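(* The system $\mathsf{RCA}_0^\omega$ proves $\Delta\text{-}\mathsf{CA}\to\mathsf{cocode}_1$ and $[\mathsf{cocode}_1+\mathsf{WKL}]\to\mathsf{HBC}_1$. Here: $\Delta\text{-}\mathsf{CA}$: for $i=0,1$, all $Y_i^2$ and $A_i(n)\equiv(\exists f\in\mathbb{N}^{\mathbb{N}})(Y_i(f,n)=0)$: $(\forall n\in\mathbb{N})(A_0(n)\leftrightarrow\neg A_1(n))\to(\exists X\subset\mathbb{N})(\forall n\in\mathbb{N})(n\in X\leftrightarrow A_0(n))$. $\mathsf{cocode}_1$: for any non-empty strongly countable set $A\subseteq[0,1]$ there is a sequence $(x_n)_{n\in\mathbb{N}}$ in $A$ such that $(\forall x\in\mathbb{R})(x\in A\leftrightarrow(\exists n\in\mathbb{N})(x_n=_{\mathbb{R}}x))$. $\mathsf{HBC}_1$: for every strongly countable $A\subset\mathbb{R}^2$ with $(\forall x\in[0,1])(\exists(a,b)\in A)(x\in(a,b))$, there are $(a_0,b_0),\dots,(a_k,b_k)\in A$ with $(\forall x\in[0,1])(\exists i\le k)(x\in(a_i,b_i))$. $\mathsf{WKL}$: weak König's lemma (every infinite binary tree has a path).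
   Context: Finite types: $0$ is a type (natural numbers), and if $\sigma,\tau$ are types then so is $\sigma\to\tau$; $1:=0\to 0$ and $n+1:=n\to 0$; superscripts indicate types. $\mathsf{L}_\omega$ is the many-sorted language with variables of every finite type, constants $0,1,<_0,+_0,\times_0,=_0$ (with usual meaning), typed combinators $\Pi,\Sigma$, and recursor constants $\mathbf{R}_\sigma$. For $\tau=(\tau_1\to\dots\to\tau_k\to 0)$, $x=_\tau y$ abbreviates $\forall z_1^{\tau_1}\dots z_k^{\tau_k}(xz_1\dots z_k=_0 yz_1\dots z_k)$. $\mathsf{QF\text{-}AC}^{\sigma,\tau}$ is the schema $(\forall x^\sigma)(\exists y^\tau)A(x,y)\to(\exists Y^{\sigma\to\tau})(\forall x^\sigma)A(x,Y(x))$ for quantifier-free $A$ of $\mathsf{L}_\omega$. $\mathsf{RCA}_0^\omega$ (Kohlenbach's base theory, classical logic) has the following axioms: ordered semi-ring axioms for $0,1,<_0,+_0,\times_0$; defining axioms of $\Pi,\Sigma$ (giving $\lambda$-abstraction); $\mathbf{R}_0(f,m,0)=m$ and $\mathbf{R}_0(f,m,n+1)=f(n,\mathbf{R}_0(f,m,n))$; extensionality $x=_\rho y\to\varphi(x)=_\tau\varphi(y)$ for all types $\rho,\tau$; induction for quantifier-free formulas of $\mathsf{L}_\omega$; and $\mathsf{QF\text{-}AC}^{1,0}$. Finite sequences and tuples are coded as usual. Inside this theory a real is a sequence of rationals $(q_n)$ with $|q_n-q_{n+i}|<2^{-n}$ for all $n,i$; reals $x,y$ represented by $(q_n),(r_n)$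 satisfy $x=_{\mathbb{R}}y$ iff $|q_n-r_n|\le 2^{-n+1}$ for all $n$. Functions on $[0,1]$, $\mathbb{R}$ or $\mathbb{R}^2$ with values in $\mathbb{N}$ or $\mathbb{R}$ are objects of the corresponding finite type that map $=_{\mathbb{R}}$-equal arguments to equal values. Subsets of $\mathbb{R}$ or $\mathbb{R}^2$ are given by characteristic functions. A set $A\subseteq\mathbb{R}$ is strongly countable if there is $Y:\mathbb{R}\to\mathbb{N}$ with $(\forall x,y\in A)(Y(x)=Y(y)\to x=_{\mathbb{R}}y)\wedge(\forall n\in\mathbb{N})(\exists x\in A)(Y(x)=n)$, and similarly for $A\subseteq\mathbb{R}^2$ with $Y:\mathbb{R}^2\to\mathbb{N}$. *)

(* Defs.v *)
From Stdlib Require Import List PeanoNat.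
Import ListNotations.

(** * Finite types and the language L_omega *)

Inductive ty : Type :=
| T0 : ty
| Arr : ty -> ty -> ty.

Notation "s ~> t" := (Arr s t) (at level 55, right associativity).
Notation T1 := (T0 ~> T0).
Notation T2 := (T1 ~> T0).

Definition ty_eq_dec (s t : ty) : {s = t} + {s <> t}.
Proof. decide equality. Defined.

(** The relation constants [=_0] and [<_0] are the atomic formulas of [fm]. *)
Inductive const : ty -> Type :=
| CZero : const T0
| COne : const T0
| CAdd : const (T0 ~> T0 ~> T0)
| CMul : const (T0 ~> T0 ~> T0)
| CPi (s t : ty) : const (s ~> t ~> s)
| CSigma (r s t : ty) : const ((r ~> s ~> t) ~> (r ~> s) ~> r ~> t)
| CRec (s : ty) : const ((T0 ~> s ~> s) ~> s ~> T0 ~> s).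

Inductive tm : ty -> Type :=
| Var (s : ty) (n : nat) : tm s
| Cst (s : ty) (c : const s) : tm s
| App (s t : ty) (f : tm (s ~> t)) (a : tm s) : tm t.

Arguments Cst {s} c.
Arguments App {s t} f a.

(** Every type has its own de Bruijn indices: [All s A] binds index 0 of type
    [s] in [A], and shifts only the other variables of type [s].  All indices
    that are not captured are free variables. *)
Inductive fm : Type :=
| Bot : fm
| Eq (a b : tm T0) : fm
| Lt (a b : tm T0) : fm
| Imp (A B : fm) : fm
| All (s : ty) (A : fm) : fm.

Declare Scope lomega_scope.
Delimit Scope lomega_scope with L.
Local Open Scope lomega_scope.

Notation "f @ a" := (App f a) (at level 24, left associativity) : lomega_scope.
Notation "0" := (Cst CZero) : lomega_scope.
Notation "1" := (Cst COne) : lomega_scope.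
Notation "a + b" := (Cst CAdd @ a @ b) : lomega_scope.
Notation "a * b" := (Cst CMul @ a @ b) : lomega_scope.
Notation "a == b" := (Eq a b) (at level 70, no associativity) : lomega_scope.
Notation "a < b" := (Lt a b) : lomega_scope.
Notation "A ==> B" := (Imp A B) (at level 85, right associativity) : lomega_scope.

(** Classical definitions of the remaining connectives. *)
Definition Not (A : fm) : fm := A ==> Bot.
Definition And (A B : fm) : fm := Not (A ==> Not B).
Definition Or (A B : fm) : fm := Not A ==> B.
Definition Iff (A B : fm) : fm := And (A ==> B) (B ==> A).
Definition Ex (s : ty) (A : fm) : fm := Not (All s (Not A)).

Notation "A &&& B" := (And A B) (at level 80, right associativity) : lomega_scope.
Notation "A ||| B" := (Or A B) (at level 82, right associativity) : lomega_scope.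
Notation "A <=> B" := (Iff A B) (at level 87, no associativity) : lomega_scope.

Fixpoint qf (A : fm) : Prop :=
  match A with
  | Bot | Eq _ _ | Lt _ _ => True
  | Imp A B => qf A /\ qf B
  | All _ _ => False
  end.

(** * Substitution *)

Definition sub : Type := forall s : ty, nat -> tm s.

Definition ids : sub := Var.

Fixpoint tm_sub (f : sub) (s : ty) (a : tm s) : tm s :=
  match a in tm s return tm s with
  | Var s n => f s n
  | Cst c => Cst c
  | App g b => App (tm_sub f _ g) (tm_sub f _ b)
  end.
Arguments tm_sub f {s} a.

Definition shift (s : ty) : sub := fun t n =>
  if ty_eq_dec s t then Var t (S n) else Var t n.

Definition up (s : ty) (f : sub) : sub := fun t n =>
  if ty_eq_dec s t
  then match n with
       | O => Var t O
       | S m => tm_sub (shift s) (f t m)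
       end
  else tm_sub (shift s) (f t n).

Fixpoint fm_sub (f : sub) (A : fm) : fm :=
  match A with
  | Bot => Bot
  | Eq a b => Eq (tm_sub f a) (tm_sub f b)
  | Lt a b => Lt (tm_sub f a) (tm_sub f b)
  | Imp A B => Imp (fm_sub f A) (fm_sub f B)
  | All s A => All s (fm_sub (up s f) A)
  end.

Definition cast {s t : ty} (e : s = t) (a : tm s) : tm t := eq_rect s tm a t e.

(** The substitution that eliminates the quantifier of [All s]. *)
Definition scons {s : ty} (a : tm s) : sub := fun t n =>
  match ty_eq_dec s t with
  | left e => match n with O => cast e a | S m => Var t m end
  | right _ => Var t n
  end.

Definition inst {s : ty} (a : tm s) (A : fm) : fm := fm_sub (scons a) A.

(** Replaces variable 0 of type [s] by [a] and leaves all others in place,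
    unlike [inst], which lowers the other indices of type [s]. *)
Definition replace0 {s : ty} (a : tm s) : sub := fun t n =>
  match ty_eq_dec s t with
  | left e => match n with O => cast e a | S _ => Var t n end
  | right _ => Var t n
  end.

(** * The system RCA_0^omega *)

(** Equality at type [t1 -> ... -> tk -> 0] abbreviates pointwise equality. *)
Fixpoint EqT (t : ty) : tm t -> tm t -> fm :=
  match t return tm t -> tm t -> fm with
  | T0 => fun a b => a == b
  | Arr s r => fun a b =>
      All s (EqT r (tm_sub (shift s) a @ Var s 0) (tm_sub (shift s) b @ Var s 0))
  end.

(** Axioms may contain free variables, which stand for their universal
    closures.  The last two ordered semi-ring axioms express that [<_0] is the
    discrete order of the natural numbers; they are redundant in the presence
    of [R_0] and quantifier-free induction. *)
Inductive axiom : fm -> Prop :=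
| ax_addA a b c : axiom (a + (b + c) == (a + b) + c)
| ax_addC a b : axiom (a + b == b + a)
| ax_add0 a : axiom (a + 0 == a)
| ax_mulA a b c : axiom (a * (b * c) == (a * b) * c)
| ax_mulC a b : axiom (a * b == b * a)
| ax_mul1 a : axiom (a * 1 == a)
| ax_mul0 a : axiom (a * 0 == 0)
| ax_mulD a b c : axiom (a * (b + c) == a * b + a * c)
| ax_lt_irr a : axiom (Not (a < a))
| ax_lt_trans a b c : axiom (a < b ==> b < c ==> a < c)
| ax_lt_total a b : axiom (a < b ||| a == b ||| b < a)
| ax_lt_add a b c : axiom (a < b ==> a + c < b + c)
| ax_lt_mul a b c : axiom (a < b ==> 0 < c ==> a * c < b * c)
| ax_lt01 : axiom (0 < 1)
| ax_ge0 a : axiom (Not (a < 0))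
| ax_lt_succ a b : axiom (a < b + 1 ==> a < b ||| a == b)
| ax_Pi s t (x : tm s) (y : tm t) :
    axiom (EqT s (Cst (CPi s t) @ x @ y) x)
| ax_Sigma r s t (x : tm (r ~> s ~> t)) (y : tm (r ~> s)) (z : tm r) :
    axiom (EqT t (Cst (CSigma r s t) @ x @ y @ z) (x @ z @ (y @ z)))
| ax_R0_zero f m :
    axiom (Cst (CRec T0) @ f @ m @ 0 == m)
| ax_R0_succ f m n :
    axiom (Cst (CRec T0) @ f @ m @ (n + 1) == f @ n @ (Cst (CRec T0) @ f @ m @ n))
| ax_ext r t (x y : tm r) (f : tm (r ~> t)) :
    axiom (EqT r x y ==> EqT t (f @ x) (f @ y))
(** [A] is [A(n)] with [n] the variable 0 of type 0. *)
| ax_ind A :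
    qf A ->
    axiom (inst 0 A ==> All T0 (A ==> fm_sub (replace0 (Var T0 0 + 1)) A) ==> All T0 A)
(** [A] is [A(x, y)] with [x] the variable 0 of type 1 and [y] the variable 0
    of type 0; the shift makes room for the quantifier over [Y]. *)
| ax_QFAC10 A :
    qf A ->
    axiom (All T1 (Ex T0 A) ==>
           Ex (T1 ~> T0) (All T1
             (inst (Var (T1 ~> T0) 0 @ Var T1 0) (fm_sub (shift (T1 ~> T0)) A)))).

(** Natural deduction for many-sorted classical logic with equality. *)
Inductive prv : list fm -> fm -> Prop :=
| prv_hyp G A : In A G -> prv G A
| prv_ax G A : axiom A -> prv G A
| prv_impI G A B : prv (A :: G) B -> prv G (A ==> B)
| prv_impE G A B : prv G (A ==> B) -> prv G A -> prv G B
| prv_raa G A : prv (Not A :: G) Bot -> prv G A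
| prv_allI G s A : prv (map (fm_sub (shift s)) G) A -> prv G (All s A)
| prv_allE G s A (a : tm s) : prv G (All s A) -> prv G (inst a A)
| prv_refl G a : prv G (a == a)
| prv_leibniz G a b A : prv G (a == b) -> prv G (inst a A) -> prv G (inst b A).

Definition RCA0w_proves (A : fm) : Prop := prv [] A.

(** * Named binders *)

(** [all s i (fun x => A)] is the usual [forall x^s A] where [x] is the free
    variable of type [s] with index [i]; the indices of nested binders of the
    same type are to be chosen distinct. *)
Definition bind (s : ty) (i : nat) : sub := fun t n =>
  if ty_eq_dec s t
  then if Nat.eqb n i then Var t 0 else Var t (S n)
  else Var t n.

Definition all (s : ty) (i : nat) (F : tm s -> fm) : fm :=
  All s (fm_sub (bind s i) (F (Var s i))).
Definition ex (s : ty) (i : nat) (F : tm s -> fm) : fm :=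
  Ex s (fm_sub (bind s i) (F (Var s i))).

(** Bracket abstraction of variable [i] of type [s]. *)
Fixpoint abs (s : ty) (i : nat) (t : ty) (a : tm t) : tm (s ~> t) :=
  match a in tm t return tm (s ~> t) with
  | Var t n =>
      match ty_eq_dec s t with
      | left e =>
          if Nat.eqb n i
          then eq_rect s (fun t => tm (s ~> t))
                 (Cst (CSigma s (s ~> s) s) @ Cst (CPi s (s ~> s)) @ Cst (CPi s s)) t e
          else Cst (CPi t s) @ Var t n
      | right _ => Cst (CPi t s) @ Var t n
      end
  | Cst c => Cst (CPi _ s) @ Cst c
  | App f b => Cst (CSigma s _ _) @ abs s i _ f @ abs s i _ b
  end.

Definition lam (s : ty) (i : nat) {t : ty} (F : tm s -> tm t) : tm (s ~> t) :=
  abs s i t (F (Var s i)).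

(** A formula with parameters [x_0, ..., x_k], all of type [s], is written with
    the variables [0, ..., k] of type [s] in the place of the parameters (so
    binders of type [s] inside it have index [> k]); the actual parameters are
    then put in by capture-avoiding simultaneous substitution. *)
Definition args {s : ty} (l : list (tm s)) : sub := fun t n =>
  match ty_eq_dec s t with
  | left e => cast e (nth n l (Var s n))
  | right _ => Var t n
  end.

Definition pred1 {s : ty} (F : tm s -> fm) (a : tm s) : fm :=
  fm_sub (args [a]) (F (Var s 0)).
Definition pred2 {s : ty} (F : tm s -> tm s -> fm) (a b : tm s) : fm :=
  fm_sub (args [a; b]) (F (Var s 0) (Var s 1)).
Definition pred3 {s : ty} (F : tm s -> tm s -> tm s -> fm) (a b c : tm s) : fm :=
  fm_sub (args [a; b; c]) (F (Var s 0) (Var s 1) (Var s 2)).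

(** * Coding *)

(** [(a + b)^2 + a], an injective pairing of the natural numbers. *)
Definition pair (a b : tm T0) : tm T0 := (a + b) * (a + b) + a.

(** The code of the rational [(a - b) / (c + 1)]. *)
Definition rat (a b c : tm T0) : tm T0 := pair (pair a b) c.

(** [pow2 n = 2^n] *)
Definition pow2 : tm T1 :=
  Cst (CRec T0) @ lam T0 0 (fun _ => lam T0 1 (fun m => m + m)) @ 1.

(** [push n f] is the sequence [n, f(0), f(1), ...], which codes the pair
    [(f, n)] as an object of type 1. *)
Definition push : tm (T0 ~> T1 ~> T1) :=
  lam T0 2 (fun n => lam T1 0 (fun f =>
    Cst (CRec T0) @ lam T0 0 (fun k => lam T0 1 (fun _ => f @ k)) @ n)).

(** [init f n] is the code of the finite sequence [f(0), ..., f(n-1)]; the empty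
    sequence has code 0 and [s * <k>] has code [pair s k + 1]. *)
Definition init : tm (T1 ~> T0 ~> T0) :=
  lam T1 0 (fun f =>
    Cst (CRec T0) @ lam T0 0 (fun k => lam T0 1 (fun s => pair s (f @ k) + 1)) @ 0).

(** For [q = (a - b)/(c + 1)] and [r = (a' - b')/(c' + 1)], the body [F] is applied
    to natural numbers [L], [M], [D] with [q - r = (L - M) / D].  The terms [q], [r]
    and the body must not otherwise mention the variables 3 to 8 of type 0. *)
Definition with_rats (F : tm T0 -> tm T0 -> tm T0 -> fm) (q r : tm T0) : fm :=
  ex T0 3 (fun a => ex T0 4 (fun b => ex T0 5 (fun c =>
  ex T0 6 (fun a' => ex T0 7 (fun b' => ex T0 8 (fun c' =>
    q == rat a b c &&& r == rat a' b' c' &&&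
    F (a * (c' + 1) + b' * (c + 1)) (a' * (c + 1) + b * (c' + 1))
      ((c + 1) * (c' + 1)))))))).

(** [q < r + 2^(-n)] for codes [q], [r] of rationals. *)
Definition rat_lt : tm T0 -> tm T0 -> tm T0 -> fm := pred3 (fun q r n =>
  with_rats (fun L M D => L * (pow2 @ n) < M * (pow2 @ n) + D) q r).

(** [q <= r + 2^(-n+1)] for codes [q], [r] of rationals. *)
Definition rat_le : tm T0 -> tm T0 -> tm T0 -> fm := pred3 (fun q r n =>
  with_rats (fun L M D => Not (M * (pow2 @ n) + (D + D) < L * (pow2 @ n))) q r).

(** * Real numbers, functions and sets *)

Definition is_real : tm T1 -> fm := pred1 (fun x =>
  all T0 0 (fun n => all T0 1 (fun i =>
    rat_lt (x @ n) (x @ (n + i)) n &&& rat_lt (x @ (n + i)) (x @ n) n))).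

Definition eq_R : tm T1 -> tm T1 -> fm := pred2 (fun x y =>
  all T0 0 (fun n => rat_le (x @ n) (y @ n) n &&& rat_le (y @ n) (x @ n) n)).

Definition le_R : tm T1 -> tm T1 -> fm := pred2 (fun x y =>
  all T0 0 (fun n => rat_le (x @ n) (y @ n) n)).

Definition lt_R (x y : tm T1) : fm := Not (le_R y x).

Definition zero_R : tm T1 := lam T0 0 (fun _ => rat 0 0 0).
Definition one_R : tm T1 := lam T0 0 (fun _ => rat 1 0 0).

Definition in_unit (x : tm T1) : fm :=
  is_real x &&& le_R zero_R x &&& le_R x one_R.

Definition is_bit (a : tm T0) : fm := a == 0 ||| a == 1.

(** A function R -> N is an object of type 1 -> 0, and a function R^2 -> N one of
    type 1 -> 1 -> 0; their values outside the reals are irrelevant. *)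
Definition fun_R : tm (T1 ~> T0) -> fm := pred1 (fun F =>
  all T1 0 (fun x => all T1 1 (fun y =>
    is_real x ==> is_real y ==> eq_R x y ==> F @ x == F @ y))).

Definition fun_R2 : tm (T1 ~> T1 ~> T0) -> fm := pred1 (fun F =>
  all T1 0 (fun x => all T1 1 (fun y => all T1 2 (fun x' => all T1 3 (fun y' =>
    is_real x ==> is_real y ==> is_real x' ==> is_real y' ==>
    eq_R x x' ==> eq_R y y' ==> F @ x @ y == F @ x' @ y'))))).

Definition set_N : tm T1 -> fm := pred1 (fun X =>
  all T0 0 (fun n => is_bit (X @ n))).

Definition set_R : tm (T1 ~> T0) -> fm := pred1 (fun A =>
  fun_R A &&& all T1 0 (fun x => is_real x ==> is_bit (A @ x))).

Definition set_R2 : tm (T1 ~> T1 ~> T0) -> fm := pred1 (fun A =>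
  fun_R2 A &&& all T1 0 (fun x => all T1 1 (fun y =>
    is_real x ==> is_real y ==> is_bit (A @ x @ y)))).

Definition mem_N (n : tm T0) (X : tm T1) : fm := X @ n == 1.
Definition mem_R (x : tm T1) (A : tm (T1 ~> T0)) : fm := is_real x &&& A @ x == 1.
Definition mem_R2 (x y : tm T1) (A : tm (T1 ~> T1 ~> T0)) : fm :=
  is_real x &&& is_real y &&& A @ x @ y == 1.

Definition strongly_countable : tm (T1 ~> T0) -> fm := pred1 (fun A =>
  ex (T1 ~> T0) 1 (fun Y =>
    fun_R Y &&&
    all T1 0 (fun x => all T1 1 (fun y =>
      mem_R x A ==> mem_R y A ==> Y @ x == Y @ y ==> eq_R x y)) &&&
    all T0 0 (fun n => ex T1 0 (fun x => mem_R x A &&& Y @ x == n)))).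

Definition strongly_countable2 : tm (T1 ~> T1 ~> T0) -> fm := pred1 (fun A =>
  ex (T1 ~> T1 ~> T0) 1 (fun Y =>
    fun_R2 Y &&&
    all T1 0 (fun x => all T1 1 (fun y => all T1 2 (fun x' => all T1 3 (fun y' =>
      mem_R2 x y A ==> mem_R2 x' y' A ==> Y @ x @ y == Y @ x' @ y' ==>
      eq_R x x' &&& eq_R y y')))) &&&
    all T0 0 (fun n => ex T1 0 (fun x => ex T1 1 (fun y =>
      mem_R2 x y A &&& Y @ x @ y == n))))).

(** * The principles *)

Definition Delta_CA : fm :=
  all T2 0 (fun Y0 => all T2 1 (fun Y1 =>
    all T0 0 (fun n =>
      ex T1 0 (fun f => Y0 @ (push @ n @ f) == 0) <=>
      Not (ex T1 0 (fun f => Y1 @ (push @ n @ f) == 0))) ==>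
    ex T1 1 (fun X => set_N X &&& all T0 0 (fun n =>
      mem_N n X <=> ex T1 0 (fun f => Y0 @ (push @ n @ f) == 0))))).

Definition cocode1 : fm :=
  all (T1 ~> T0) 0 (fun A =>
    set_R A ==>
    all T1 0 (fun x => mem_R x A ==> in_unit x) ==>
    ex T1 0 (fun x => mem_R x A) ==>
    strongly_countable A ==>
    ex (T0 ~> T1) 0 (fun xs =>
      all T0 0 (fun n => mem_R (xs @ n) A) &&&
      all T1 0 (fun x => is_real x ==>
        (mem_R x A <=> ex T0 0 (fun n => eq_R (xs @ n) x))))).

(** The finite list of pairs is given by its last index [k] and two sequences
    [a], [b] of reals, of which only the first [k + 1] entries are used. *)
Definition HBC1 : fm :=
  all (T1 ~> T1 ~> T0) 0 (fun A =>
    set_R2 A ==>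
    strongly_countable2 A ==>
    all T1 0 (fun x => in_unit x ==>
      ex T1 1 (fun a => ex T1 2 (fun b =>
        mem_R2 a b A &&& lt_R a x &&& lt_R x b))) ==>
    ex T0 0 (fun k => ex (T0 ~> T1) 0 (fun a => ex (T0 ~> T1) 1 (fun b =>
      all T0 1 (fun i => i < k + 1 ==> mem_R2 (a @ i) (b @ i) A) &&&
      all T1 0 (fun x => in_unit x ==>
        ex T0 1 (fun i => i < k + 1 &&& lt_R (a @ i) x &&& lt_R x (b @ i))))))).

(** A binary tree: a set of codes of finite 0-1-sequences that is closed under
    initial segments. *)
Definition binary_tree : tm T1 -> fm := pred1 (fun T =>
  set_N T &&&
  all T0 0 (fun s => mem_N s T ==>
    ex T1 1 (fun f => ex T0 1 (fun n => set_N f &&& s == init @ f @ n))) &&&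
  all T1 1 (fun f => all T0 0 (fun m => all T0 1 (fun n =>
    set_N f ==> m < n ==> mem_N (init @ f @ n) T ==> mem_N (init @ f @ m) T)))).

Definition infinite_N : tm T1 -> fm := pred1 (fun X =>
  all T0 0 (fun k => ex T0 1 (fun n => k < n &&& mem_N n X))).

Definition WKL : fm :=
  all T1 0 (fun T => binary_tree T ==> infinite_N T ==>
    ex T1 1 (fun f => set_N f &&& all T0 0 (fun n => mem_N (init @ f @ n) T))).

(* Main.v *)
(** A formula that holds in all models of RCA_0^omega is provable (Henkin's
    construction, with fresh variables as witnesses), so both implications are
    proved in an arbitrary model [M]; by extensionality, its elements of type
    [s -> t] may be seen as functions.  The natural numbers of [M] may be
    nonstandard; they generate an ordered field [frac M] in which the rationals
    of [M] are evaluated.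

    Under the hypotheses of [cocode1] and of [HBC1] there is a function on the
    reals that takes two different values: the characteristic function of [A], or
    else the injection of [A] into the natural numbers.  Bisection gives a point
    where it is discontinuous, and Grilliot's trick turns a discontinuous function
    into a functional [mu] searching for zeros of number-theoretic functions.
    With [mu] all arithmetical formulas are decidable.

    Delta_CA -> cocode1: the Dedekind cut of a real depends only on the real, so
    the cut of the element of [A] with number [n] is Delta-definable from [n].

    cocode1 -> HBC1: with [mu], pairs of reals are coded injectively in [0, 1], so
    cocode1 enumerates the given cover, and bisection yields a finite subcover. *)
From Stdlib Require Eqdep_dec.
From HB Require Import structures.
From Pilot Require Import -(notations) Defs.

(** [Defs] and ssreflect give [==>] and [@] incompatible precedences, so ssreflect
    is imported in this module only, and the notations of [Defs] only after it. *)
Module Models.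

From mathcomp Require Import all_boot all_order ssralg ssrnum boolp ring lra.
Import Order.TTheory GRing.Theory Num.Theory.

Set Implicit Arguments.
Unset Strict Implicit.
Unset Printing Implicit Defensive.

(** * Substitution *)

(** A function between the carriers of a model can be shown to be an object of the model only by
    building it from combinators, recursion on numbers and quantifier-free choice. So every
    construction is accompanied by a proof of representability, and induction applies only to
    predicates whose characteristic function is represented. The two values of that function arise
    as follows. A set as in [cocode1] has an element but omits 2. For a cover [A], either (0,0) or
    (1,0) is missing while [A] has a member, or both lie in [A] and the injection gives them
    different numbers. [Delta_CA] quantifies over sequences, that is over representations of a real,
    whereas the injection fixes an element only up to equality of reals; the cut removes this
    ambiguity. Pairs are coded through their cuts for the same reason. *)

Lemma ty_eq_decE s : ty_eq_dec s s = left erefl.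
Proof. by case: ty_eq_dec => // e; congr left; exact: Prop_irrelevance. Qed.

Lemma ty_eq_decN s t (ne : s <> t) : ty_eq_dec s t = right ne.
Proof. by case: ty_eq_dec => // e; congr right; exact: Prop_irrelevance. Qed.

Lemma dep2_ext (T : ty -> Type) (f g : forall s, nat -> T s) :
  (forall s n, f s n = g s n) -> f = g.
Proof.
move=> fg; apply: functional_extensionality_dep => s.
by apply: funext => n.
Qed.

Section SubRules.
Variables (s : ty) (f : sub) (a : tm s).

Lemma up_0 : up s f s 0 = Var s 0.
Proof. by rewrite /up ty_eq_decE. Qed.
Lemma up_S n : up s f s n.+1 = tm_sub (shift s) (f s n).
Proof. by rewrite /up ty_eq_decE. Qed.
Lemma up_ne t n : s <> t -> up s f t n = tm_sub (shift s) (f t n).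
Proof. by move=> ne; rewrite /up ty_eq_decN. Qed.
Lemma shift_eq n : shift s s n = Var s n.+1.
Proof. by rewrite /shift ty_eq_decE. Qed.
Lemma shift_ne t n : s <> t -> shift s t n = Var t n.
Proof. by move=> ne; rewrite /shift ty_eq_decN. Qed.
Lemma scons_0 : scons a s 0 = a.
Proof. by rewrite /scons ty_eq_decE. Qed.
Lemma scons_S n : scons a s n.+1 = Var s n.
Proof. by rewrite /scons ty_eq_decE. Qed.
Lemma scons_ne t n : s <> t -> scons a t n = Var t n.
Proof. by move=> ne; rewrite /scons ty_eq_decN. Qed.
Lemma replace0_0 : replace0 a s 0 = a.
Proof. by rewrite /replace0 ty_eq_decE. Qed.
Lemma replace0_S n : replace0 a s n.+1 = Var s n.+1.
Proof. by rewrite /replace0 ty_eq_decE. Qed.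
Lemma replace0_ne t n : s <> t -> replace0 a t n = Var t n.
Proof. by move=> ne; rewrite /replace0 ty_eq_decN. Qed.

End SubRules.

Definition subE := (up_0, up_S, shift_eq, scons_0, scons_S, replace0_0, replace0_S).

Definition scomp (f g : sub) : sub := fun s n => tm_sub g (f s n).

Lemma tm_sub_comp f g s (a : tm s) : tm_sub g (tm_sub f a) = tm_sub (scomp f g) a.
Proof. by elim: a => //= s' t u -> a ->. Qed.

Lemma shift_up s f : scomp (shift s) (up s f) = scomp f (shift s).
Proof.
apply: dep2_ext => t n; rewrite /scomp.
case: (ty_eq_dec s t) => [<-|ne]; first by rewrite shift_eq /= up_S.
by rewrite shift_ne //= up_ne.
Qed.

Lemma up_comp s f g : up s (scomp f g) = scomp (up s f) (up s g).
Proof.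
apply: dep2_ext => t n; rewrite /scomp.
case: (ty_eq_dec s t) => [<-|ne]; last by rewrite !up_ne // !tm_sub_comp shift_up.
by case: n => [|n]; rewrite !subE //= ?subE // !tm_sub_comp shift_up.
Qed.

Lemma fm_sub_comp f g A : fm_sub g (fm_sub f A) = fm_sub (scomp f g) A.
Proof.
by elim: A f g => //= [a b|a b|A IHA B IHB|s A IH] f g;
   rewrite ?tm_sub_comp ?IHA ?IHB ?IH ?up_comp.
Qed.

Lemma tm_sub_ids s (a : tm s) : tm_sub ids a = a.
Proof. by elim: a => //= s' t u -> a ->. Qed.

Lemma up_ids s : up s ids = ids.
Proof.
apply: dep2_ext => t n; case: (ty_eq_dec s t) => [<-|ne]; last by rewrite up_ne //= shift_ne.
by case: n => [|n]; rewrite subE //= subE.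
Qed.

Lemma fm_sub_ids A : fm_sub ids A = A.
Proof.
by elim: A => //= [a b|a b|A -> B ->|s A IH] //; rewrite ?tm_sub_ids // up_ids IH.
Qed.

Lemma scomp_shift_scons s (a : tm s) : scomp (shift s) (scons a) = ids.
Proof.
apply: dep2_ext => t n; rewrite /scomp; case: (ty_eq_dec s t) => [<-|ne].
  by rewrite !subE /= subE.
by rewrite shift_ne //= scons_ne.
Qed.

Lemma scons_shift s (a : tm s) t (b : tm t) : tm_sub (scons a) (tm_sub (shift s) b) = b.
Proof. by rewrite tm_sub_comp scomp_shift_scons tm_sub_ids. Qed.

Lemma scons_comp s (a : tm s) f : scomp (scons a) f = scomp (up s f) (scons (tm_sub f a)).
Proof.
apply: dep2_ext => u n; rewrite /scomp; case: (ty_eq_dec s u) => [<-|ne].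
  by case: n => [|n]; rewrite !subE /= ?subE ?scons_shift.
by rewrite up_ne // scons_ne //= scons_shift.
Qed.

Lemma fm_sub_inst s (a : tm s) f A :
  fm_sub f (inst a A) = inst (tm_sub f a) (fm_sub (up s f) A).
Proof. by rewrite /inst !fm_sub_comp scons_comp. Qed.

Lemma fm_sub_shift s f A : fm_sub (up s f) (fm_sub (shift s) A) = fm_sub (shift s) (fm_sub f A).
Proof. by rewrite !fm_sub_comp shift_up. Qed.

Lemma tm_sub_shift s f t (a : tm t) :
  tm_sub (up s f) (tm_sub (shift s) a) = tm_sub (shift s) (tm_sub f a).
Proof. by rewrite !tm_sub_comp shift_up. Qed.

Lemma EqT_sub t (a b : tm t) f : fm_sub f (EqT t a b) = EqT t (tm_sub f a) (tm_sub f b).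
Proof.
elim: t a b f => [//|s _ t IH] a b f /=.
by rewrite IH /= !tm_sub_shift subE.
Qed.

Lemma inst_EqT s t (a b : tm (Arr s t)) (c : tm s) :
  inst c (EqT t (App (tm_sub (shift s) a) (Var s 0)) (App (tm_sub (shift s) b) (Var s 0)))
  = EqT t (App a c) (App b c).
Proof. by rewrite /inst EqT_sub /= !scons_shift subE. Qed.

Lemma qf_sub A f : qf A -> qf (fm_sub f A).
Proof. by elim: A f => //= A IHA B IHB f [/IHA ? /IHB ?]. Qed.

(** Needed for the induction axiom, whose step replaces variable 0 by [Var T0 0 + 1], a term that a
    lifted substitution leaves unchanged. *)
Lemma replace0_up s (a : tm s) f :
  tm_sub (up s f) a = a -> scomp (replace0 a) (up s f) = scomp (up s f) (replace0 a).
Proof.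
move=> fa; have re t (b : tm t) : tm_sub (replace0 a) (tm_sub (shift s) b) = tm_sub (shift s) b.
  rewrite tm_sub_comp; suff -> : scomp (shift s) (replace0 a) = shift s by [].
  apply: dep2_ext => u n; rewrite /scomp; case: (ty_eq_dec s u) => [<-|ne]; first by rewrite subE /= subE.
  by rewrite shift_ne //= replace0_ne.
apply: dep2_ext => u n; rewrite /scomp; case: (ty_eq_dec s u) => [<-|ne].
  by case: n => [|n]; rewrite !subE /= ?subE ?fa ?re.
by rewrite replace0_ne //= up_ne // re.
Qed.

(** Each type has its own indices, so binders of different types do not interact. The choice axiom
    needs this: its conclusion has an additional quantifier over [Y]. *)
Lemma up_up s t f : s <> t -> up s (up t f) = up t (up s f).
Proof.
move=> ne; have ne' := nesym ne.
have sh : scomp (shift s) (shift t) = scomp (shift t) (shift s).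
  apply: dep2_ext => u n; rewrite /scomp.
  case: (ty_eq_dec s u) => [<-|su]; first by rewrite (shift_ne _ ne') /= !shift_eq /= shift_ne.
  rewrite (shift_ne _ su) /=; case: (ty_eq_dec t u) => [tu|tu].
    by rewrite -tu subE /= shift_ne.
  by rewrite shift_ne //= shift_ne.
have shE u (a : tm u) : tm_sub (shift s) (tm_sub (shift t) a) = tm_sub (shift t) (tm_sub (shift s) a).
  by rewrite !tm_sub_comp sh.
apply: dep2_ext => u n; case: (ty_eq_dec s u) => [<-|su].
  rewrite [RHS]up_ne //; case: n => [|n]; rewrite !subE /= ?shift_ne //.
  by rewrite up_ne // shE.
rewrite up_ne //; case: (ty_eq_dec t u) => [<-|tu].
  by case: n => [|n]; rewrite !subE /= ?shift_ne // up_ne // shE.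
by rewrite !up_ne // shE.
Qed.

Lemma axiom_sub A f : axiom A -> axiom (fm_sub f A).
Proof.
case=> [a b c|a b|a|a b c|a b|a|a|a b c|a|a b c|a b|a b c|a b c||a|a b|s t x y|r s t x y z|g m
  |g m n|r t x y g|B qB|B qB] /=; rewrite ?EqT_sub /=; try by constructor.
- rewrite fm_sub_inst /= fm_sub_comp replace0_up ?/= ?subE // -fm_sub_comp.
  by apply: ax_ind; apply: qf_sub.
- rewrite fm_sub_inst /= !subE /= up_ne // up_0 /= shift_ne //.
  rewrite (@up_up T1 (Arr T1 T0)) // (@up_up T0 (Arr T1 T0)) // fm_sub_shift.
  by apply: (@ax_QFAC10 (fm_sub (up T0 (up T1 f)) B)); apply: qf_sub.
Qed.

(** * Derivations *)

Arguments prv_impE {G A B} _ _.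
Arguments prv_leibniz {G a b A} _ _.
Arguments prv_allE {G s A} a _.

Lemma prv_weaken G A : prv G A -> forall G', List.incl G G' -> prv G' A.
Proof.
elim=> {G A} [G A h|G A h|G A B _ IH|G A B _ IH1 _ IH2|G A _ IH|G s A _ IH|G s A a _ IH|G a
  |G a b A _ IH1 _ IH2] G' sG.
- by apply: prv_hyp; apply: sG.
- exact: prv_ax.
- apply: prv_impI; apply: IH => B' /= [->|/sG]; by [left|right].
- exact: prv_impE (IH1 _ sG) (IH2 _ sG).
- apply: prv_raa; apply: IH => B' /= [->|/sG]; by [left|right].
- by apply: prv_allI; apply: IH; apply: List.incl_map.
- exact/prv_allE/IH.
- exact: prv_refl.
- exact: prv_leibniz (IH1 _ sG) (IH2 _ sG).
Qed.

Lemma prv_sub G A f : prv G A -> prv (List.map (fm_sub f) G) (fm_sub f A).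
Proof.
move=> h; elim: h f => {G A} [G A h|G A h|G A B _ IH|G A B _ IH1 _ IH2|G A _ IH|G s A _ IH
  |G s A a _ IH|G a|G a b A _ IH1 _ IH2] f /=.
- by apply: prv_hyp; apply: List.in_map.
- by apply: prv_ax; apply: axiom_sub.
- exact/prv_impI/IH.
- exact: prv_impE (IH1 f) (IH2 f).
- exact/prv_raa/(IH f).
- apply: prv_allI; move: (IH (up s f)).
  by rewrite !List.map_map; under List.map_ext => B do rewrite fm_sub_shift.
- rewrite fm_sub_inst; exact/prv_allE/(IH f).
- exact: prv_refl.
- rewrite fm_sub_inst; apply: prv_leibniz (IH1 f) _.
  by have := IH2 f; rewrite fm_sub_inst.
Qed.

Fixpoint tm_idx s (a : tm s) : nat :=
  match a with
  | Var _ n => n.+1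
  | Cst _ _ => 0
  | App _ _ g b => maxn (tm_idx g) (tm_idx b)
  end.

(** Bound variables count as well, so this is only an upper bound for the free
    indices. *)
Fixpoint fm_idx (A : fm) : nat :=
  match A with
  | Bot => 0
  | Eq a b | Lt a b => maxn (tm_idx a) (tm_idx b)
  | Imp A B => maxn (fm_idx A) (fm_idx B)
  | All _ A => fm_idx A
  end.

Lemma tm_sub_agree k (f g : sub) s (a : tm s) :
  (forall t n, n < k -> f t n = g t n) -> tm_idx a <= k -> tm_sub f a = tm_sub g a.
Proof.
move=> fg; elim: a => //= s' t u IHu b IHb.
by rewrite geq_max => /andP[/IHu -> /IHb ->].
Qed.

Lemma fm_sub_agree k (f g : sub) A :
  (forall t n, n < k -> f t n = g t n) -> fm_idx A <= k -> fm_sub f A = fm_sub g A.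
Proof.
elim: A f g => //= [a b|a b|A IHA B IHB|s A IH] f g fg; rewrite ?geq_max.
- by move=> /andP[/(tm_sub_agree fg) -> /(tm_sub_agree fg) ->].
- by move=> /andP[/(tm_sub_agree fg) -> /(tm_sub_agree fg) ->].
- by move=> /andP[/(IHA _ _ fg) -> /(IHB _ _ fg) ->].
- move=> Ak; rewrite (IH (up s f) (up s g)) // => t n nk.
  case: (ty_eq_dec s t) => [<-|ne]; last by rewrite !up_ne // fg.
  by case: n nk => [|n] nk; rewrite !subE // fg // ltnW.
Qed.

Definition ctx_idx (G : list fm) : nat := \max_(A <- G) fm_idx A.

Lemma ctx_idx_in G A : List.In A G -> fm_idx A <= ctx_idx G.
Proof.
rewrite /ctx_idx; elim: G => //= B G IH [->|/IH AG]; rewrite big_cons ?leq_maxl //.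
by rewrite leq_max AG orbT.
Qed.

(** Substituting [bind s k] into the derivation turns the fresh variable [k] into the variable to be
    bound; it acts on the context as [shift s] and sends the instance back to [B]. *)
Lemma prv_fresh G s k B : ctx_idx G <= k -> fm_idx B <= k ->
  prv G (inst (Var s k) B) -> prv G (All s B).
Proof.
move=> Gk Bk /(prv_sub (bind s k)) h; apply: prv_allI.
have -> : List.map (fm_sub (shift s)) G = List.map (fm_sub (bind s k)) G.
  apply: List.map_ext_in => A /ctx_idx_in AG.
  apply: (@fm_sub_agree k) => [t n nk|]; last exact: leq_trans AG Gk.
  rewrite /shift /bind; case: ty_eq_dec => // e.
  by case: (PeanoNat.Nat.eqb_spec n k) nk => // ->; rewrite ltnn.
suff <- : fm_sub (bind s k) (inst (Var s k) B) = B by [].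
rewrite /inst fm_sub_comp -[RHS]fm_sub_ids; apply: (@fm_sub_agree k) => // t n nk.
rewrite /scomp /ids; case: (ty_eq_dec s t) => [<-|ne]; last first.
  by rewrite scons_ne //= /bind ty_eq_decN.
case: n nk => [|n] nk; rewrite subE /= /bind ty_eq_decE ?PeanoNat.Nat.eqb_refl //.
by case: (PeanoNat.Nat.eqb_spec n k) nk => // ->; rewrite ltnNge leqnSn.
Qed.

(** * Countability of the language *)

Import GenTree.

(** Finite trees labelled by natural numbers form a countable type, so injectivity of the codes
    already yields an enumeration of all formulas. *)
Fixpoint ty_code (s : ty) : GenTree.tree nat :=
  match s with T0 => Leaf 0 | Arr s t => Node 0 [:: ty_code s; ty_code t] end.

Definition const_code s (c : const s) : GenTree.tree nat :=
  match c with
  | CZero => Node 0 [::]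
  | COne => Node 1 [::]
  | CAdd => Node 2 [::]
  | CMul => Node 3 [::]
  | CPi s t => Node 4 [:: ty_code s; ty_code t]
  | CSigma r s t => Node 5 [:: ty_code r; ty_code s; ty_code t]
  | CRec s => Node 6 [:: ty_code s]
  end.

Fixpoint tm_code s (a : tm s) : GenTree.tree nat :=
  match a with
  | Var s n => Node 0 [:: ty_code s; Leaf n]
  | Cst _ c => Node 1 [:: const_code c]
  | App _ _ g b => Node 2 [:: tm_code g; tm_code b]
  end.

Fixpoint fm_code (A : fm) : GenTree.tree nat :=
  match A with
  | Bot => Leaf 0
  | Eq a b => Node 0 [:: tm_code a; tm_code b]
  | Lt a b => Node 1 [:: tm_code a; tm_code b]
  | Imp A B => Node 2 [:: fm_code A; fm_code B]
  | All s A => Node 3 [:: ty_code s; fm_code A]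
  end.

Lemma ty_code_inj : injective ty_code.
Proof. by elim=> [|s IHs t IHt] [|s' t'] //= [/IHs -> /IHt ->]. Qed.

Lemma existT_inj (P : ty -> Type) s (a b : P s) : existT P s a = existT P s b -> a = b.
Proof. exact: Eqdep_dec.inj_pair2_eq_dec ty_eq_dec _ _ _ _. Qed.

Lemma const_code_inj s (c : const s) t (d : const t) :
  const_code c = const_code d -> existT const s c = existT const t d.
Proof.
case: c => [||||s1 t1|r1 s1 t1|s1]; case: d => [||||s2 t2|r2 s2 t2|s2] //=.
- by case=> /ty_code_inj -> /ty_code_inj ->.
- by case=> /ty_code_inj -> /ty_code_inj -> /ty_code_inj ->.
- by case=> /ty_code_inj ->.
Qed.

(** Stated with dependent pairs because the type of an application hides the type of its argument,
    which has to be recovered from the code. *)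
Lemma tm_code_inj s (a : tm s) t (b : tm t) :
  tm_code a = tm_code b -> existT tm s a = existT tm t b.
Proof.
elim: a t b => [s' n|s' c|s' t' g IHg a IHa] t [t2 m|t2 d|s2 t2 h b] //=.
- by case=> /ty_code_inj -> ->.
- by case=> /const_code_inj /(congr1 (fun p => existT tm (projT1 p) (Cst (projT2 p)))).
- case=> /IHg h1 /IHa h2; have [e1 e2] := EqdepFacts.eq_sigT_fst h1; subst.
  by rewrite (existT_inj h1) (existT_inj h2).
Qed.

Lemma fm_code_inj : injective fm_code.
Proof.
elim=> [|a b|a b|A IHA B IHB|s A IH] [|c d|c d|C D|t C] //=.
- by case=> /tm_code_inj/(@existT_inj tm) -> /tm_code_inj/(@existT_inj tm) ->.
- by case=> /tm_code_inj/(@existT_inj tm) -> /tm_code_inj/(@existT_inj tm) ->.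
- by case=> /IHA -> /IHB ->.
- by case=> /ty_code_inj -> /IH ->.
Qed.

Definition nth_fm (n : nat) : fm :=
  if pselect (exists A, pickle (fm_code A) = n) is left h then sval (cid h) else Bot.

Lemma nth_fmP A : exists n, nth_fm n = A.
Proof.
exists (pickle (fm_code A)); rewrite /nth_fm; case: pselect => [h|[]]; last by exists A.
by case: cid => B /= /(pcan_inj pickleK)/fm_code_inj.
Qed.

(** * Semantics *)

(** The atomic equality is interpreted by identity in the carrier of type 0; [app_ext] makes the
    defined equality of every higher type an identity as well. *)
Record structure := Structure {
  D : ty -> Type;
  app : forall s t, D (Arr s t) -> D s -> D t;
  icst : forall s, const s -> D s;
  ltD : D T0 -> D T0 -> Prop;
  app_ext : forall s t (f g : D (Arr s t)), (forall x, app f x = app g x) -> f = g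
}.

Arguments icst : clear implicits.

Definition env (M : structure) := forall s : ty, nat -> D M s.

Definition econs M s (d : D M s) (rho : env M) : env M := fun t n =>
  match ty_eq_dec s t with
  | left e => match n with O => eq_rect s (D M) d t e | S m => rho t m end
  | right _ => rho t n
  end.

Section Satisfaction.
Variable M : structure.

Fixpoint eval (rho : env M) s (a : tm s) : D M s :=
  match a with
  | Var s n => rho s n
  | Cst s c => icst M s c
  | App s t g b => app (eval rho g) (eval rho b)
  end.

Fixpoint sat (rho : env M) (A : fm) : Prop :=
  match A with
  | Bot => False
  | Eq a b => eval rho a = eval rho b
  | Lt a b => ltD (eval rho a) (eval rho b)
  | Imp A B => sat rho A -> sat rho B
  | All s A => forall d : D M s, sat (econs d rho) A
  end.

End Satisfaction.

Lemma econs_0 M s (d : D M s) rho : econs d rho s 0 = d.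
Proof. by rewrite /econs ty_eq_decE. Qed.
Lemma econs_S M s (d : D M s) rho n : econs d rho s n.+1 = rho s n.
Proof. by rewrite /econs ty_eq_decE. Qed.
Lemma econs_ne M s (d : D M s) rho t n : s <> t -> econs d rho t n = rho t n.
Proof. by move=> ne; rewrite /econs ty_eq_decN. Qed.

Definition esub M (rho : env M) (f : sub) : env M := fun s n => eval rho (f s n).

Lemma eval_sub M (rho : env M) f s (a : tm s) : eval rho (tm_sub f a) = eval (esub rho f) a.
Proof. by elim: a => //= s' t u -> a ->. Qed.

Lemma esub_shift M s (d : D M s) rho : esub (econs d rho) (shift s) = rho.
Proof.
apply: dep2_ext => t n; rewrite /esub; case: (ty_eq_dec s t) => [<-|ne].
  by rewrite shift_eq /= econs_S.
by rewrite shift_ne //= econs_ne.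
Qed.

Lemma esub_up M s (d : D M s) rho f : esub (econs d rho) (up s f) = econs d (esub rho f).
Proof.
apply: dep2_ext => t n; rewrite {1}/esub; case: (ty_eq_dec s t) => [<-|ne].
  by case: n => [|n]; rewrite subE /= ?econs_0 // econs_S eval_sub esub_shift.
by rewrite up_ne // econs_ne // eval_sub esub_shift.
Qed.

Lemma sat_sub M (rho : env M) f A : sat rho (fm_sub f A) = sat (esub rho f) A.
Proof.
elim: A rho f => //= [a b|a b|A IHA B IHB|s A IH] rho f; rewrite ?eval_sub //.
  by rewrite IHA IHB.
by apply: eq_forall => d; rewrite IH esub_up.
Qed.

Lemma sat_EqT M (rho : env M) t (a b : tm t) : sat rho (EqT t a b) = (eval rho a = eval rho b).
Proof.
elim: t a b rho => [//|s _ t IH] a b rho /=.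
have re d : sat (econs d rho)
    (EqT t (App (tm_sub (shift s) a) (Var s 0)) (App (tm_sub (shift s) b) (Var s 0)))
  = (app (eval rho a) d = app (eval rho b) d).
  by rewrite IH /= !eval_sub esub_shift econs_0.
apply/propext; split=> [h|h d]; last by rewrite re h.
by apply: app_ext => d; rewrite -re.
Qed.

Definition modelsRCA (M : structure) := forall A, axiom A -> forall rho : env M, sat rho A.

(** * Completeness *)

Section Quotient.
Variables (T : Type) (R : T -> T -> Prop).

(** Classes are predicates and representatives are chosen classically. Both the term model and the
    field of fractions are quotients of this kind. *)
Definition quot : Type := {P : T -> Prop | exists a, P = R a}.
Definition qcls (a : T) : quot := exist _ (R a) (ex_intro _ a erefl).
Definition qrepr (d : quot) : T := sval (cid (svalP d)).

Hypothesis R_refl : forall a, R a a.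
Hypothesis R_sym : forall a b, R a b -> R b a.
Hypothesis R_trans : forall a b c, R a b -> R b c -> R a c.

Lemma qclsE (a b : T) : qcls a = qcls b <-> R a b.
Proof.
split=> [|ab]; first by move=> /(congr1 (fun d => sval d b)) /= ->.
apply: eq_exist => /=; apply: funext => c; apply/propext.
by split; apply: R_trans => //; apply: R_sym.
Qed.

Lemma qreprK (d : quot) : qcls (qrepr d) = d.
Proof. by case: d => P hP; apply: eq_exist; rewrite /qrepr /=; case: cid. Qed.

End Quotient.

Definition consistent (G : list fm) : Prop := ~ prv G Bot.

(** The Henkin step: a negated universal formula receives the variable [k] as a counterexample. *)
Definition with_witness (k : nat) (F : fm) (G : list fm) : list fm :=
  match F with
  | Imp (All s B) Bot => Not (inst (Var s k) B) :: G
  | _ => G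
  end.

Lemma with_witness_incl k F G : List.incl G (with_witness k F G).
Proof. by move=> A AG; case: F => //= -[] //= s B [] //=; right. Qed.

(** The index [ctx_idx] exceeds all those in the context. If the witness led to a contradiction, the
    instance at this fresh variable would be provable, hence also the universal formula whose
    negation is in the context. *)
Lemma with_witness_consistent F G :
  consistent (F :: G) -> consistent (with_witness (ctx_idx (F :: G)) F (F :: G)).
Proof.
case: F => // -[] // s B [] // con.
have [//|/contrapT incon] := pselect (consistent (with_witness (ctx_idx (Not (All s B) :: G))
  (Not (All s B)) (Not (All s B) :: G))).
case: con; apply: (@prv_impE _ (All s B)); first by apply: prv_hyp; left.
apply: (@prv_fresh _ _ _ _ (leqnn _)); last exact: prv_raa.
by apply: (leq_trans _ (@ctx_idx_in _ (Not (All s B)) _)); [rewrite /= maxn0|left].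
Qed.

Section TermModel.
Variables (A0 : fm) (A0_unprovable : ~ prv nil A0).

(** Every stage is a finite list, so a fresh variable always remains and the language needs no new
    constants. *)
Fixpoint stage (n : nat) : list fm :=
  match n with
  | O => [:: Not A0]
  | S m => let G := nth_fm m :: stage m in
    if pselect (consistent G) then with_witness (ctx_idx G) (nth_fm m) G else stage m
  end.

Lemma stage_consistent n : consistent (stage n).
Proof.
elim: n => [h|n IH] /=; first exact/A0_unprovable/prv_raa.
by case: pselect => // con; apply: with_witness_consistent.
Qed.

Lemma stage_incl m n : m <= n -> List.incl (stage m) (stage n).
Proof.
move=> /subnK <-; elim: (n - m) => [|k IH]; first exact: List.incl_refl.
move=> A AG; rewrite addSn /=; case: pselect => [con|incon]; last exact: IH.
by apply: with_witness_incl; right; apply: IH.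
Qed.

Definition Th (A : fm) : Prop := exists n, prv (stage n) A.

Lemma Th_ax A : axiom A -> Th A.
Proof. by move=> h; exists 0; apply: prv_ax. Qed.

Lemma Th_consistent : ~ Th Bot.
Proof. by case=> n /stage_consistent. Qed.

Lemma Th_mp A B : Th (Imp A B) -> Th A -> Th B.
Proof.
move=> [m hm] [n hn]; exists (maxn m n); apply: (@prv_impE _ A).
  exact (prv_weaken hm (stage_incl (leq_maxl m n))).
exact (prv_weaken hn (stage_incl (leq_maxr m n))).
Qed.

Lemma Th_leibniz a b A : Th (Eq a b) -> Th (inst a A) -> Th (inst b A).
Proof.
move=> [m hm] [n hn]; exists (maxn m n); apply: (@prv_leibniz _ a).
  exact (prv_weaken hm (stage_incl (leq_maxl m n))).
exact (prv_weaken hn (stage_incl (leq_maxr m n))).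
Qed.

Lemma Th_complete A : Th A \/ Th (Not A).
Proof.
have [n nA] := nth_fmP A.
have [con|/contrapT incon] := pselect (consistent (nth_fm n :: stage n)).
  left; exists n.+1; apply: prv_hyp => /=; case: pselect => //= con'; rewrite nA.
  by apply: with_witness_incl; left.
by right; exists n; apply: prv_impI; rewrite -nA.
Qed.

Lemma Th_imp A B : Th (Imp A B) <-> (Th A -> Th B).
Proof.
split=> [|h]; first exact: Th_mp.
have [/h[n hB]|[n nA]] := Th_complete A; exists n; apply: prv_impI.
  by apply: prv_weaken hB _ _ => C; right.
apply: prv_raa; apply: (@prv_impE _ A); last by apply: prv_hyp; right; left.
by apply: prv_weaken nA _ _ => C hC; right; right.
Qed.

(** If the universal formula fails, completeness puts its negation into the theory; that negation
    was enumerated at some stage, and the witness added there refutes one of the instances. *)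
Lemma Th_all s B : Th (All s B) <-> forall a : tm s, Th (inst a B).
Proof.
split=> [[n h] a|h]; first by exists n; apply: prv_allE.
have [//|nB] := Th_complete (All s B).
have [n nE] := nth_fmP (Not (All s B)).
have [con|/contrapT incon] := pselect (consistent (nth_fm n :: stage n)); last first.
  case: Th_consistent; apply: Th_mp nB; exists n; apply: prv_impI.
  by rewrite -/(Not _) -nE.
case: Th_consistent; apply: Th_mp (h (Var s (ctx_idx (nth_fm n :: stage n)))).
exists n.+1; apply: prv_hyp => /=; case: pselect => //= con'.
by rewrite nE; left.
Qed.

Definition eqv s (a b : tm s) : Prop := Th (EqT s a b).

Lemma eqv_fun s t (a b : tm (Arr s t)) :
  eqv a b <-> forall c : tm s, eqv (App a c) (App b c).
Proof.
by rewrite /eqv /= Th_all; split=> h c; move: (h c); rewrite inst_EqT.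
Qed.

Lemma eqv_refl s (a : tm s) : eqv a a.
Proof.
elim: s a => [a|s _ t IH a]; first by exists 0; apply: prv_refl.
by apply/eqv_fun => c.
Qed.

Lemma eqv_sym s (a b : tm s) : eqv a b -> eqv b a.
Proof.
elim: s a b => [a b ab|s _ t IH a b /eqv_fun ab]; last by apply/eqv_fun => c; apply: IH.
have := @Th_leibniz _ _ (Eq (Var T0 0) (tm_sub (shift T0) a)) ab.
by rewrite /inst /= !subE !scons_shift; apply; apply: (@eqv_refl T0).
Qed.

Lemma eqv_trans s (a b c : tm s) : eqv a b -> eqv b c -> eqv a c.
Proof.
elim: s a b c => [a b c ab bc|s _ t IH a b c /eqv_fun ab /eqv_fun bc].
  have := @Th_leibniz _ _ (Eq (tm_sub (shift T0) a) (Var T0 0)) bc.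
  by rewrite /inst /= !subE !scons_shift; apply.
by apply/eqv_fun => d; apply: IH (bc d).
Qed.

Lemma eqv_app s t (f g : tm (Arr s t)) (a b : tm s) :
  eqv f g -> eqv a b -> eqv (App f a) (App g b).
Proof.
move=> /eqv_fun fg ab; apply: eqv_trans (fg a) _.
exact: Th_mp (Th_ax (ax_ext _ _ a b g)) ab.
Qed.

Lemma eqv_lt (a b c d : tm T0) : eqv a b -> eqv c d -> Th (Lt a c) -> Th (Lt b d).
Proof.
move=> ab cd h.
have := @Th_leibniz _ _ (Lt (Var T0 0) (tm_sub (shift T0) c)) ab.
rewrite /inst /= !subE !scons_shift => /(_ h) {}h.
have := @Th_leibniz _ _ (Lt (tm_sub (shift T0) b) (Var T0 0)) cd.
by rewrite /inst /= !subE !scons_shift; apply.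
Qed.

Definition tmD (s : ty) : Type := quot (@eqv s).
Definition cls s (a : tm s) : tmD s := qcls _ a.
Definition repr s (d : tmD s) : tm s := qrepr d.

Lemma clsE s (a b : tm s) : cls a = cls b <-> eqv a b.
Proof. exact: qclsE (@eqv_refl s) (@eqv_sym s) (@eqv_trans s) a b. Qed.

Lemma reprK s (d : tmD s) : cls (repr d) = d.
Proof. exact: qreprK. Qed.

Lemma repr_cls s (a : tm s) : eqv (repr (cls a)) a.
Proof. by apply/clsE; rewrite reprK. Qed.

Definition tm_app s t (f : tmD (Arr s t)) (a : tmD s) : tmD t := cls (App (repr f) (repr a)).

Lemma tm_app_cls s t (f : tm (Arr s t)) a : tm_app (cls f) (cls a) = cls (App f a).
Proof. by apply/clsE; apply: eqv_app; apply: repr_cls. Qed.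

Lemma tm_app_ext s t (f g : tmD (Arr s t)) :
  (forall x, tm_app f x = tm_app g x) -> f = g.
Proof.
rewrite -(reprK f) -(reprK g) => h; apply/clsE/eqv_fun => c.
by apply/clsE; rewrite -!tm_app_cls h.
Qed.

Definition term_model : structure :=
  @Structure tmD tm_app (fun s c => cls (Cst c)) (fun a b => Th (Lt (repr a) (repr b)))
    tm_app_ext.

Definition cls_env (f : sub) : env term_model := fun s n => cls (f s n).

Lemma eval_term f s (a : tm s) : eval (cls_env f) a = cls (tm_sub f a).
Proof. by elim: a => //= s' t g -> b ->; rewrite tm_app_cls. Qed.

(** The truth lemma. Every element of the term model is the class of a term, so quantifying over
    elements amounts to quantifying over instances. *)
Lemma sat_term f A : sat (cls_env f) A <-> Th (fm_sub f A).
Proof.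
elim: A f => [|a b|a b|A IHA B IHB|s A IH] f /=.
- by split=> // /Th_consistent.
- by rewrite !eval_term clsE.
- rewrite !eval_term; split; apply: eqv_lt; try exact: repr_cls;
    by apply: eqv_sym; apply: repr_cls.
- by rewrite Th_imp IHA IHB.
- rewrite Th_all.
  have re a : (sat (econs (cls a : D term_model s) (cls_env f)) A) <-> Th (inst a (fm_sub (up s f) A)).
    rewrite /inst fm_sub_comp -IH; suff -> : econs (cls a : D term_model s) (cls_env f)
      = cls_env (scomp (up s f) (scons a)) by [].
    apply: dep2_ext => t n; rewrite /cls_env /scomp; case: (ty_eq_dec s t) => [<-|ne].
      by case: n => [|n]; rewrite ?econs_0 ?econs_S subE /= ?subE ?scons_shift.
    by rewrite econs_ne // up_ne // scons_shift.
  by split=> h a; [apply/re|rewrite -(reprK a); apply/re].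
Qed.

(** An environment is a substitution of terms up to classes, and substitution instances of axioms
    are axioms. *)
Lemma term_model_RCA : modelsRCA term_model.
Proof.
move=> A axA rho.
have -> : rho = cls_env (fun s n => repr (rho s n)).
  by apply: dep2_ext => s n; rewrite /cls_env reprK.
by apply/sat_term/Th_ax/axiom_sub.
Qed.

Lemma term_model_refutes : ~ sat (cls_env ids) A0.
Proof.
move=> /sat_term; rewrite fm_sub_ids => h; apply: Th_consistent; apply: Th_mp h.
by exists 0; apply: prv_hyp; left.
Qed.

End TermModel.

Theorem completeness A :
  (forall M, modelsRCA M -> forall rho : env M, sat rho A) -> RCA0w_proves A.
Proof.
move=> h; apply: contrapT => nA.
exact (term_model_refutes (h _ (@term_model_RCA _ nA) _)).
Qed.

(** * Combinatory completeness *)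

Record rca := Rca { rca_str :> structure; rcaP : modelsRCA rca_str }.

Coercion app : D >-> Funclass.

Lemma sat_Not M (rho : env M) A : sat rho (Not A) = ~ sat rho A.
Proof. by []. Qed.

Lemma sat_And M (rho : env M) A B : sat rho (And A B) = (sat rho A /\ sat rho B).
Proof.
apply/propext; split; last by case=> ha hb h; apply: h ha hb.
by move=> h; split; apply: contrapT => n; apply: h => ha hb; apply: n.
Qed.

Lemma sat_Or M (rho : env M) A B : sat rho (Or A B) = (sat rho A \/ sat rho B).
Proof.
apply/propext; split; last by case=> [ha na|hb na] //; case: (na ha).
by move=> h; have [a|/h] := pselect (sat rho A); [left|right].
Qed.

Lemma sat_Ex M (rho : env M) s A : sat rho (Ex s A) = exists d : D M s, sat (econs d rho) A.
Proof.
apply/propext; split; last by case=> d hd h; apply: (h d hd).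
by move=> h; apply: contrapT => n; apply: h => d hd; apply: n; exists d.
Qed.

Lemma sat_Imp M (rho : env M) A B : sat rho (Imp A B) = (sat rho A -> sat rho B).
Proof. by []. Qed.

Lemma sat_All M (rho : env M) s A : sat rho (All s A) = forall d : D M s, sat (econs d rho) A.
Proof. by []. Qed.

Definition satE := (sat_And, sat_Ex, sat_Not, sat_Or, sat_Imp, sat_All).

Section Combinators.
Context {M : rca}.
Implicit Types (C : seq ty) (r s t u : ty).

Fixpoint dflt s : D M s :=
  match s with T0 => icst M _ CZero | Arr s t => app (icst M _ (CPi t s)) (dflt t) end.

Definition env0 : env M := fun s _ => dflt s.

Lemma ax_eval t (a b : tm t) (rho : env M) : axiom (EqT t a b) -> eval rho a = eval rho b.
Proof. by move=> /rcaP/(_ rho) h; rewrite -(sat_EqT rho a b). Qed.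

Lemma PiE s t (x : D M s) (y : D M t) : icst M _ (CPi s t) x y = x.
Proof.
have := ax_eval (fun u n => match n with 0 => econs x env0 u 0 | _ => econs y env0 u 0 end)
  (ax_Pi _ _ (Var s 0) (Var t 1)).
by rewrite /= !econs_0.
Qed.

Lemma SigmaE r s t (x : D M (Arr r (Arr s t))) (y : D M (Arr r s)) (z : D M r) :
  icst M _ (CSigma r s t) x y z = x z (y z).
Proof.
have := ax_eval (fun u n => match n with
    0 => econs x env0 u 0 | 1 => econs y env0 u 0 | _ => econs z env0 u 0 end)
  (ax_Sigma r s t (Var _ 0) (Var _ 1) (Var _ 2)).
by rewrite /= !econs_0.
Qed.

(** [dctx C] interprets the context of the variables of types [C], the innermost
    one first, and [Rp F] says that an element of the model represents the
    function [F] of these variables. *)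
Fixpoint dctx C : Type := match C with nil => unit | s :: C => (D M s * dctx C)%type end.

Fixpoint cur C t : ty := match C with nil => t | s :: C => cur C (Arr s t) end.

Fixpoint apps C t : D M (cur C t) -> dctx C -> D M t :=
  match C return D M (cur C t) -> dctx C -> D M t with
  | nil => fun h _ => h
  | s :: C => fun h e => app (@apps C (Arr s t) h e.2) e.1
  end.

Definition Rp C t (F : dctx C -> D M t) : Prop := exists h, forall e, apps h e = F e.

Lemma Rp_const C t (c : D M t) : @Rp C t (fun=> c).
Proof.
elim: C t c => [|s C IH] t c; first by exists c.
have [h hE] := IH _ (icst M _ (CPi t s) c).
by exists h => e /=; rewrite hE PiE.
Qed.

Lemma Rp_app C s t (F : dctx C -> D M (Arr s t)) (G : dctx C -> D M s) :
  Rp F -> Rp G -> Rp (fun e => F e (G e)).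
Proof.
move=> [f fE] [g gE].
suff [h hE] : exists h : D M (cur C t), forall e, apps h e = (apps f e) (apps g e).
  by exists h => e; rewrite hE fE gE.
elim: C s t f g {F G fE gE} => [|r C IH] s t f g; first by exists (f g).
have [k kE] := @Rp_const C _ (icst M _ (CSigma r s t)).
have [h1 h1E] := IH _ _ k f; have [h2 h2E] := IH _ _ h1 g.
by exists h2 => e /=; rewrite h2E h1E kE SigmaE.
Qed.

Lemma Rp_weak C s t (F : dctx C -> D M t) : Rp F -> @Rp (s :: C) t (fun e => F e.2).
Proof.
move=> rF; have [h hE] := Rp_app (Rp_const C (icst M _ (CPi t s))) rF.
by exists h => e /=; rewrite hE PiE.
Qed.

Lemma Rp_var C s : @Rp (s :: C) s (fun e => e.1).
Proof.
have [h hE] := @Rp_const C _ (icst M _ (CSigma s (Arr s s) s)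
  (icst M _ (CPi s (Arr s s))) (icst M _ (CPi s s))).
by exists h => e /=; rewrite hE SigmaE PiE.
Qed.

(** Total, with a default value when [F] is not represented; terms can thus be written first and
    their representability shown when they are applied. *)
Definition dfun s t (F : D M s -> D M t) : D M (Arr s t) :=
  if pselect (exists h : D M (Arr s t), forall x, h x = F x) is left h then sval (cid h)
  else dflt _.

Lemma dfunE s t (F : D M s -> D M t) :
  @Rp [:: s] t (fun e => F e.1) -> forall x, dfun F x = F x.
Proof.
move=> [h hE] x; rewrite /dfun; case: pselect => [ex|[]]; first by case: cid.
by exists h => y; apply: (hE (y, tt)).
Qed.

(** Abstraction costs nothing here: [cur (s :: C) t] is [cur C (Arr s t)], so one element represents
    both functions. *)
Lemma Rp_dfun C s t (F : dctx C -> D M s -> D M t) :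
  @Rp (s :: C) t (fun e => F e.2 e.1) -> Rp (fun e => dfun (F e)).
Proof.
move=> [h hE]; exists h => e; apply: app_ext => x.
rewrite dfunE -?(hE (x, e)) //.
by exists (@apps C (Arr s t) h e) => -[y []] /=; apply: (hE (y, e)).
Qed.

End Combinators.

Opaque dfun.

Arguments Rp_app {M C s t F G} _ _.
Arguments Rp_weak {M C s t F} _.

Ltac rep_hyp n h := first
  [ exact h | lazymatch n with S ?m => rep_hyp m uconstr:(Rp_weak h) end ].
Ltac rep_var := first
  [ rep_hyp 12 uconstr:(Rp_var _ _) | match goal with h : Rp _ |- _ => rep_hyp 12 h end ].

(** Redefined below whenever new closure properties of representability have been proved. *)
Ltac rep_ext := fail.

Ltac rep_step := cbv beta; lazymatch goal with
  | |- Rp (fun _ => ?c) => exact: Rp_const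
  | |- Rp (fun e => app (@?f e) (@?a e)) => apply: (Rp_app (F := f) (G := a))
  | |- Rp (fun e => dfun (@?f e)) => apply: (Rp_dfun (F := f))
  | |- _ => first [rep_var | rep_ext]
  end.

Ltac rep := intros; repeat rep_step.

(** * Arithmetic in a model *)

Local Open Scope ring_scope.

Notation zeroD := (icst _ _ CZero).
Notation oneD := (icst _ _ COne).
Notation addD := (icst _ _ CAdd).
Notation mulD := (icst _ _ CMul).

Notation rec g m n := (icst _ _ (CRec T0) (dfun (fun k => dfun (fun z => g k z))) m n).
Notation ifz a x y := (rec (fun _ _ => y) x a).

Section ModelArithmetic.
Context {M : rca}.
Implicit Types a b c m n : D M T0.

Definition env3 a b c : env M := econs a (econs b (econs c env0)).

Ltac by_axiom h a b c :=
  have := rcaP (h (Var T0 0) (Var T0 1) (Var T0 2)) (env3 a b c);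
  rewrite ?satE /= /env3 ?(econs_0, econs_S).

Lemma addDA a b c : addD a (addD b c) = addD (addD a b) c.
Proof. by by_axiom ax_addA a b c. Qed.
Lemma addDC a b : addD a b = addD b a.
Proof. by by_axiom (fun x y (_ : tm T0) => ax_addC x y) a b a. Qed.
Lemma add0D a : addD zeroD a = a.
Proof. by by_axiom (fun x (_ _ : tm T0) => ax_add0 x) a a a; rewrite addDC. Qed.
Lemma mulDA a b c : mulD a (mulD b c) = mulD (mulD a b) c.
Proof. by by_axiom ax_mulA a b c. Qed.
Lemma mulDC a b : mulD a b = mulD b a.
Proof. by by_axiom (fun x y (_ : tm T0) => ax_mulC x y) a b a. Qed.
Lemma mul1D a : mulD oneD a = a.
Proof. by by_axiom (fun x (_ _ : tm T0) => ax_mul1 x) a a a; rewrite mulDC. Qed.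
Lemma mul0D a : mulD zeroD a = zeroD.
Proof. by by_axiom (fun x (_ _ : tm T0) => ax_mul0 x) a a a; rewrite mulDC. Qed.
Lemma mulDD a b c : mulD (addD a b) c = addD (mulD a c) (mulD b c).
Proof. by by_axiom ax_mulD c a b; rewrite (mulDC (addD a b)) (mulDC a) (mulDC b). Qed.
Lemma ltD_irr a : ~ ltD a a.
Proof. by by_axiom (fun x (_ _ : tm T0) => ax_lt_irr x) a a a. Qed.
Lemma ltD_trans a b c : ltD a b -> ltD b c -> ltD a c.
Proof. by by_axiom ax_lt_trans a b c. Qed.
Lemma ltD_total a b : ltD a b \/ a = b \/ ltD b a.
Proof. by by_axiom (fun x y (_ : tm T0) => ax_lt_total x y) a b a. Qed.
Lemma ltD_add a b c : ltD a b -> ltD (addD a c) (addD b c).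
Proof. by by_axiom ax_lt_add a b c. Qed.
Lemma ltD01 : ltD (zeroD : D M T0) oneD.
Proof. exact: (rcaP ax_lt01 env0). Qed.
Lemma ltD_ge0 a : ~ ltD a zeroD.
Proof. by by_axiom (fun x (_ _ : tm T0) => ax_ge0 x) a a a. Qed.
Lemma ltD_succ a b : ltD a (addD b oneD) -> ltD a b \/ a = b.
Proof. by by_axiom (fun x y (_ : tm T0) => ax_lt_succ x y) a b a. Qed.
Lemma oneD_neq0 : (oneD : D M T0) <> zeroD.
Proof. by move=> e; have := ltD01; rewrite e => /ltD_irr. Qed.

Lemma recD0 (f : D M (Arr T0 (Arr T0 T0))) m : icst M _ (CRec T0) f m zeroD = m.
Proof.
have := rcaP (ax_R0_zero (Var _ 0) (Var T0 1)) (econs f (env3 m m m)).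
by rewrite /= /env3 !(econs_0, econs_S, econs_ne).
Qed.

Lemma recDS (f : D M (Arr T0 (Arr T0 T0))) m n :
  icst M _ (CRec T0) f m (addD n oneD) = f n (icst M _ (CRec T0) f m n).
Proof.
have := rcaP (ax_R0_succ (Var _ 0) (Var T0 1) (Var T0 2)) (econs f (env3 m m n)).
by rewrite /= /env3 !(econs_0, econs_S, econs_ne).
Qed.

Lemma indD (f : D M T1) :
  f zeroD = zeroD -> (forall n, f n = zeroD -> f (addD n oneD) = zeroD) -> forall n, f n = zeroD.
Proof.
move=> f0 fS n; pose A := Eq (App (Var T1 0) (Var T0 0)) (Cst CZero).
have satA m : sat (econs m (econs f env0)) A = (f m = zeroD).
  by rewrite /= !(econs_0, econs_S, econs_ne).
have := rcaP (@ax_ind A I) (econs f env0); rewrite !sat_Imp !sat_All => h.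
rewrite -satA; apply: h => [|m].
  by rewrite /inst sat_sub /= /esub scons_0 scons_ne //= econs_0.
rewrite sat_Imp satA sat_sub /= /esub replace0_0 replace0_ne //= !(econs_0, econs_S, econs_ne) //.
exact: fS.
Qed.

Lemma qfacD (A : fm) (rho : env M) : qf A ->
  (forall f : D M T1, exists n : D M T0, sat (econs n (econs f rho)) A) ->
  exists Y : D M T2, forall f, sat (econs (Y f) (econs f rho)) A.
Proof.
move=> qA h; have := rcaP (ax_QFAC10 _ qA) rho; rewrite sat_Imp sat_All sat_Ex => hA.
case: hA => [f|Y hY].
  by rewrite sat_Ex.
rewrite sat_All in hY; exists Y => f; have := hY f; rewrite /inst !sat_sub.
set r := esub _ _; suff -> : r = econs (Y f) (econs f rho) by [].
rewrite /r /esub; apply: dep2_ext => s n.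
case: (ty_eq_dec T0 s) => [<-|ne0].
  case: n => [|n]; rewrite ?scons_0 ?scons_S /= ?shift_ne //=;
    by rewrite !(econs_0, econs_S, econs_ne).
case: (ty_eq_dec T1 s) => [<-|ne1].
  by case: n => [|n]; rewrite shift_ne //= scons_ne //= !(econs_0, econs_S, econs_ne).
case: (ty_eq_dec T2 s) => [<-|ne2].
  by rewrite shift_eq /= ?scons_ne //= !(econs_S, econs_ne).
by rewrite shift_ne //= scons_ne //= !econs_ne.
Qed.

(** * Representable functions and predicates *)

Lemma rec0 (g : D M T0 -> D M T0 -> D M T0) m : rec g m zeroD = m.
Proof. exact: recD0. Qed.

Lemma recS (g : D M T0 -> D M T0 -> D M T0) m n :
  @Rp M [:: T0; T0] T0 (fun e => g e.2.1 e.1) -> rec g m (addD n oneD) = g n (rec g m n).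
Proof.
move=> rg; rewrite recDS dfunE; last first.
  by apply: (@Rp_dfun M [:: T0] T0 T0 (fun e z => g e.1 z)).
rewrite dfunE //; have [h hE] := rg; exists (h n : D M T1) => -[z []] /=; exact: (hE (z, (n, tt))).
Qed.

(** Zero stands for truth, as in the matrices [f n = 0]; characteristic functions of sets in the
    language use 1 for membership instead. *)
Definition chi (P : Prop) : D M T0 := if pselect P then zeroD else oneD.
Definition ite s (P : Prop) (x y : D M s) : D M s := if pselect P then x else y.

Lemma chi0 P : chi P = zeroD <-> P.
Proof.
rewrite /chi; case: pselect => //= nP; split=> // h.
by have := ltD01; rewrite h => /ltD_irr.
Qed.

Lemma chiT (P : Prop) : P -> chi P = zeroD.
Proof. by move=> /chi0. Qed.

Lemma chiF (P : Prop) : ~ P -> chi P = oneD.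
Proof. by rewrite /chi; case: pselect. Qed.

Lemma iteT s (P : Prop) (x y : D M s) : P -> ite P x y = x.
Proof. by rewrite /ite; case: pselect. Qed.

Lemma iteF s (P : Prop) (x y : D M s) : ~ P -> ite P x y = y.
Proof. by rewrite /ite; case: pselect. Qed.

Lemma ifz_chi P (x y : D M T0) : ifz (chi P) x y = ite P x y.
Proof.
have [hP|nP] := pselect P; first by rewrite (chiT hP) (iteT _ _ hP) rec0.
rewrite (chiF nP) (iteF _ _ nP) -[oneD]add0D recS //; exact: Rp_const.
Qed.

Variable C : seq ty.
Implicit Types P Q : @dctx M C -> Prop.

Definition RpP P := Rp (fun e => chi (P e)).

Lemma Rp_ite P (F G : dctx C -> D M T0) :
  RpP P -> Rp F -> Rp G -> Rp (fun e => ite (P e) (F e) (G e)).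
Proof.
move=> rP rF rG; have -> : (fun e => ite (P e) (F e) (G e)) = (fun e => ifz (chi (P e)) (F e) (G e)).
  by apply: funext => e; rewrite ifz_chi.
by rep.
Qed.

Lemma RpP_const (P : Prop) : RpP (fun=> P).
Proof. exact: Rp_const. Qed.

Lemma RpP_ext P Q : (forall e, P e <-> Q e) -> RpP P -> RpP Q.
Proof. by move=> PQ; suff -> : Q = P by []; apply: funext => e; apply/propext; rewrite PQ. Qed.

Lemma RpP_imp P Q : RpP P -> RpP Q -> RpP (fun e => P e -> Q e).
Proof.
move=> rP rQ; rewrite /RpP.
have -> : (fun e => chi (P e -> Q e)) = (fun e => ite (P e) (chi (Q e)) zeroD).
  apply: funext => e; rewrite /ite; case: pselect => h; last by apply: chiT.
  by congr chi; apply/propext; split=> [|?]; [apply|].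
by apply: Rp_ite => //; apply: Rp_const.
Qed.

Lemma RpP_not P : RpP P -> RpP (fun e => ~ P e).
Proof. by move=> rP; apply: RpP_imp => //; apply: RpP_const. Qed.

Lemma RpP_and P Q : RpP P -> RpP Q -> RpP (fun e => P e /\ Q e).
Proof.
move=> rP rQ; apply: (@RpP_ext (fun e => ~ (P e -> ~ Q e))); last first.
  by apply/RpP_not/RpP_imp => //; apply: RpP_not.
move=> e; split=> [h|[p q] h]; last exact: h p q.
by split; apply: contrapT => n; apply: h => p q; apply: n.
Qed.

Lemma RpP_or P Q : RpP P -> RpP Q -> RpP (fun e => P e \/ Q e).
Proof.
move=> rP rQ; apply: (@RpP_ext (fun e => ~ P e -> Q e)); last by apply: RpP_imp => //; apply: RpP_not.
by move=> e; split=> [h|[] //]; have [p|/h] := pselect (P e); [left|right].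
Qed.

Lemma RpP_iff P Q : RpP P -> RpP Q -> RpP (fun e => P e <-> Q e).
Proof. by move=> rP rQ; apply: RpP_and; apply: RpP_imp. Qed.

(** The language has no term for the characteristic function of an atomic relation. Quantifier-free
    choice supplies one: for each [f] there is exactly one truth value of [A], with the two
    arguments stored as [f 0] and [f 1]. *)
Lemma Rp_rel (A : fm) (R : D M T0 -> D M T0 -> Prop) : qf A ->
  (forall (f : D M T1) n, sat (econs n (econs f env0)) A <-> R (f zeroD) (f oneD)) ->
  forall F G : dctx C -> D M T0, Rp F -> Rp G -> RpP (fun e => R (F e) (G e)).
Proof.
move=> qA hA F G rF rG.
pose B := Or (And A (Eq (Var T0 0) (Cst CZero))) (And (Not A) (Eq (Var T0 0) (Cst COne))).
have satB (f : D M T1) n : sat (econs n (econs f env0)) B <-> n = chi (R (f zeroD) (f oneD)).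
  rewrite !satE /= econs_0 /chi; have := hA f n; case: pselect => /= r [Ar rA].
    split=> [[[_ ->]|[h]] //|e]; first by case: h; apply: rA.
    by left; split=> //; apply: rA.
  split=> [[[/Ar]|[_ ->]] //|e]; right; split=> // /Ar; exact: r.
have [|f|Y hY] := @qfacD B env0; first by rewrite /B /=; do !split.
  by exists (chi (R (f zeroD) (f oneD))); apply/satB.
rewrite /RpP; have -> : (fun e => chi (R (F e) (G e))) = (fun e => Y (dfun (fun k => ifz k (F e) (G e)))).
  apply: funext => e; have /satB -> := hY (dfun (fun k => ifz k (F e) (G e))).
  have rf : @Rp M [:: T0] T0 (fun k => ifz k.1 (F e) (G e)) by rep.
  by rewrite !dfunE // rec0 -[oneD]add0D recS //; apply: Rp_const.
by rep.
Qed.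

Lemma RpP_eq (F G : dctx C -> D M T0) : Rp F -> Rp G -> RpP (fun e => F e = G e).
Proof.
apply: (@Rp_rel (Eq (App (Var T1 0) (Cst CZero)) (App (Var T1 0) (Cst COne)))) => //.
Qed.

Lemma RpP_lt (F G : dctx C -> D M T0) : Rp F -> Rp G -> RpP (fun e => ltD (F e) (G e)).
Proof.
apply: (@Rp_rel (Lt (App (Var T1 0) (Cst CZero)) (App (Var T1 0) (Cst COne)))) => //.
Qed.

End ModelArithmetic.

Ltac rep_logic := lazymatch goal with
  | |- RpP _ => unfold RpP
  | |- Rp (fun e => chi (_ = _)) => apply: RpP_eq
  | |- Rp (fun e => chi (ltD _ _)) => apply: RpP_lt
  | |- Rp (fun e => chi (@?P e /\ @?Q e)) => apply: (RpP_and (P := P) (Q := Q))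
  | |- Rp (fun e => chi (@?P e \/ @?Q e)) => apply: (RpP_or (P := P) (Q := Q))
  | |- Rp (fun e => chi (@?P e <-> @?Q e)) => apply: (RpP_iff (P := P) (Q := Q))
  | |- Rp (fun e => chi (~ @?P e)) => apply: (RpP_not (P := P))
  | |- Rp (fun e => chi (@?P e -> @?Q e)) => apply: (RpP_imp (P := P) (Q := Q))
  | |- Rp (fun e => ite (@?P e) (@?F e) (@?G e)) => apply: (Rp_ite (P := P) (F := F) (G := G))
  end.

Ltac rep_ext ::= rep_logic.

(** * Induction and choice for representable predicates *)

Section Induction.
Context {M : rca}.
Implicit Types a b c m n : D M T0.

Lemma indP (P : D M T0 -> Prop) : @RpP M [:: T0] (fun e => P e.1) ->
  P zeroD -> (forall n, P n -> P (addD n oneD)) -> forall n, P n.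
Proof.
move=> rP P0 PS n; pose f := dfun (fun n => chi (P n)).
have fE m : f m = zeroD <-> P m by rewrite /f dfunE // chi0.
by apply/fE; apply: indD => [|m /fE/PS]; rewrite fE.
Qed.

(** The predicate enters the axiom only through its characteristic function, a parameter of the
    matrix; the choice therefore covers everything that is represented, not just quantifier-free
    formulas. *)
Lemma choice1 (P : D M T1 -> D M T0 -> Prop) : @RpP M [:: T0; T1] (fun e => P e.2.1 e.1) ->
  (forall f, exists n, P f n) -> exists Y : D M T2, forall f, P f (Y f).
Proof.
move=> rP h; pose F := dfun (fun f => dfun (fun n => chi (P f n))).
have FE f n : F f n = zeroD <-> P f n.
  rewrite /F dfunE ?dfunE ?chi0 //; last by rep.
  have [g gE] := rP; exists (g f : D M T1) => -[z []] /=; exact: (gE (z, (f, tt))).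
pose A := Eq (App (App (Var (Arr T1 T1) 0) (Var T1 0)) (Var T0 0)) (Cst CZero).
have satA f n : sat (econs n (econs f (econs F env0))) A <-> P f n.
  by rewrite /= !(econs_0, econs_S, econs_ne).
have [//|f|Y hY] := @qfacD M A (econs F env0).
  by have [n hn] := h f; exists n; apply/satA.
by exists Y => f; apply/satA.
Qed.

Lemma choice0 (P : D M T0 -> D M T0 -> Prop) : @RpP M [:: T0; T0] (fun e => P e.2.1 e.1) ->
  (forall m, exists n, P m n) -> exists g : D M T1, forall n, P n (g n).
Proof.
move=> rP h.
have [|f|Y hY] := @choice1 (fun f => P (f zeroD)); last 1 first.
- exists (dfun (fun n => Y (dfun (fun=> n)))) => n; rewrite dfunE; last by rep.
  by have := hY (dfun (fun=> n)); rewrite dfunE //; rep.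
- have [g gE] := rP; exists (dfun (fun f => g (f zeroD) : D M T1)) => -[z [f []]] /=.
  by rewrite dfunE; [exact: (gE (z, (f zeroD, tt)))|rep].
- exact: h.
Qed.

Lemma nz_succ n : n <> zeroD -> exists m, n = addD m oneD.
Proof.
pose p n : D M T0 := rec (fun k _ => k) zeroD n.
have h : n = zeroD \/ n = addD (p n) oneD.
  apply: (indP (P := fun n => n = zeroD \/ n = addD (p n) oneD)) => [||m _]; first by rewrite /p; rep.
    by left.
  by right; rewrite /p recS //; rep.
by case: h => [//|->] _; exists (p n).
Qed.

Lemma lt_sub a b : ltD a b -> exists c, b = addD a (addD c oneD).
Proof.
(* [t n] is the truncated difference of [n] and [a], set up by recursion; its positive value at [b]
   yields the witness. *)
move=> ab; pose t n : D M T0 := rec (fun k z => ite (ltD a (addD k oneD)) (addD z oneD) zeroD) zeroD n.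
have tS n : t (addD n oneD) = ite (ltD a (addD n oneD)) (addD (t n) oneD) zeroD.
  by rewrite /t recS //; rep.
have t0 : t zeroD = zeroD by rewrite /t rec0.
have [h _] : (ltD a b -> b = addD a (t b)) /\ (~ ltD a b -> t b = zeroD).
  apply: (indP (P := fun b => (ltD a b -> b = addD a (t b)) /\ (~ ltD a b -> t b = zeroD)))
    => [||n [IH1 IH2]]; first by rewrite /t; rep.
    by split=> [/ltD_ge0|_ //].
  split=> h; rewrite tS; last by rewrite iteF.
  rewrite iteT // addDA; have [an|an] := pselect (ltD a n); first by rewrite -(IH1 an).
  have [//|->] := ltD_succ h; by rewrite IH2 ?(addDC n zeroD) ?add0D //; exact: ltD_irr.
have [e|/nz_succ [c cE]] := pselect (t b = zeroD).
  by have := ab; rewrite (h ab) e addDC add0D => /ltD_irr.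
by exists c; rewrite -cE -h.
Qed.

End Induction.

(** * The ordered field of fractions *)

HB.instance Definition _ (M : rca) := gen_eqMixin (D M T0).
HB.instance Definition _ (M : rca) := gen_choiceMixin (D M T0).
HB.instance Definition _ (M : rca) := GRing.isNmodule.Build (D M T0) addDA addDC add0D.
Lemma oneD_neq (M : rca) : (oneD : D M T0) != 0.
Proof. by apply/eqP; exact: oneD_neq0. Qed.
HB.instance Definition _ (M : rca) :=
  GRing.Nmodule_isComNzSemiRing.Build (D M T0) mulDA mulDC mul1D mulDD mul0D (@oneD_neq M).

Section Order.
Context {M : rca}.
Implicit Types a b c d x y : D M T0.

Definition leN a b : Prop := exists c, b = a + c.

Lemma lt_subN a b : ltD a b -> exists c, b = a + (c + 1).
Proof. exact: lt_sub. Qed.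

Lemma leN_total a b : leN a b \/ leN b a.
Proof.
have [/lt_subN[c ->]|[->|/lt_subN[c ->]]] := ltD_total a b.
- by left; exists (c + 1).
- by left; exists 0; rewrite addr0.
- by right; exists (c + 1).
Qed.

Lemma lt_addS a c : ltD a (a + (c + 1)).
Proof.
have h0 : ltD 0 (c + 1).
  have [//|[e|/ltD_ge0 //]] := ltD_total 0 (c + 1).
  suff : ltD c (c + 1) by rewrite -e => /ltD_ge0.
  by have := ltD_add c ltD01; rewrite add0D addDC.
by have := ltD_add a h0; rewrite add0D addDC.
Qed.

Lemma addS_neq a c : a <> a + (c + 1).
Proof. by move=> e; have := lt_addS a c; rewrite -e => /ltD_irr. Qed.

Lemma addNI a b c : a + c = b + c -> a = b.
Proof.
have [/lt_subN[d ->]|[//|/lt_subN[d ->]]] := ltD_total a b.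
  by rewrite addrAC => /addS_neq.
by rewrite (addrAC b) => /esym/addS_neq.
Qed.

Lemma addN_eq0 a b : a + b = 0 -> a = 0.
Proof.
have [//|/nz_succ[c ->]] := pselect (a = 0).
rewrite addrAC => e; have := lt_addS 0 (c + b).
by rewrite add0r e => /ltD_irr.
Qed.

Lemma mulN_eq0 a c : a * (c + 1) = 0 -> a = 0.
Proof. by rewrite mulrDr mulr1 addrC => /addN_eq0. Qed.

Lemma mulNI a b c : a * (c + 1) = b * (c + 1) -> a = b.
Proof.
have aux x y : x * (c + 1) = (x + (y + 1)) * (c + 1) -> False.
  have -> : (x + (y + 1)) * (c + 1) = x * (c + 1) + (y * (c + 1) + c + 1) by ring.
  exact: addS_neq.
by have [/lt_subN[d ->] /aux|[//|/lt_subN[d ->] /esym/aux]] := ltD_total a b.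
Qed.

(** [(a, b, c)] stands for [(a - b) / (c + 1)]. *)
Definition triple : Type := (D M T0 * D M T0 * D M T0)%type.
Implicit Types s t u : triple.

Definition teq s t : Prop :=
  s.1.1 * (t.2 + 1) + t.1.2 * (s.2 + 1) = t.1.1 * (s.2 + 1) + s.1.2 * (t.2 + 1).
(** The last component is (c + 1)(c' + 1) - 1, written without subtraction. *)
Definition tadd s t : triple :=
  (s.1.1 * (t.2 + 1) + t.1.1 * (s.2 + 1), s.1.2 * (t.2 + 1) + t.1.2 * (s.2 + 1),
   s.2 * t.2 + s.2 + t.2).
Definition tmul s t : triple :=
  (s.1.1 * t.1.1 + s.1.2 * t.1.2, s.1.1 * t.1.2 + s.1.2 * t.1.1, s.2 * t.2 + s.2 + t.2).
Definition topp s : triple := (s.1.2, s.1.1, s.2).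

Lemma teq_refl s : teq s s.
Proof. by []. Qed.
Lemma teq_sym s t : teq s t -> teq t s.
Proof. by rewrite /teq => ->. Qed.
Lemma teq_trans s t u : teq s t -> teq t u -> teq s u.
Proof.
rewrite /teq; move: s t u => [[a b] c] [[a' b'] c'] [[a2 b2] c2] /= h1 h2.
apply: (@mulNI _ _ c'); apply: (@addNI _ _ (b' * (c + 1) * (c2 + 1) + a' * (c + 1) * (c2 + 1))).
transitivity ((a * (c' + 1) + b' * (c + 1)) * (c2 + 1) + (a' * (c2 + 1) + b2 * (c' + 1)) * (c + 1)).
  by ring.
by rewrite h1 h2; ring.
Qed.

Definition qfrac : Type := quot teq.
Definition qfr s : qfrac := qcls teq s.

Lemma qfrE s t : qfr s = qfr t <-> teq s t.
Proof. exact: qclsE teq_refl teq_sym teq_trans s t. Qed.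

Lemma qfrP (k : qfrac) : exists s, k = qfr s.
Proof. by exists (qrepr k); rewrite -[LHS]qreprK. Qed.

Definition fadd (k l : qfrac) : qfrac := qfr (tadd (qrepr k) (qrepr l)).
Definition fmul (k l : qfrac) : qfrac := qfr (tmul (qrepr k) (qrepr l)).
Definition fopp (k : qfrac) : qfrac := qfr (topp (qrepr k)).

Lemma reprE s : teq (qrepr (qfr s)) s.
Proof. by apply/qfrE; apply: qreprK. Qed.

Lemma fr_add s t : fadd (qfr s) (qfr t) = qfr (tadd s t).
Proof.
apply/qfrE; move: (reprE s) (reprE t).
move: s t (qrepr (qfr s)) (qrepr (qfr t)) => [[x y] z] [[x' y'] z'] [[a b] c] [[a' b'] c'].
rewrite /teq /= => h1 h2.
transitivity ((a * (z + 1) + y * (c + 1)) * (c' + 1) * (z' + 1)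
  + (a' * (z' + 1) + y' * (c' + 1)) * (c + 1) * (z + 1)); first by ring.
by rewrite h1 h2; ring.
Qed.

Lemma fr_opp s : fopp (qfr s) = qfr (topp s).
Proof.
apply/qfrE; move: (reprE s); move: s (qrepr (qfr s)) => [[x y] z] [[a b] c]; rewrite /teq /= => h.
by rewrite addrC -h addrC.
Qed.

Lemma fr_mul s t : fmul (qfr s) (qfr t) = qfr (tmul s t).
Proof.
have mulC u v : tmul u v = tmul v u by rewrite /tmul; congr (_, _, _); ring.
have mulE u v w : teq u v -> teq (tmul u w) (tmul v w).
  move: u v w => [[a b] c] [[x y] z] [[p q] r]; rewrite /teq /= => h.
  transitivity ((a * (z + 1) + y * (c + 1)) * p * (r + 1)
    + (x * (c + 1) + b * (z + 1)) * q * (r + 1)); first by ring.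
  by rewrite -h {1}h; ring.
apply/qfrE; apply: teq_trans (mulE _ _ _ (reprE s)) _.
by rewrite (mulC s) (mulC s); apply: mulE; apply: reprE.
Qed.

Definition fr0 : qfrac := qfr (0, 0, 0).
Definition fr1 : qfrac := qfr (1, 0, 0).

Ltac by_fr := move=> *; repeat match goal with k : qfrac |- _ => have [? ->] := qfrP k; clear k end;
  rewrite /fr0 /fr1 ?(fr_add, fr_mul, fr_opp); apply/qfrE; rewrite /teq /=; ring.

Lemma faddA : associative fadd.           Proof. by_fr. Qed.
Lemma faddC : commutative fadd.           Proof. by_fr. Qed.
Lemma fadd0 : left_id fr0 fadd.           Proof. by_fr. Qed.
Lemma faddN : left_inverse fr0 fopp fadd. Proof. by_fr. Qed.
Lemma fmulA : associative fmul.           Proof. by_fr. Qed.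
Lemma fmulC : commutative fmul.           Proof. by_fr. Qed.
Lemma fmul1 : left_id fr1 fmul.           Proof. by_fr. Qed.
Lemma fmulD : left_distributive fmul fadd. Proof. by_fr. Qed.
End Order.

HB.instance Definition _ (M : rca) := gen_eqMixin (@qfrac M).
HB.instance Definition _ (M : rca) := gen_choiceMixin (@qfrac M).
HB.instance Definition _ (M : rca) :=
  GRing.isZmodule.Build (@qfrac M) (@faddA M) (@faddC M) (@fadd0 M) (@faddN M).

Lemma fr1_neq0 (M : rca) : @fr1 M != 0.
Proof.
apply/eqP => /qfrE; rewrite /teq /= !(mul1r, mul0r, addr0, add0r).
exact: oneD_neq0.
Qed.

HB.instance Definition _ (M : rca) := GRing.Zmodule_isComNzRing.Build (@qfrac M)
  (@fmulA M) (@fmulC M) (@fmul1 M) (@fmulD M) (@fr1_neq0 M).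

Section Field.
Context {M : rca}.
Implicit Types (s t : @triple M) (k l : @qfrac M).

Lemma fr_eq0 s : qfr s = 0 <-> s.1.1 = s.1.2.
Proof.
by rewrite qfrE /teq /=; split=> [|->]; rewrite ?mul0r add0r ?addr0 !mulr1 //= add0r.
Qed.

Lemma fr_inv_ex k : k != 0 -> exists l, l * k = 1.
Proof.
have [[[a b] c] ->] := qfrP k => /eqP/fr_eq0 /= ab.
have [/lt_subN[d ->]|[//|/lt_subN[d ->]]] := ltD_total a b.
- by exists (qfr (0, c + 1, d)); rewrite [LHS]fr_mul; apply/qfrE; rewrite /teq /=; ring.
- by exists (qfr (c + 1, 0, d)); rewrite [LHS]fr_mul; apply/qfrE; rewrite /teq /=; ring.
Qed.

Definition finv k : @qfrac M :=
  if pselect (k != 0) is left h then sval (cid (fr_inv_ex h)) else 0.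

Lemma finvV k : k != 0 -> finv k * k = 1.
Proof. by rewrite /finv; case: pselect => // h _; case: cid. Qed.

Lemma finv0 : finv 0 = 0.
Proof. by rewrite /finv; case: pselect => // h; have := eqxx (0 : @qfrac M); rewrite (negPf h). Qed.

Definition fnonneg k : Prop := leN (qrepr k).1.2 (qrepr k).1.1.

Lemma fr_nonneg s : fnonneg (qfr s) <-> leN s.1.2 s.1.1.
Proof.
have aux s' t : teq s' t -> leN s'.1.2 s'.1.1 -> leN t.1.2 t.1.1.
  move: s' t => [[a b] c] [[a' b'] c']; rewrite /teq /= => h [x xE]; subst a.
  have [//|[y yE]] := leN_total b' a'; subst b'.
  have e : x * (c' + 1) + y * (c + 1) = 0.
    apply: (@addNI _ _ _ (b * (c' + 1) + a' * (c + 1))); rewrite add0r.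
    by rewrite [RHS]addrC -h; ring.
  rewrite addrC in e; have /mulN_eq0 -> := addN_eq0 e; rewrite addr0.
  by exists 0; rewrite addr0.
by split; apply: aux; [|apply: teq_sym]; apply: reprE.
Qed.

Definition fle k l : bool := `[< fnonneg (l - k) >].
Definition fnorm k : @qfrac M := if fle 0 k then k else - k.

Lemma fle0P k : reflect (fnonneg k) (fle 0 k).
Proof. by rewrite /fle subr0; apply: asboolP. Qed.

Lemma fle0_add k l : fle 0 k -> fle 0 l -> fle 0 (k + l).
Proof.
have [[[a b] c] ->] := qfrP k; have [[[a' b'] c'] ->] := qfrP l.
move=> /fle0P/fr_nonneg[x /= ->] /fle0P/fr_nonneg[y /= ->]; apply/fle0P.
rewrite [_ + _]fr_add; apply/fr_nonneg => /=.
by exists (x * (c' + 1) + y * (c + 1)); ring.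
Qed.

Lemma fle0_mul k l : fle 0 k -> fle 0 l -> fle 0 (k * l).
Proof.
have [[[a b] c] ->] := qfrP k; have [[[a' b'] c'] ->] := qfrP l.
move=> /fle0P/fr_nonneg[x /= ->] /fle0P/fr_nonneg[y /= ->]; apply/fle0P.
by rewrite [_ * _]fr_mul; apply/fr_nonneg => /=; exists (x * y); ring.
Qed.

Lemma fsub_ge0 k l : fle 0 (l - k) = fle k l.
Proof. by rewrite /fle subr0. Qed.

Lemma fle0N k : fle k 0 = fle 0 (- k).
Proof. by rewrite -fsub_ge0 sub0r. Qed.

Lemma fr_oppE s : - qfr s = qfr (topp s).
Proof. exact: fr_opp. Qed.

Lemma fle0_anti k : fle 0 k -> fle k 0 -> k = 0.
Proof.
rewrite fle0N; have [[[a b] c] ->] := qfrP k; rewrite fr_oppE.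
move=> /fle0P/fr_nonneg[x /= aE] /fle0P/fr_nonneg[y /= bE]; apply/fr_eq0 => /=.
have : x + y = 0.
  by apply: (@addNI _ _ _ b); rewrite add0r [RHS]bE aE; ring.
by move=> /addN_eq0 x0; rewrite aE x0 addr0.
Qed.

Lemma fle0_total k : fle 0 k || fle k 0.
Proof.
rewrite fle0N; have [[[a b] c] ->] := qfrP k; rewrite fr_oppE.
by apply/orP; have [h|h] := leN_total b a; [left|right]; apply/fle0P/fr_nonneg.
Qed.

Lemma fnormN k : fnorm (- k) = fnorm k.
Proof.
rewrite /fnorm; have [k0|k0] := boolP (fle 0 k); have [nk0|nk0] := boolP (fle 0 (- k)) => //.
- by rewrite (fle0_anti k0) ?oppr0 // fle0N.
- by rewrite opprK.
- by have := fle0_total k; rewrite fle0N (negPf k0) (negPf nk0).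
Qed.

Lemma fnorm_ge0 k : fle 0 k -> fnorm k = k.
Proof. by rewrite /fnorm => ->. Qed.

End Field.

HB.instance Definition _ (M : rca) := GRing.ComNzRing_isField.Build (@qfrac M) (@finvV M) (@finv0 M).
HB.instance Definition _ (M : rca) := Num.IntegralDomain_isLeReal.Build (@qfrac M)
  (@fle0_add M) (@fle0_mul M) (@fle0_anti M) (@fsub_ge0 M) (@fle0_total M)
  (@fnormN M) (@fnorm_ge0 M) (fun _ _ => erefl).

(** Sealing the field behind an opaque proof keeps unification from unfolding
    its construction. *)
Record fraction_field (M : rca) := FractionField {
  fraction_sort :> realFieldType;
  fraction : @triple M -> fraction_sort;
  fraction_surj : forall k, exists s, k = fraction s;
  fraction_eq : forall s t, fraction s = fraction t <-> teq s t;
  fraction_0 : fraction (0, 0, 0) = 0;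
  fraction_1 : fraction (1, 0, 0) = 1;
  fraction_add : forall s t, fraction s + fraction t = fraction (tadd s t);
  fraction_mul : forall s t, fraction s * fraction t = fraction (tmul s t);
  fraction_ge0 : forall s, leN s.1.2 s.1.1 -> 0 <= fraction s
}.

Lemma fraction_field_exists (M : rca) : fraction_field M.
Proof.
apply: (@FractionField M (@qfrac M) (@qfr M) (@qfrP M) (@qfrE M) erefl erefl (@fr_add M) (@fr_mul M)).
by move=> s h; apply/fle0P/fr_nonneg.
Qed.

Definition frac (M : rca) : realFieldType := fraction_field_exists M.
Definition fr {M : rca} : @triple M -> frac M := @fraction _ _.

Lemma frP (M : rca) (k : frac M) : exists s, k = fr s.
Proof. exact: fraction_surj. Qed.

(** * Powers of two and codes of rationals *)

Lemma Rp_add (M : rca) C (F G : @dctx M C -> D M T0) : Rp F -> Rp G -> Rp (fun e => F e + G e).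
Proof. by move=> rF rG; apply: (Rp_app (F := fun e => addD (F e))) => //; rep. Qed.

Lemma Rp_mul (M : rca) C (F G : @dctx M C -> D M T0) : Rp F -> Rp G -> Rp (fun e => F e * G e).
Proof. by move=> rF rG; apply: (Rp_app (F := fun e => mulD (F e))) => //; rep. Qed.

Ltac rep_arith := lazymatch goal with
  | |- Rp (fun e => GRing.add (@?f e) (@?g e)) => apply: (Rp_add (F := f) (G := g))
  | |- Rp (fun e => GRing.mul (@?f e) (@?g e)) => apply: (Rp_mul (F := f) (G := g))
  end.

Ltac rep_ext ::= first [rep_logic | rep_arith].

Section Embedding.
Context {M : rca}.
Implicit Types (a b c m n : D M T0) (k l : frac M).

Definition emb a : frac M := fr (a, 0, 0).

Lemma emb0 : emb 0 = 0. Proof. exact: fraction_0. Qed.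
Lemma emb1 : emb 1 = 1. Proof. exact: fraction_1. Qed.

Lemma embD a b : emb (a + b) = emb a + emb b.
Proof. by rewrite [RHS]fraction_add; apply/fraction_eq; rewrite /teq /=; ring. Qed.

Lemma embM a b : emb (a * b) = emb a * emb b.
Proof. by rewrite [RHS]fraction_mul; apply/fraction_eq; rewrite /teq /=; ring. Qed.

Definition embE := (embD, embM, emb0, emb1).

Lemma emb_inj : injective emb.
Proof. by move=> a b /fraction_eq; rewrite /teq /= add0r !mulr1 !addr0. Qed.

Lemma emb_ge0 a : 0 <= emb a.
Proof. by apply: fraction_ge0; exists a; rewrite /= add0r. Qed.

Lemma ltDE a b : ltD a b <-> emb a < emb b.
Proof.
have aux x c : emb x < emb (x + (c + 1)).
  by rewrite !embE; have := emb_ge0 c; lra.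
split=> [/lt_subN[c ->] //|ab].
have [//|[e|/lt_subN[c e]]] := ltD_total a b; first by rewrite e ltxx in ab.
by have := aux b c; rewrite -e => /(lt_trans ab); rewrite ltxx.
Qed.

Lemma ltD_nemb a b : ~ ltD a b <-> emb b <= emb a.
Proof. by rewrite ltDE; split=> [/negP|]; rewrite leNgt // => /negP. Qed.

Lemma emb_lt1 a b : emb a < emb b -> emb a + 1 <= emb b.
Proof.
by move=> /ltDE/lt_subN[c ->]; rewrite !embE; have := emb_ge0 c; lra.
Qed.

Lemma emb_leP a b : emb a <= emb b -> exists c, b = a + c.
Proof.
by have [//|[c ->]] := leN_total a b; rewrite embE => h; exists 0; apply: emb_inj;
   rewrite !embE; have := emb_ge0 c; lra.
Qed.

Lemma frE_emb a b c : fr (a, b, c) = (emb a - emb b) / (emb c + 1).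
Proof.
have c0 : emb c + 1 != 0 by have := emb_ge0 c; lra.
apply: (mulIf c0); rewrite divfK // -emb1 -embD; apply: (addIr (emb b)); rewrite subrK.
rewrite /emb /fr fraction_mul fraction_add.
by apply/fraction_eq; rewrite /teq /=; ring.
Qed.

(** Archimedean relative to the natural numbers of the model, standard or not: a + 1 bounds (a - b)
    / (c + 1). *)
Lemma emb_archi k : exists n, k < emb n.
Proof.
have [[[a b] c] ->] := frP k; exists (a + 1); rewrite frE_emb.
rewrite ltr_pdivrMr; last by have := emb_ge0 c; lra.
rewrite !embE; have := mulr_ge0 (emb_ge0 a) (emb_ge0 c).
by move: (emb_ge0 a) (emb_ge0 b) (emb_ge0 c); nra.
Qed.

Definition p2 n : D M T0 := rec (fun _ z => z + z) 1 n.

Lemma p2_0 : p2 0 = 1. Proof. exact: rec0. Qed.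
Lemma p2_S n : p2 (n + 1) = p2 n + p2 n.
Proof. by rewrite /p2 [LHS]recS //; rep. Qed.

Lemma p2_gt n : emb n < emb (p2 n).
Proof.
apply/ltDE; apply: (indP (P := fun n => ltD n (p2 n))) => [||m /ltDE h]; first by rewrite /p2; rep.
  by apply/ltDE; rewrite p2_0 emb0 emb1; lra.
by apply/ltDE; rewrite p2_S [X in emb X < _]/(m + 1) !embE; have := emb_lt1 h; have := emb_ge0 m; lra.
Qed.

Lemma p2_add n m : p2 (n + m) = p2 n * p2 m.
Proof.
apply: (indP (P := fun m => p2 (n + m) = p2 n * p2 m)) => [||i IH]; first by rewrite /p2; rep.
  by rewrite addr0 p2_0 mulr1.
by rewrite [addD _ _]/(i + 1) addrA !p2_S IH mulrDr.
Qed.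

Definition pw n : frac M := (emb (p2 n))^-1.

Lemma p2_gt0 n : 0 < emb (p2 n).
Proof. by have := p2_gt n; have := emb_ge0 n; lra. Qed.

Lemma p2_neq0 n : emb (p2 n) != 0.
Proof. by rewrite gt_eqF // p2_gt0. Qed.

Lemma pw_gt0 n : 0 < pw n.
Proof. by rewrite /pw invr_gt0 p2_gt0. Qed.

Lemma pw_0 : pw 0 = 1.
Proof. by rewrite /pw p2_0 emb1 invr1. Qed.

Lemma pw_add n m : pw (n + m) = pw n * pw m.
Proof. by rewrite /pw p2_add embM invfM. Qed.

Lemma pw_1 : pw 1 = 2^-1.
Proof. by rewrite /pw -[1](add0r 1) p2_S p2_0 !embE. Qed.

Lemma pw_S n : pw (n + 1) = pw n / 2.
Proof. by rewrite pw_add pw_1. Qed.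

Lemma p2_pw n : emb (p2 n) * pw n = 1.
Proof. by rewrite /pw mulfV // p2_neq0. Qed.

Lemma pw_le n m : emb n <= emb m -> pw m <= pw n.
Proof.
move=> /emb_leP[c ->]; rewrite pw_add.
have : pw c <= 1 by rewrite /pw invf_le1 ?p2_gt0 //; have := emb_lt1 (p2_gt c); have := emb_ge0 c; lra.
by have := pw_gt0 n; nra.
Qed.

Lemma pw_lim k : 0 < k -> exists n, pw n < k.
Proof.
move=> k0; have [n hn] := emb_archi k^-1; exists n.
by rewrite /pw invf_plt ?posrE ?p2_gt0 //; apply: lt_trans hn (p2_gt n).
Qed.

Definition pairN a b : D M T0 := (a + b) * (a + b) + a.
Definition ratN a b c : D M T0 := pairN (pairN a b) c.

(** A code lies in [(a + b)^2, (a + b + 1)^2), so it determines the sum and then [a]. *)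
Lemma pairN_inj a b a' b' : pairN a b = pairN a' b' -> a = a' /\ b = b'.
Proof.
have aux x y x' y' : pairN x y = pairN x' y' -> ~ emb (x + y) < emb (x' + y').
  move=> /(congr1 emb) h /emb_lt1; move: h; rewrite /pairN !embE.
  by move: (emb_ge0 x) (emb_ge0 y) (emb_ge0 x') (emb_ge0 y'); nra.
move=> h; have s : a + b = a' + b'.
  apply: emb_inj; have [lt|lt|//] := ltgtP (emb (a + b)) (emb (a' + b')); first by case: (aux _ _ _ _ h).
  by case: (aux _ _ _ _ (esym h)).
have e : a = a'.
  by apply: (@addNI _ _ _ ((a + b) * (a + b))); rewrite addrC -/(pairN a b) h /pairN -s addrC.
by split=> //; apply: (@addNI _ _ _ a); rewrite addrC s e addrC.
Qed.

Definition isq q : Prop := exists a b c, q = ratN a b c.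
(** Not every number codes a rational, so [val] has the default value 0 and [isq] accompanies it in
    all comparisons. *)
Definition val q : frac M :=
  if pselect (exists k, exists a b c, q = ratN a b c /\ k = fr (a, b, c)) is left h
  then sval (cid h) else 0.

Lemma val_rat a b c : val (ratN a b c) = fr (a, b, c).
Proof.
rewrite /val; case: pselect => [h|[]]; last by exists (fr (a, b, c)), a, b, c.
by case: cid => k /= [a' [b' [c' [/pairN_inj[/pairN_inj[-> ->] ->] ->]]]].
Qed.

Lemma val_surj k : exists2 q, isq q & val q = k.
Proof.
have [[[a b] c] ->] := frP k; exists (ratN a b c); last exact: val_rat.
by exists a, b, c.
Qed.

Definition with_ratsD (F : D M T0 -> D M T0 -> D M T0 -> Prop) q r : Prop :=
  exists a b c a' b' c', q = ratN a b c /\ r = ratN a' b' c' /\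
  F (a * (c' + 1) + b' * (c + 1)) (a' * (c + 1) + b * (c' + 1)) ((c + 1) * (c' + 1)).

Definition ratlt q r n : Prop := with_ratsD (fun L N d => ltD (L * p2 n) (N * p2 n + d)) q r.
Definition ratle q r n : Prop :=
  with_ratsD (fun L N d => ~ ltD (N * p2 n + (d + d)) (L * p2 n)) q r.

(** Whatever decodings of [q] and [r] are taken, [F] is applied to numbers with (L - N) / d equal to
    the difference of the values, so the quantifiers over decodings disappear. *)
Lemma with_ratsE (F : D M T0 -> D M T0 -> D M T0 -> Prop) q r (Q : Prop) :
  (forall L N d, 0 < emb d -> val q - val r = (emb L - emb N) / emb d -> (F L N d <-> Q)) ->
  with_ratsD F q r <-> isq q /\ isq r /\ Q.
Proof.
move=> FQ; have aux a b c a' b' c' : q = ratN a b c -> r = ratN a' b' c' ->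
    F (a * (c' + 1) + b' * (c + 1)) (a' * (c + 1) + b * (c' + 1)) ((c + 1) * (c' + 1)) <-> Q.
  have c0 : 0 < emb c + 1 by have := emb_ge0 c; lra.
  have c'0 : 0 < emb c' + 1 by have := emb_ge0 c'; lra.
  move=> qE rE; apply: FQ; rewrite ?qE ?rE ?val_rat ?frE_emb !embE; first by rewrite mulr_gt0.
  by field; rewrite !gt_eqF.
split=> [[a [b [c [a' [b' [c' [qE [rE h]]]]]]]]|[[a [b [c qE]]] [[a' [b' [c' rE]]] h]]].
  by split; [exists a, b, c|split; [exists a', b', c'|apply/(aux _ _ _ _ _ _ qE rE)]].
by exists a, b, c, a', b', c'; split=> //; split=> //; apply/(aux _ _ _ _ _ _ qE rE).
Qed.

Lemma ratltE q r n : ratlt q r n <-> isq q /\ isq r /\ val q < val r + pw n.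
Proof.
apply: with_ratsE => L N d d0 h; rewrite ltDE !embE.
have -> : (val q < val r + pw n) = (val q - val r < pw n) by rewrite ltrBlDl.
rewrite h.
have p0 := p2_gt0 n.
by rewrite ltr_pdivrMr // (mulrC (pw n)) ltr_pdivlMr // mulrBl ltrBlDl.
Qed.

Lemma ratleE q r n : ratle q r n <-> isq q /\ isq r /\ val q <= val r + 2 * pw n.
Proof.
apply: with_ratsE => L N d d0 h; rewrite ltD_nemb !embE.
have -> : (val q <= val r + 2 * pw n) = (val q - val r <= 2 * pw n) by rewrite lerBlDl.
rewrite h.
have p0 := p2_gt0 n.
by rewrite ler_pdivrMr // mulrAC ler_pdivlMr // mulrBl lerBlDl mulrDl mul1r.
Qed.

End Embedding.

Section RepCodes.
Context {M : rca} {C : seq ty}.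
Implicit Types F G H : @dctx M C -> D M T0.

Lemma Rp_p2 F : Rp F -> Rp (fun e => p2 (F e)).
Proof. by rewrite /p2; rep. Qed.

Lemma Rp_pairN F G : Rp F -> Rp G -> Rp (fun e => pairN (F e) (G e)).
Proof. by rewrite /pairN; rep. Qed.

Lemma Rp_ratN F G H : Rp F -> Rp G -> Rp H -> Rp (fun e => ratN (F e) (G e) (H e)).
Proof. by move=> rF rG rH; rewrite /ratN; apply: Rp_pairN => //; apply: Rp_pairN. Qed.

End RepCodes.

Ltac rep_codes := lazymatch goal with
  | |- Rp (fun e => p2 (@?F e)) => refine (@Rp_p2 _ _ F _)
  | |- Rp (fun e => pairN (@?F e) (@?G e)) => refine (@Rp_pairN _ _ F G _ _)
  | |- Rp (fun e => ratN (@?F e) (@?G e) (@?H e)) => refine (@Rp_ratN _ _ F G H _ _ _)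
  end.

Ltac rep_ext ::= first [rep_logic | rep_arith | rep_codes].

(** * Semantics of named binders *)

Definition upd (M : structure) (rho : env M) s (i : nat) (d : D M s) : env M := fun t n =>
  match ty_eq_dec s t with
  | left e => if PeanoNat.Nat.eqb n i then eq_rect s (D M) d t e else rho t n
  | right _ => rho t n
  end.

Section NamedBinders.
Context {M : structure}.
Implicit Types (rho : env M).

Lemma upd_eq rho s i (d : D M s) : upd rho i d s i = d.
Proof. by rewrite /upd ty_eq_decE PeanoNat.Nat.eqb_refl. Qed.
Lemma upd_ni rho s i (d : D M s) n : n <> i -> upd rho i d s n = rho s n.
Proof. by rewrite /upd ty_eq_decE; case: PeanoNat.Nat.eqb_spec. Qed.
Lemma upd_nt rho s i (d : D M s) t n : s <> t -> upd rho i d t n = rho t n.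
Proof. by move=> ne; rewrite /upd ty_eq_decN. Qed.

Lemma esub_bind rho s i (d : D M s) : esub (econs d rho) (bind s i) = upd rho i d.
Proof.
apply: dep2_ext => t n; rewrite /esub /bind; case: (ty_eq_dec s t) => [<-|ne].
  case: (PeanoNat.Nat.eqb_spec n i) => [->|ni] /=; first by rewrite econs_0 upd_eq.
  by rewrite econs_S upd_ni.
by rewrite /= econs_ne // upd_nt.
Qed.

Lemma sat_all rho s i F : sat rho (Defs.all s i F) = forall d : D M s, sat (upd rho i d) (F (Var s i)).
Proof. by rewrite sat_All; apply: eq_forall => d; rewrite sat_sub esub_bind. Qed.

Lemma sat_ex rho s i F : sat rho (Defs.ex s i F) = exists d : D M s, sat (upd rho i d) (F (Var s i)).
Proof. by rewrite sat_Ex; apply: eq_exists => d; rewrite sat_sub esub_bind. Qed.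

Lemma args_eq s (l : list (tm s)) n : args l s n = List.nth n l (Var s n).
Proof. by rewrite /args ty_eq_decE. Qed.
Lemma args_ne s (l : list (tm s)) t n : s <> t -> args l t n = Var t n.
Proof. by move=> ne; rewrite /args ty_eq_decN. Qed.

Lemma esub_args1 rho s (a : tm s) : esub rho (args [:: a]) = upd rho 0 (eval rho a).
Proof.
apply: dep2_ext => t n; rewrite /esub; case: (ty_eq_dec s t) => [<-|ne].
  by rewrite args_eq; case: n => [|[|n]]; rewrite !(upd_eq, upd_ni).
by rewrite args_ne //= upd_nt.
Qed.

Lemma esub_args2 rho s (a b : tm s) :
  esub rho (args [:: a; b]) = upd (upd rho 1 (eval rho b)) 0 (eval rho a).
Proof.
apply: dep2_ext => t n; rewrite /esub; case: (ty_eq_dec s t) => [<-|ne].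
  by rewrite args_eq; case: n => [|[|[|n]]]; rewrite !(upd_eq, upd_ni).
by rewrite args_ne //= !upd_nt.
Qed.

Lemma esub_args3 rho s (a b c : tm s) : esub rho (args [:: a; b; c])
  = upd (upd (upd rho 2 (eval rho c)) 1 (eval rho b)) 0 (eval rho a).
Proof.
apply: dep2_ext => t n; rewrite /esub; case: (ty_eq_dec s t) => [<-|ne].
  by rewrite args_eq; case: n => [|[|[|[|n]]]]; rewrite !(upd_eq, upd_ni).
by rewrite args_ne //= !upd_nt.
Qed.

Lemma sat_pred1 rho s (F : tm s -> fm) a :
  sat rho (Defs.pred1 F a) = sat (upd rho 0 (eval rho a)) (F (Var s 0)).
Proof. by rewrite sat_sub esub_args1. Qed.

Lemma sat_pred2 rho s (F : tm s -> tm s -> fm) a b :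
  sat rho (Defs.pred2 F a b) = sat (upd (upd rho 1 (eval rho b)) 0 (eval rho a)) (F (Var s 0) (Var s 1)).
Proof. by rewrite sat_sub esub_args2. Qed.

Lemma sat_pred3 rho s (F : tm s -> tm s -> tm s -> fm) a b c :
  sat rho (Defs.pred3 F a b c) = sat (upd (upd (upd rho 2 (eval rho c)) 1 (eval rho b)) 0 (eval rho a))
    (F (Var s 0) (Var s 1) (Var s 2)).
Proof. by rewrite sat_sub esub_args3. Qed.

Lemma sat_Eq rho a b : sat rho (Eq a b) = (eval rho a = eval rho b).
Proof. by []. Qed.

Lemma sat_Lt rho a b : sat rho (Lt a b) = ltD (eval rho a) (eval rho b).
Proof. by []. Qed.

Lemma eval_Var rho s n : eval rho (Var s n) = rho s n.
Proof. by []. Qed.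

Lemma eval_Cst rho s (c : const s) : eval rho (Cst c) = icst M s c.
Proof. by []. Qed.

Lemma eval_App rho s t (f : tm (Arr s t)) a : eval rho (App f a) = (eval rho f) (eval rho a).
Proof. by []. Qed.

Lemma sat_Iff rho A B : sat rho (Iff A B) = (sat rho A <-> sat rho B).
Proof. by rewrite sat_And. Qed.

End NamedBinders.

Definition evalE := (@eval_Var, @eval_Cst, @eval_App).
Definition updE := (@upd_eq, @upd_ni, @upd_nt).

Section Lambda.
Context {M : rca}.
Implicit Types (rho : env M).

Lemma eval_lam rho s i t (F : tm s -> tm t) (d : D M s) :
  eval rho (lam s i F) d = eval (upd rho i d) (F (Var s i)).
Proof.
rewrite /lam; elim: (F _) => {t F} [t n|t c|t u f IHf a IHa] /=.
- have [st|ne] := ty_eq_dec s t; last by rewrite ty_eq_decN /= PiE upd_nt.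
  subst t; rewrite ty_eq_decE.
  case: (PeanoNat.Nat.eqb_spec n i) => [->|ni] /=; last by rewrite PiE upd_ni.
  by rewrite SigmaE PiE upd_eq.
- by rewrite PiE.
- by rewrite SigmaE IHf IHa.
Qed.

Lemma app_pow2 rho n : eval rho pow2 n = p2 n.
Proof.
rewrite /p2; set g := dfun _.
suff <- : eval rho (lam T0 0 (fun=> lam T0 1 (fun m => App (App (Cst CAdd) m) m))) = g by [].
apply: app_ext => k; apply: app_ext => z; rewrite !eval_lam ?evalE ?updE // /g.
by rewrite dfunE; [rewrite dfunE //; rep|rep].
Qed.

Definition pushD n (f : D M T1) : D M T1 :=
  icst M _ (CRec T0) (dfun (fun k => dfun (fun=> f k))) n.

Lemma app_push rho n f : eval rho push n f = pushD n f.
Proof.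
rewrite !eval_lam /pushD; set g := dfun _; set r := upd _ _ _.
suff <- : eval r (lam T0 0 (fun k => lam T0 1 (fun=> App (Var T1 0) k))) = g.
  by rewrite /r ?evalE ?updE.
apply: app_ext => k; apply: app_ext => z; rewrite !eval_lam !evalE /r !updE // /g.
by rewrite dfunE; [rewrite dfunE //; rep|rep].
Qed.

Lemma eval_pow2 rho n : eval rho (App pow2 n) = p2 (eval rho n).
Proof. exact: app_pow2. Qed.

Lemma eval_push rho n f : eval rho (App (App push n) f) = pushD (eval rho n) (eval rho f).
Proof. exact: app_push. Qed.

Lemma pushD_0 n f : pushD n f 0 = n.
Proof. exact: recD0. Qed.

Lemma pushD_S n f k : pushD n f (k + 1) = f k.
Proof. by rewrite /pushD recDS dfunE ?dfunE //; rep. Qed.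

End Lambda.

Lemma eq_and (A A' B B' : Prop) : A = A' -> B = B' -> (A /\ B) = (A' /\ B').
Proof. by move=> -> ->. Qed.
Lemma eq_or (A A' B B' : Prop) : A = A' -> B = B' -> (A \/ B) = (A' \/ B').
Proof. by move=> -> ->. Qed.
Lemma eq_imp (A A' B B' : Prop) : A = A' -> B = B' -> (A -> B) = (A' -> B').
Proof. by move=> -> ->. Qed.
Lemma eq_iff (A A' B B' : Prop) : A = A' -> B = B' -> (A <-> B) = (A' <-> B').
Proof. by move=> -> ->. Qed.

Ltac sat_atom := fail.

(** The atomic formulas are matched syntactically: unification would compute the
    substitutions in them. *)
Ltac sat_step := cbv beta; lazymatch goal with
  | |- sat _ (Defs.all _ _ _) = _ => rewrite sat_all; apply: eq_forall; intro
  | |- sat _ (Defs.ex _ _ _) = _ => rewrite sat_ex; apply: eq_exists; intro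
  | |- sat _ (And _ _) = _ => rewrite sat_And; apply: eq_and
  | |- sat _ (Or _ _) = _ => rewrite sat_Or; apply: eq_or
  | |- sat _ (Iff _ _) = _ => rewrite sat_Iff; apply: eq_iff
  | |- sat _ (Imp _ _) = _ => rewrite sat_Imp; apply: eq_imp
  | |- sat _ (Not _) = _ => rewrite sat_Not; apply: (congr1 not)
  | |- sat _ (Eq _ _) = _ => rewrite sat_Eq ?(eval_push, evalE) ?updE //
  | |- sat _ (Lt _ _) = _ => rewrite sat_Lt ?(eval_pow2, evalE) ?updE //
  | |- sat _ _ = _ => etransitivity; [sat_atom|rewrite ?evalE ?updE //]
  end.

Ltac sat_solve := repeat sat_step.

(** * Meaning of the defined formulas in a model *)

Section Formulas.
Context {M : rca}.
Implicit Types (rho : env M).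

Lemma sat_rat_lt rho q r n :
  sat rho (rat_lt q r n) = ratlt (eval rho q) (eval rho r) (eval rho n).
Proof. by rewrite /rat_lt sat_pred3 /with_rats /ratlt /with_ratsD; sat_solve. Qed.

Lemma sat_rat_le rho q r n :
  sat rho (rat_le q r n) = ratle (eval rho q) (eval rho r) (eval rho n).
Proof. by rewrite /rat_le sat_pred3 /with_rats /ratle /with_ratsD; sat_solve. Qed.

Definition isreal (x : D M T1) : Prop :=
  forall n i : D M T0, ratlt (x n) (x (n + i)) n /\ ratlt (x (n + i)) (x n) n.
Definition eqR (x y : D M T1) : Prop := forall n, ratle (x n) (y n) n /\ ratle (y n) (x n) n.
Definition leR (x y : D M T1) : Prop := forall n, ratle (x n) (y n) n.
Definition ltR (x y : D M T1) : Prop := ~ leR y x.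
Definition cst (q : D M T0) : D M T1 := dfun (fun=> q).
Definition inunit (x : D M T1) : Prop :=
  isreal x /\ leR (cst (ratN 0 0 0)) x /\ leR x (cst (ratN 1 0 0)).

Ltac sat_atom ::= lazymatch goal with
  | |- sat _ (rat_lt _ _ _) = _ => exact: sat_rat_lt
  | |- sat _ (rat_le _ _ _) = _ => exact: sat_rat_le
  end.

Lemma sat_is_real rho x : sat rho (is_real x) = isreal (eval rho x).
Proof. by rewrite /is_real sat_pred1 /isreal; sat_solve. Qed.

Lemma sat_eq_R rho x y : sat rho (eq_R x y) = eqR (eval rho x) (eval rho y).
Proof. by rewrite /eq_R sat_pred2 /eqR; sat_solve. Qed.

Lemma sat_le_R rho x y : sat rho (le_R x y) = leR (eval rho x) (eval rho y).
Proof. by rewrite /le_R sat_pred2 /leR; sat_solve. Qed.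

Lemma sat_lt_R rho x y : sat rho (lt_R x y) = ltR (eval rho x) (eval rho y).
Proof. by rewrite /lt_R sat_Not sat_le_R. Qed.

Lemma eval_zero_R rho : eval rho zero_R = cst (ratN 0 0 0).
Proof.
apply: app_ext => n; rewrite /zero_R eval_lam /cst /Defs.rat /Defs.pair ?evalE.
by rewrite dfunE //; rep.
Qed.

Lemma eval_one_R rho : eval rho one_R = cst (ratN 1 0 0).
Proof.
apply: app_ext => n; rewrite /one_R eval_lam /cst /Defs.rat /Defs.pair ?evalE.
by rewrite dfunE //; rep.
Qed.

Lemma sat_in_unit rho x : sat rho (in_unit x) = inunit (eval rho x).
Proof.
rewrite /in_unit sat_And sat_is_real sat_And; congr (_ /\ (_ /\ _)).
  by rewrite sat_le_R eval_zero_R.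
by rewrite sat_le_R eval_one_R.
Qed.

Definition isbit (a : D M T0) : Prop := a = 0 \/ a = 1.
Definition funR (F : D M T2) : Prop :=
  forall x y, isreal x -> isreal y -> eqR x y -> F x = F y.
Definition funR2 (F : D M (Arr T1 T2)) : Prop := forall x y x' y',
  isreal x -> isreal y -> isreal x' -> isreal y' -> eqR x x' -> eqR y y' -> F x y = F x' y'.
Definition setN (X : D M T1) : Prop := forall n, isbit (X n).
Definition memR x (A : D M T2) : Prop := isreal x /\ A x = 1.
Definition memR2 x y (A : D M (Arr T1 T2)) : Prop := isreal x /\ isreal y /\ A x y = 1.
Definition setR (A : D M T2) : Prop := funR A /\ forall x, isreal x -> isbit (A x).
Definition setR2 (A : D M (Arr T1 T2)) : Prop :=
  funR2 A /\ forall x y, isreal x -> isreal y -> isbit (A x y).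
Definition scount (A : D M T2) : Prop := exists Y : D M T2, funR Y /\
  (forall x y, memR x A -> memR y A -> Y x = Y y -> eqR x y) /\
  (forall n, exists x, memR x A /\ Y x = n).
Definition scount2 (A : D M (Arr T1 T2)) : Prop := exists Y : D M (Arr T1 T2), funR2 Y /\
  (forall x y x' y', memR2 x y A -> memR2 x' y' A -> Y x y = Y x' y' -> eqR x x' /\ eqR y y') /\
  (forall n, exists x y, memR2 x y A /\ Y x y = n).

Ltac sat_atom ::= lazymatch goal with
  | |- sat _ (is_real _) = _ => exact: sat_is_real
  | |- sat _ (eq_R _ _) = _ => exact: sat_eq_R
  | |- sat _ (lt_R _ _) = _ => exact: sat_lt_R
  | |- sat _ (in_unit _) = _ => exact: sat_in_unit
  end.

Lemma sat_is_bit rho a : sat rho (is_bit a) = isbit (eval rho a).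
Proof. by rewrite /is_bit sat_Or. Qed.

Lemma sat_fun_R rho F : sat rho (fun_R F) = funR (eval rho F).
Proof. by rewrite /fun_R sat_pred1 /funR; sat_solve. Qed.

Lemma sat_fun_R2 rho F : sat rho (fun_R2 F) = funR2 (eval rho F).
Proof. by rewrite /fun_R2 sat_pred1 /funR2; sat_solve. Qed.

Lemma sat_mem_R rho x A : sat rho (mem_R x A) = memR (eval rho x) (eval rho A).
Proof. by rewrite /mem_R /memR; sat_solve. Qed.

Lemma sat_mem_R2 rho x y A : sat rho (mem_R2 x y A) = memR2 (eval rho x) (eval rho y) (eval rho A).
Proof. by rewrite /mem_R2 /memR2; sat_solve. Qed.

Ltac sat_atom ::= lazymatch goal with
  | |- sat _ (is_real _) = _ => exact: sat_is_real
  | |- sat _ (eq_R _ _) = _ => exact: sat_eq_R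
  | |- sat _ (lt_R _ _) = _ => exact: sat_lt_R
  | |- sat _ (in_unit _) = _ => exact: sat_in_unit
  | |- sat _ (is_bit _) = _ => exact: sat_is_bit
  | |- sat _ (fun_R _) = _ => exact: sat_fun_R
  | |- sat _ (fun_R2 _) = _ => exact: sat_fun_R2
  | |- sat _ (mem_R _ _) = _ => exact: sat_mem_R
  | |- sat _ (mem_R2 _ _ _) = _ => exact: sat_mem_R2
  end.

Lemma sat_set_N rho X : sat rho (set_N X) = setN (eval rho X).
Proof. by rewrite /set_N sat_pred1 /setN; sat_solve. Qed.

Lemma sat_set_R rho A : sat rho (set_R A) = setR (eval rho A).
Proof. by rewrite /set_R sat_pred1 /setR; sat_solve. Qed.

Lemma sat_set_R2 rho A : sat rho (set_R2 A) = setR2 (eval rho A).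
Proof. by rewrite /set_R2 sat_pred1 /setR2; sat_solve. Qed.

Lemma sat_scount rho A : sat rho (strongly_countable A) = scount (eval rho A).
Proof. by rewrite /strongly_countable sat_pred1 /scount; sat_solve. Qed.

Lemma sat_scount2 rho A : sat rho (strongly_countable2 A) = scount2 (eval rho A).
Proof. by rewrite /strongly_countable2 sat_pred1 /scount2; sat_solve. Qed.

End Formulas.

Ltac sat_atom ::= lazymatch goal with
  | |- sat _ (is_real _) = _ => exact: sat_is_real
  | |- sat _ (eq_R _ _) = _ => exact: sat_eq_R
  | |- sat _ (lt_R _ _) = _ => exact: sat_lt_R
  | |- sat _ (in_unit _) = _ => exact: sat_in_unit
  | |- sat _ (mem_R _ _) = _ => exact: sat_mem_R
  | |- sat _ (mem_R2 _ _ _) = _ => exact: sat_mem_R2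
  | |- sat _ (mem_N _ _) = _ => unfold mem_N; rewrite sat_Eq; reflexivity
  | |- sat _ (set_N _) = _ => exact: sat_set_N
  | |- sat _ (set_R _) = _ => exact: sat_set_R
  | |- sat _ (set_R2 _) = _ => exact: sat_set_R2
  | |- sat _ (strongly_countable _) = _ => exact: sat_scount
  | |- sat _ (strongly_countable2 _) = _ => exact: sat_scount2
  end.

(** * The principles as statements about a model *)

Section Principles.
Context (M : rca).

Definition DeltaCA : Prop := forall Y0 Y1 : D M T2,
  (forall n, (exists f, Y0 (pushD n f) = 0) <-> ~ (exists f, Y1 (pushD n f) = 0)) ->
  exists X : D M T1, setN X /\ forall n, X n = 1 <-> exists f, Y0 (pushD n f) = 0.

Definition cocode : Prop := forall A : D M T2, setR A ->
  (forall x, memR x A -> inunit x) -> (exists x, memR x A) -> scount A ->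
  exists xs : D M (Arr T0 T1), (forall n, memR (xs n) A) /\
    forall x, isreal x -> (memR x A <-> exists n, eqR (xs n) x).

Definition HBC : Prop := forall A : D M (Arr T1 T2), setR2 A -> scount2 A ->
  (forall x, inunit x -> exists a b, memR2 a b A /\ ltR a x /\ ltR x b) ->
  exists k, exists a b : D M (Arr T0 T1),
    (forall i, ltD i (k + 1) -> memR2 (a i) (b i) A) /\
    forall x, inunit x -> exists i, ltD i (k + 1) /\ ltR (a i) x /\ ltR x (b i).

Lemma sat_Delta_CA (rho : env M) : sat rho Delta_CA = DeltaCA.
Proof. by rewrite /Delta_CA /DeltaCA; sat_solve. Qed.

Lemma sat_cocode1 (rho : env M) : sat rho cocode1 = cocode.
Proof. by rewrite /cocode1 /cocode; sat_solve. Qed.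

Lemma sat_HBC1 (rho : env M) : sat rho HBC1 = HBC.
Proof. by rewrite /HBC1 /HBC; sat_solve. Qed.

End Principles.

(** * Real numbers in a model *)

Section Reals.
Context {M : rca}.
Implicit Types (q r n m N : D M T0) (x y z : D M T1) (k l e : frac M).

Lemma emb_max n m : exists N, emb n <= emb N /\ emb m <= emb N.
Proof.
exists (n + m); rewrite !embE; move: (emb_ge0 n) (emb_ge0 m).
by split; lra.
Qed.

(** The limit argument behind all comparisons of reals: a positive gap would exceed the error
    [c * pw m] for large [m]. *)
Lemma le_pw n k l c :
  0 <= c -> (forall m, emb n <= emb m -> k <= l + c * pw m) -> k <= l.
Proof.
move=> c0 h; rewrite leNgt; apply/negP => lk.
have d0 : 0 < (k - l) / (c + 1) by rewrite divr_gt0; lra.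
have [j hj] := pw_lim d0.
have [N [nN jN]] := emb_max n j.
have := h N nN; have pN := le_lt_trans (pw_le jN) hj.
move: pN; rewrite ltr_pdivlMr; last by lra.
by move: (pw_gt0 N); nra.
Qed.

Lemma isrealE x : isreal x <->
  (forall n, isq (x n)) /\ forall n m, emb n <= emb m -> `|val (x n) - val (x m)| < pw n.
Proof.
split=> [h|[hq h] n i]; last first.
  have := h n (n + i); rewrite embD lerDl => /(_ (emb_ge0 _)); rewrite ltr_norml => /andP[h1 h2].
  by split; apply/ratltE; do !split => //; lra.
split=> [n|n m /emb_leP[i ->]]; first by have [/ratltE[]] := h n 0.
have [/ratltE[_ [_ h1]] /ratltE[_ [_ h2]]] := h n i.
by rewrite ltr_norml; apply/andP; split; lra.
Qed.

Lemma real_isq x n : isreal x -> isq (x n).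
Proof. by move=> /isrealE[]. Qed.

Lemma real_cauchy x n m : isreal x -> emb n <= emb m ->
  val (x n) < val (x m) + pw n /\ val (x m) < val (x n) + pw n.
Proof.
move=> /isrealE[_ h] /h; rewrite ltr_norml => /andP[h1 h2].
by split; lra.
Qed.

Lemma real_cauchy2 x n m : isreal x -> val (x n) < val (x m) + pw n + pw m.
Proof.
move=> hx; have [h|/ltW h] := leP (emb n) (emb m).
  by have [h1 _] := real_cauchy hx h; have := pw_gt0 m; lra.
by have [_ h1] := real_cauchy hx h; have := pw_gt0 n; lra.
Qed.

Lemma leRE x y : isreal x -> isreal y ->
  leR x y <-> forall n, val (x n) <= val (y n) + 2 * pw n.
Proof.
move=> hx hy; split=> h n; first by have /ratleE[_ []] := h n.
by apply/ratleE; do !split => //; exact: real_isq.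
Qed.

(** The eventual form is free of the fixed rate of convergence, so inequalities can be composed by
    adding small errors. It returns to the fixed rate by comparing both sequences at one far
    index. *)
Lemma leR_evP x y : isreal x -> isreal y ->
  leR x y <-> forall e, 0 < e -> exists N, forall n, emb N <= emb n -> val (x n) <= val (y n) + e.
Proof.
move=> hx hy; rewrite leRE //; split=> [h e e0|h n].
  have [N hN] := @pw_lim M (e / 2) ltac:(by lra); exists N => n Nn.
  by have := h n; have := pw_le Nn; lra.
apply: (@le_pw n _ _ 2) => // m nm.
have [N hN] := h _ (pw_gt0 m); have [p [mp Np]] := emb_max m N.
have np := le_trans nm mp.
have [h1 _] := real_cauchy hx np; have [_ h2] := real_cauchy hy np.
by have := hN _ Np; have := pw_gt0 m; lra.
Qed.

Lemma ltR_evP x y : isreal x -> isreal y ->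
  ltR x y <-> exists2 e, 0 < e & exists N, forall n, emb N <= emb n -> val (x n) + e <= val (y n).
Proof.
move=> hx hy; split=> [h|[e e0 [N h]] /(leR_evP hy hx) /(_ (e / 2) ltac:(by lra)) [N' h']].
  have [n hn] : exists n, val (x n) + 2 * pw n < val (y n).
    apply: contrapT => nh; apply: h; apply/leRE => // n.
    by rewrite leNgt; apply/negP => hn; apply: nh; exists n.
  exists (val (y n) - val (x n) - 2 * pw n); first by lra.
  exists n => m nm; have [h1 h2] := real_cauchy hx nm; have [h3 h4] := real_cauchy hy nm.
  by lra.
have [p [Np N'p]] := emb_max N N'.
by have := h p Np; have := h' p N'p; lra.
Qed.

Lemma ltR_leR x y : isreal x -> isreal y -> ltR x y -> leR x y.
Proof.
move=> hx hy /(ltR_evP hx hy)[e e0 [N h]]; apply/leR_evP => // e' e'0.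
by exists N => n /h; lra.
Qed.

Lemma leR_trans x y z : isreal x -> isreal y -> isreal z -> leR x y -> leR y z -> leR x z.
Proof.
move=> hx hy hz /(leR_evP hx hy) h1 /(leR_evP hy hz) h2; apply/leR_evP => // e e0.
have [N hN] := h1 (e / 2) ltac:(by lra); have [N' hN'] := h2 (e / 2) ltac:(by lra).
have [p [Np N'p]] := emb_max N N'; exists p => n pn.
have := hN n (le_trans Np pn); have := hN' n (le_trans N'p pn); lra.
Qed.

Lemma ltR_leR_trans x y z : isreal x -> isreal y -> isreal z -> ltR x y -> leR y z -> ltR x z.
Proof. by move=> hx hy hz xy yz zx; apply: xy; apply: leR_trans zx. Qed.

Lemma leR_ltR_trans x y z : isreal x -> isreal y -> isreal z -> leR x y -> ltR y z -> ltR x z.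
Proof. by move=> hx hy hz xy yz zx; apply: yz; apply: leR_trans xy. Qed.

Lemma eqR_leR x y : eqR x y <-> leR x y /\ leR y x.
Proof. by split=> [h|[h1 h2] n]; split=> // n; have [] := h n. Qed.

Lemma eqR_refl x : isreal x -> eqR x x.
Proof.
move=> hx; have h : leR x x by apply/leRE => // n; have := pw_gt0 n; lra.
by apply/eqR_leR.
Qed.

Lemma eqR_sym x y : eqR x y -> eqR y x.
Proof. by move=> /eqR_leR[h1 h2]; apply/eqR_leR. Qed.

Lemma eqR_trans x y z : isreal x -> isreal y -> isreal z -> eqR x y -> eqR y z -> eqR x z.
Proof.
move=> hx hy hz /eqR_leR[h1 h2] /eqR_leR[h3 h4]; apply/eqR_leR.
by split; [apply: (leR_trans hx hy)|apply: (leR_trans hz hy)].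
Qed.

Lemma cstE q n : cst q n = q.
Proof. by rewrite /cst dfunE //; rep. Qed.

Lemma cst_real q : isq q -> isreal (cst q).
Proof.
move=> hq; apply/isrealE; split=> [n|n m _]; rewrite !cstE //.
by rewrite subrr normr0 pw_gt0.
Qed.

Lemma leR_cst q r : isq q -> isq r -> leR (cst q) (cst r) <-> val q <= val r.
Proof.
move=> hq hr; rewrite leRE //; try exact: cst_real.
split=> [h|h n]; last by rewrite !cstE; have := pw_gt0 n; lra.
by apply: (@le_pw 0 _ _ 2) => // m _; have := h m; rewrite !cstE.
Qed.

(** One side is exact, so the tolerance drops from [2 * pw n] to [pw n]. *)
Lemma leR_cstl q x : isq q -> isreal x -> leR (cst q) x <-> forall n, val q <= val (x n) + pw n.
Proof.
move=> hq hx; rewrite leRE //; last exact: cst_real.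
split=> [h n|h n]; last by rewrite cstE; have := h n; have := pw_gt0 n; lra.
apply: (@le_pw n _ _ 2) => // m nm; have := h m; rewrite cstE.
by have [_] := real_cauchy hx nm; lra.
Qed.

Lemma leR_cstr q x : isq q -> isreal x -> leR x (cst q) <-> forall n, val (x n) <= val q + pw n.
Proof.
move=> hq hx; rewrite leRE //; last exact: cst_real.
split=> [h n|h n]; last by rewrite cstE; have := h n; have := pw_gt0 n; lra.
apply: (@le_pw n _ _ 2) => // m nm; have := h m; rewrite cstE.
by have [+ _] := real_cauchy hx nm; lra.
Qed.

Lemma cst_lowl q x n : isq q -> isreal x -> val q <= val (x n) - pw n -> leR (cst q) x.
Proof.
by move=> hq hx h; apply/leR_cstl => // m; have := real_cauchy2 n m hx; lra.
Qed.

Lemma cst_gtr q x n : isq q -> isreal x -> val (x n) + pw n < val q -> ltR x (cst q).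
Proof. by move=> hq hx h /leR_cstl - /(_ hq hx n); lra. Qed.

Lemma cst_ltl q x n : isq q -> isreal x -> val q < val (x n) - pw n -> ltR (cst q) x.
Proof. by move=> hq hx h /leR_cstr - /(_ hq hx n); lra. Qed.

Lemma cst_between q r x : isq q -> isq r -> isreal x -> leR (cst q) x -> leR x (cst r) ->
  val q <= val r.
Proof.
move=> hq hr hx h1 h2; apply/leR_cst => //.
by apply: leR_trans h1 h2 => //; apply: cst_real.
Qed.

(** Lower bounds of one real with errors below 2^(-n) are automatically Cauchy at the required
    rate. *)
Lemma approx_real x y : isreal x -> (forall n, isq (y n)) ->
  (forall n, leR (cst (y n)) x /\ exists r, isq r /\ leR x (cst r) /\ val r < val (y n) + pw n) ->
  isreal y /\ eqR y x.
Proof.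
move=> hx yq h.
have close n m : val (y n) < val (y m) + pw m.
  have [h1 _] := h n; have [_ [r [hr [h2 h3]]]] := h m.
  by have := cst_between (yq n) hr hx h1 h2; lra.
have hy : isreal y.
  apply/isrealE; split=> // n m /pw_le nm; rewrite ltr_norml.
  by have := close n m; have := close m n => ? ?; apply/andP; split; lra.
split=> //; apply/eqR_leR; split; apply/leRE => // n; have [h1 [r [hr [h2 h3]]]] := h n.
  by have /(leR_cstl (yq n) hx)/(_ n) := h1; have := pw_gt0 n; lra.
by have /(leR_cstr hr hx)/(_ n) := h2; lra.
Qed.

Lemma eqR_cst q r : isq q -> isq r -> val q = val r -> eqR (cst q) (cst r).
Proof. by move=> hq hr e; apply/eqR_leR; split; apply/leR_cst; rewrite // e. Qed.

End Reals.

(** * Grilliot's trick *)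

Definition predN (M : rca) (n : D M T0) : D M T0 := rec (fun k _ => k) 0 n.

(** The code of the point [(a - b + i / 2^n) / d], for [d] nonzero. *)
Definition grid (M : rca) (a b d n i : D M T0) : D M T0 :=
  ratN (a * p2 n + i) (b * p2 n) (predN (d * p2 n)).

Section RepGrid.
Context {M : rca} {C : seq ty}.
Implicit Types F G H : @dctx M C -> D M T0.

Lemma Rp_cst F : Rp F -> Rp (fun e => cst (F e)).
Proof. by rewrite /cst; rep. Qed.

Lemma Rp_predN F : Rp F -> Rp (fun e => predN (F e)).
Proof. by rewrite /predN; rep. Qed.

Lemma Rp_grid F1 F2 F3 F G : Rp F1 -> Rp F2 -> Rp F3 -> Rp F -> Rp G ->
  Rp (fun e => grid (F1 e) (F2 e) (F3 e) (F e) (G e)).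
Proof.
move=> r1 r2 r3 rF rG; rewrite /grid; apply: Rp_ratN; last apply: Rp_predN; by rep.
Qed.

End RepGrid.

Ltac rep_grid := lazymatch goal with
  | |- Rp (fun e => cst (@?F e)) => refine (@Rp_cst _ _ F _)
  | |- Rp (fun e => predN (@?F e)) => refine (@Rp_predN _ _ F _)
  | |- Rp (fun e => grid (@?F1 e) (@?F2 e) (@?F3 e) (@?F e) (@?G e)) =>
      refine (@Rp_grid _ _ F1 F2 F3 F G _ _ _ _ _)
  end.

Ltac rep_ext ::= first [rep_logic | rep_arith | rep_codes | rep_grid].

Section Grid.
Context {M : rca}.
Implicit Types (q r n m i : D M T0) (x y z : D M T1) (f j : D M T1).

Lemma predN_S n : predN (n + 1) = n.
Proof. by rewrite /predN [LHS]recS //; rep. Qed.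

Lemma emb_predN n : 0 < emb n -> emb (predN n) + 1 = emb n.
Proof.
move=> n0; have [e|/nz_succ[m ->]] := pselect (n = 0); first by rewrite e emb0 ltxx in n0.
by rewrite -[addD m oneD]/(m + 1) predN_S !embE.
Qed.

Variables (a b d : D M T0).
Hypothesis d1 : (1 : frac M) <= emb d.

Notation G := (grid a b d).

Lemma grid_isq n i : isq (G n i).
Proof. by exists (a * p2 n + i), (b * p2 n), (predN (d * p2 n)). Qed.

Lemma val_grid n i : val (G n i) = (emb a - emb b + emb i * pw n) / emb d.
Proof.
have d1' := d1; have d0 : emb d != 0 by apply: lt0r_neq0; lra.
rewrite val_rat frE_emb emb_predN !embE; last by rewrite mulr_gt0 ?p2_gt0 //; lra.
by rewrite /pw; field; rewrite d0 p2_neq0.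
Qed.

Variable j : D M T1.
Hypothesis jS : forall n, j (n + 1) = j n + j n \/ j (n + 1) = j n + j n + 1.

(** The limit of a bisection that keeps cell [j n] at stage [n]: by [jS] this cell is one of the
    halves of the preceding one. The bound on [d] makes the cells no longer than 2^(-n), the rate
    demanded of a real. *)
Definition grid_lim : D M T1 := dfun (fun n => G n (j n)).

Lemma grid_limE n : grid_lim n = G n (j n).
Proof. by rewrite /grid_lim dfunE //; rep. Qed.

Lemma grid_mono n m : emb n <= emb m ->
  emb (j n) * pw n <= emb (j m) * pw m /\ (emb (j m) + 1) * pw m <= (emb (j n) + 1) * pw n.
Proof.
move=> /emb_leP[i ->].
(* The nesting of the cells is restated with natural numbers of the model, which makes it a
   predicate that admits induction. *)
suff [/ltD_nemb h1 /ltD_nemb h2] : ~ ltD (j (n + i)) (j n * p2 i) /\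
    ~ ltD ((j n + 1) * p2 i) (j (n + i) + 1).
  have := p2_pw i; have := pw_gt0 n; have := pw_gt0 i; move: h1 h2.
  rewrite pw_add !embE => h1 h2 pi pn e.
  have -> : emb (j n) * pw n = (emb (j n) * emb (p2 i)) * (pw n * pw i).
    by rewrite -mulrA (mulrCA (emb (p2 i))) e mulr1.
  have -> : (emb (j n) + 1) * pw n = ((emb (j n) + 1) * emb (p2 i)) * (pw n * pw i).
    by rewrite -mulrA (mulrCA (emb (p2 i))) e mulr1.
  by split; apply: ler_wpM2r => //; apply/ltW/mulr_gt0.
apply: (indP (P := fun i => ~ ltD (j (n + i)) (j n * p2 i) /\
    ~ ltD ((j n + 1) * p2 i) (j (n + i) + 1))) => [||k [/ltD_nemb h1 /ltD_nemb h2]]; first by rep.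
  by rewrite p2_0 !mulr1 addr0; split; exact: ltD_irr.
move: h1 h2; rewrite -[addD k oneD]/(k + 1) addrA p2_S => h1 h2.
by have [->|->] := jS (n + k); split; apply/ltD_nemb; move: h1 h2; rewrite !embE; lra.
Qed.

Lemma val_grid_succ n i : val (G n (i + 1)) = val (G n i) + pw n / emb d.
Proof. by rewrite !val_grid embD emb1 -mulrDl; congr (_ / _); ring. Qed.

Lemma grid_close n m : emb n <= emb m -> val (G n (j n)) <= val (G m (j m)) /\
  val (G m (j m)) + pw m / emb d <= val (G n (j n)) + pw n / emb d.
Proof.
move=> /grid_mono[h1 h2]; have d0 : 0 < (emb d)^-1 by have := d1; rewrite invr_gt0; lra.
by rewrite !val_grid -!mulrDl; split; apply: ler_wpM2r; lra.
Qed.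

Lemma pw_div_gt0 n : 0 < pw n / emb d.
Proof. by apply: divr_gt0; [exact: pw_gt0|have := d1; lra]. Qed.

Lemma pw_div_le n : pw n / emb d <= pw n.
Proof.
have h := d1; have d0 : 0 < emb d by lra.
by rewrite ler_pdivrMr //; have := pw_gt0 n; nra.
Qed.

Lemma grid_lim_real : isreal grid_lim.
Proof.
apply/isrealE; split=> [n|n m nm]; rewrite !grid_limE; first exact: grid_isq.
have [h1 h2] := grid_close nm.
move: (pw_div_gt0 m) (pw_div_gt0 n) (pw_div_le n) h1 h2.
move: (val _) (val _) (_ / _) (_ / _) => u v w t ? ? ? ? ?.
by rewrite ltr_norml; apply/andP; split; lra.
Qed.

Lemma grid_lim_ge n : leR (cst (G n (j n))) grid_lim.
Proof.
apply/leR_cstl => [||m]; [exact: grid_isq|exact: grid_lim_real|rewrite grid_limE].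
move: (pw_div_gt0 n) (pw_div_le m) (pw_gt0 m) => ? ? ?.
by have [nm|/ltW nm] := leP (emb n) (emb m); have [h1 h2] := grid_close nm; lra.
Qed.

Lemma grid_lim_le n : leR grid_lim (cst (G n (j n + 1))).
Proof.
apply/leR_cstr => [||m]; [exact: grid_isq|exact: grid_lim_real|rewrite grid_limE].
rewrite (val_grid_succ n); move: (pw_div_gt0 n) (pw_div_gt0 m) (pw_gt0 m) => ? ? ?.
by have [nm|/ltW nm] := leP (emb n) (emb m); have [h1 h2] := grid_close nm; lra.
Qed.

End Grid.

(** Feferman's search operator, a form of Kleene's quantifier functional $\exists^2$. *)
Definition has_mu (M : rca) : Prop :=
  exists mu : D M T2, forall f : D M T1, (exists n, f n = 0) -> f (mu f) = 0.

Section Grilliot.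
Context {M : rca}.
Implicit Types (q r n m i k : D M T0) (x y z : D M T1) (f : D M T1).

(** The least [m < k] with [f m = 0], or [k] if there is none. *)
Definition search f k : D M T0 :=
  rec (fun m i => ite (i = m) (ite (f m = 0) m (m + 1)) i) 0 k.

Lemma search_0 f : search f 0 = 0.
Proof. exact: rec0. Qed.

Lemma search_S f k : search f (k + 1) =
  ite (search f k = k) (ite (f k = 0) k (k + 1)) (search f k).
Proof. by rewrite /search [LHS]recS //; rep. Qed.

Lemma ltD_S k : ltD k (k + 1).
Proof. by apply/ltDE; rewrite !embE; lra. Qed.

Lemma ltD_ne k m : ltD k m -> k <> m.
Proof. by move=> h e; move: h; rewrite e => /ltD_irr. Qed.

Lemma search_found f k : search f k = k \/ ltD (search f k) k /\ f (search f k) = 0.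
Proof.
apply: (indP (P := fun k => search f k = k \/ ltD (search f k) k /\ f (search f k) = 0))
  => [||n]; first by rewrite /search; rep.
  by left; apply: search_0.
rewrite [addD n oneD]/(n + 1) search_S => -[e|[h1 h2]].
  rewrite iteT //; have [fn|fn] := pselect (f n = 0); last by rewrite iteF //; left.
  by rewrite iteT //; right; split=> //; apply: ltD_S.
rewrite iteF; last exact: ltD_ne.
by right; split=> //; apply: ltD_trans h1 (ltD_S n).
Qed.

Lemma search_stable f k i : search f k <> k -> search f (k + i) = search f k.
Proof.
move=> ne; have [//|[lt _]] := search_found f k.
apply: (indP (P := fun i => search f (k + i) = search f k)) => [||n IH]; first by rewrite /search; rep.
  by rewrite addr0.
rewrite [addD n oneD]/(n + 1) addrA search_S iteF // IH; apply: ltD_ne.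
by move: lt; rewrite !ltDE !embE; have := emb_ge0 n; lra.
Qed.

Lemma search_stops f m : f m = 0 -> search f (m + 1) <> m + 1.
Proof.
move=> fm; rewrite search_S; have [e|e] := pselect (search f m = m).
  by rewrite !iteT //; apply: ltD_ne; apply: ltD_S.
rewrite iteF //; have [//|[lt _]] := search_found f m.
by apply: ltD_ne; apply: ltD_trans lt (ltD_S m).
Qed.

Lemma search_ge f k i : search f k = k -> emb k <= emb (search f (k + i)).
Proof.
move=> e; apply/ltD_nemb.
apply: (indP (P := fun i => ~ ltD (search f (k + i)) k)) => [||n IH]; first by rewrite /search; rep.
  by rewrite addr0 e; apply: ltD_irr.
rewrite [addD n oneD]/(n + 1) addrA search_S /ite; case: pselect => // e'.
by case: pselect => ?; apply/ltD_nemb; rewrite !embE; have := emb_ge0 n; lra.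
Qed.

Lemma search_none f k : (forall n, f n <> 0) -> search f k = k.
Proof. by move=> h; have [//|[_ /h]] := search_found f k. Qed.

(** [F] is discontinuous at [c], as witnessed by the rationals [d m]. They are kept apart from the
    sequence [c] because they may be right endpoints of a bisection whose left endpoints represent
    [c]. *)
Variables (F : D M T2) (c d : D M T1).
Hypotheses (F_ext : funR F) (c_real : isreal c) (d_isq : forall m, isq (d m)).
Hypothesis cd_close : forall n m, emb n <= emb m -> `|val (c n) - val (d m)| < pw n.
Hypothesis cd_neq : forall m, F (cst (d m)) <> F c.

(** Agrees with [c] as long as no zero of [f] is found, and is equal to a rational
    [d m] if there is one. *)
Definition switch f : D M T1 :=
  dfun (fun k => ite (search f k = k) (c k) (d (search f k))).

Lemma switchE f k : switch f k = ite (search f k = k) (c k) (d (search f k)).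
Proof. by rewrite /switch dfunE // /search; rep. Qed.

Lemma switch_none f : (forall n, f n <> 0) -> switch f = c.
Proof. by move=> h; apply: app_ext => k; rewrite switchE iteT //; apply: search_none. Qed.

(** With [p] the first zero, the sequence follows [c] up to index [p] and is constantly [d p]
    afterwards. By [cd_close] it is a real, equal to the rational [d p], where [F] differs from
    [F c]. *)
Lemma switch_found f m : f m = 0 -> F (switch f) <> F c.
Proof.
move=> fm; set p := search f (m + 1).
have swE k : (switch f k = d p /\ emb p < emb k) \/ (switch f k = c k /\ emb k <= emb p).
  have e1 : search f (m + 1 + k) = p by apply: search_stable; apply: search_stops.
  rewrite switchE; have [e|e] := pselect (search f k = k).
    by right; rewrite iteT //; split=> //; rewrite -e1 addrC; apply: search_ge.
  have e2 : search f k = p by rewrite -(search_stable (m + 1) e) addrC e1.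
  left; rewrite iteF // e2; split=> //; apply/ltDE.
  by rewrite -e2; have [//|[]] := search_found f k.
have near k : `|val (switch f k) - val (d p)| < pw k.
  by have [[-> _]|[-> /cd_close //]] := swE k; rewrite subrr normr0 pw_gt0.
have sw_real : isreal (switch f).
  apply/isrealE; split=> [k|n k nk].
    by have [[-> _]|[-> _]] := swE k; [apply: d_isq|apply: real_isq].
  have [[-> pn]|[-> np]] := swE n; have [[-> pk]|[-> kp]] := swE k.
  - by rewrite subrr normr0 pw_gt0.
  - by have := lt_le_trans pn (le_trans nk kp); rewrite ltxx.
  - exact: cd_close.
  - by have /isrealE[_] := c_real; apply.
rewrite (F_ext sw_real (cst_real (d_isq p))); first exact: cd_neq.
apply/eqR_leR; split; apply/leRE => //; try exact: cst_real.
  by move=> k; rewrite cstE; have := near k; have := pw_gt0 k; rewrite ltr_norml => ? /andP[? ?]; lra.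
by move=> k; rewrite cstE; have := near k; have := pw_gt0 k; rewrite ltr_norml => ? /andP[? ?]; lra.
Qed.

(** Whether [f] has a zero is now decided by the equation [F (switch f) = F c], so the statement
    that [n] is a zero if there is one becomes a representable matrix, and choice selects such an
    [n]. *)
Lemma grilliot : has_mu M.
Proof.
have [||mu muP] := @choice1 M (fun f n => F (switch f) <> F c -> f n = 0).
- by rewrite /switch /search; rep.
- move=> f; have [[n fn]|nf] := pselect (exists n, f n = 0); first by exists n.
  exists 0 => h; case: h; rewrite switch_none // => n fn; apply: nf; by exists n.
by exists mu => f [m /switch_found/muP].
Qed.

End Grilliot.

(** * A nonconstant function on the reals yields [mu] *)

Section Discontinuity.
Context {M : rca}.
Implicit Types (q r n m i k : D M T0) (x y z : D M T1).
Variable F : D M T2.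
Hypothesis F_ext : funR F.

Lemma mu_of_approximations x : isreal x -> (forall n, F (cst (x n)) <> F x) -> has_mu M.
Proof.
move=> hx; apply: (grilliot F_ext hx) => [n|n m nm]; first exact: real_isq.
by have /isrealE[_] := hx; apply.
Qed.

Lemma F_cst q r : isq q -> isq r -> val q = val r -> F (cst q) = F (cst r).
Proof. by move=> hq hr e; apply: F_ext; try exact: cst_real; apply: eqR_cst. Qed.

(** Bisection keeps the value [v] at the left endpoint and another value at the right one. At the
    limit [c], if [F c = v] the right endpoints witness discontinuity, otherwise the left ones. The
    bound 2 on [d] makes cells strictly shorter than 2^(-n), as the strict inequality in [cd_close]
    requires for right endpoints. *)
Lemma mu_of_step a b d : 2 <= emb d ->
  F (cst (grid a b d 0 0)) <> F (cst (grid a b d 0 1)) -> has_mu M.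
Proof.
move=> d2; have d1 : 1 <= emb d by lra.
set v := F (cst (grid a b d 0 0)) => vn.
(* Point [i + i + 1] of level [n + 1] is the midpoint of cell [i] of level [n]; it becomes the new
   left endpoint exactly when [F] still has the value [v] there. *)
pose jj n : D M T0 := rec (fun n i => ite (F (cst (grid a b d (n + 1) (i + i + 1))) = v)
  (i + i + 1) (i + i)) 0 n.
pose j : D M T1 := dfun jj.
have jE n : j n = jj n by rewrite /j dfunE // /jj; rep.
have j0 : j 0 = 0 by rewrite jE /jj rec0.
have jS n : j (n + 1) = ite (F (cst (grid a b d (n + 1) (j n + j n + 1))) = v)
    (j n + j n + 1) (j n + j n).
  by rewrite !jE /jj [LHS]recS //; rep.
have jS' n : j (n + 1) = j n + j n \/ j (n + 1) = j n + j n + 1.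
  by rewrite jS /ite; case: pselect; [right|left].
have G2 n i : F (cst (grid a b d (n + 1) (i + i))) = F (cst (grid a b d n i)).
  apply: F_cst; try exact: grid_isq.
  by rewrite !val_grid // pw_S !embE; congr (_ / _); lra.
have inv n : F (cst (grid a b d n (j n))) = v /\ F (cst (grid a b d n (j n + 1))) <> v.
  apply: (indP (P := fun n => F (cst (grid a b d n (j n))) = v /\
    F (cst (grid a b d n (j n + 1))) <> v)) => [||m [h1 h2]]; first by rep.
    by rewrite j0 add0r; split=> // e; apply: vn.
  rewrite [addD m oneD]/(m + 1) jS.
  have [e|e] := pselect (F (cst (grid a b d (m + 1) (j m + j m + 1))) = v).
    rewrite iteT //; split=> //.
    have -> : j m + j m + 1 + 1 = (j m + 1) + (j m + 1) by rewrite addrACA addrA.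
    by rewrite G2.
  by rewrite iteF // G2.
pose c := grid_lim a b d j; have c_real : isreal c by apply: grid_lim_real.
have close n m : emb n <= emb m ->
    [/\ val (grid a b d n (j n)) <= val (grid a b d m (j m)) < val (grid a b d n (j n)) + pw n,
        0 < pw m / emb d & val (grid a b d m (j m)) + pw m / emb d < val (grid a b d n (j n)) + pw n].
  move=> nm; have [h1 h2] := grid_close a b d1 jS' nm.
  have pd : pw n / emb d < pw n.
    by rewrite ltr_pdivrMr; have := pw_gt0 n; [nra|lra].
  have pm := pw_div_gt0 d1 m.
  move: h1 h2 pd pm; move: (val _) (val _) (_ / _) (_ / _) => u w s t ? ? ? ?.
  by split; [apply/andP; split|..]; lra.
have [e|e] := pselect (F c = v).
  pose e1 : D M T1 := dfun (fun n => grid a b d n (j n + 1)).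
  have e1E n : e1 n = grid a b d n (j n + 1) by rewrite /e1 dfunE //; rep.
  apply: (@grilliot M F c e1) => // [m|n m nm|m]; rewrite e1E.
  - exact: grid_isq.
  - rewrite /c grid_limE val_grid_succ //; have [/andP[h1 h2] h3 h4] := close n m nm.
    by rewrite ltr_norml; apply/andP; split; move: h1 h2 h3 h4; lra.
  - by rewrite e; have [] := inv m.
apply: (@grilliot M F c c) => // [m|n m nm|m]; first exact: real_isq.
  by have /isrealE[_] := c_real; apply.
by rewrite /c grid_limE; have [-> _] := inv m; exact: nesym.
Qed.

(** On a grid through both rationals some neighbouring points must have different values; otherwise
    induction on the number of steps would carry the value at [q] over to [r]. *)
Lemma mu_of_rationals q r : isq q -> isq r -> F (cst q) <> F (cst r) -> has_mu M.
Proof.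
wlog qr : q r / val q <= val r.
  move=> h hq hr ne; have [le|/ltW le] := leP (val q) (val r); first exact: (h q r).
  by apply: (h r q) => //; apply: nesym.
move=> hq hr; have [a [b [c qE]]] := hq; have [a' [b' [c' rE]]] := hr.
(* A common denominator, doubled so that [2 <= emb d]; with the common subtrahend [o] the two
   rationals become (l - o) / d and (u - o) / d. *)
pose d := (c + 1) * (c' + 1) + (c + 1) * (c' + 1).
pose l := a * (c' + 1) + b' * (c + 1) + (a * (c' + 1) + b' * (c + 1)).
pose u := a' * (c + 1) + b * (c' + 1) + (a' * (c + 1) + b * (c' + 1)).
pose o := b * (c' + 1) + b' * (c + 1) + (b * (c' + 1) + b' * (c + 1)).
have c0 := emb_ge0 c; have c'0 := emb_ge0 c'.
have d2 : 2 <= emb d by rewrite /d !embE; nra.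
have d1 : 1 <= emb d by lra.
have cn : emb c + 1 != 0 by apply: lt0r_neq0; lra.
have c'n : emb c' + 1 != 0 by apply: lt0r_neq0; lra.
have dn : (emb c + 1) * (emb c' + 1) + (emb c + 1) * (emb c' + 1) != 0.
  by apply: lt0r_neq0; nra.
have qv : val q = (emb l - emb o) / emb d.
  by rewrite qE val_rat frE_emb /l /o /d !embE; field; rewrite dn ?cn ?c'n.
have rv : val r = (emb u - emb o) / emb d.
  by rewrite rE val_rat frE_emb /u /o /d !embE; field; rewrite dn ?cn ?c'n.
have [w wE] : exists w, u = l + w.
  apply: emb_leP; move: qr; rewrite qv rv ler_pM2r; last by rewrite invr_gt0; lra.
  by rewrite lerD2r.
move=> ne; apply: contrapT => nmu; apply: ne.
have step i : F (cst (grid (l + i) o d 0 0)) = F (cst (grid l o d 0 0)).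
  apply: (indP (P := fun i => F (cst (grid (l + i) o d 0 0)) = F (cst (grid l o d 0 0))))
    => [||k IH]; first by rep.
    by rewrite addr0.
  rewrite [addD k oneD]/(k + 1) -IH; apply: contrapT => ne; apply: nmu.
  apply: (@mu_of_step (l + k) o d d2) => e; apply: ne; rewrite e.
  apply: F_cst; try exact: grid_isq.
  by rewrite !val_grid // pw_0 !embE; congr (_ / _); lra.
rewrite (@F_cst q (grid l o d 0 0)) ?(@F_cst r (grid (l + w) o d 0 0)) //; try exact: grid_isq.
  by rewrite rv val_grid // pw_0 -wE embE mulr1 addr0.
by rewrite qv val_grid // pw_0 embE mulr1 addr0.
Qed.

(** Either one of the reals is approximated by rationals at which [F] differs from its value there,
    or each shares its value with one of its approximations and [F] separates two rationals. *)
Lemma mu_of_nonconstant x y : isreal x -> isreal y -> F x <> F y -> has_mu M.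
Proof.
move=> hx hy ne.
have [h|/existsNP[n /contrapT hn]] := pselect (forall n, F (cst (x n)) <> F x).
  exact: mu_of_approximations h.
have [h|/existsNP[m /contrapT hm]] := pselect (forall n, F (cst (y n)) <> F y).
  exact: mu_of_approximations h.
by apply: (@mu_of_rationals (x n) (y m)); [exact: real_isq|exact: real_isq|rewrite hn hm].
Qed.

End Discontinuity.

(** * Arithmetical predicates become decidable *)

Lemma Rp_exists (M : rca) C (P : @dctx M C -> D M T0 -> Prop) : has_mu M ->
  @RpP M (T0 :: C) (fun e => P e.2 e.1) -> RpP (fun e => exists n, P e n).
Proof.
move=> [mu muP] rP; pose f e := dfun (fun n => chi (P e n)).
have fE e n : f e n = 0 <-> P e n.
  have [h hE] := rP; rewrite /f dfunE ?chi0 //.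
  by exists (@apps M C T1 h e) => -[m []] /=; exact: (hE (m, e)).
apply: (@RpP_ext _ _ (fun e => f e (mu (f e)) = 0)).
  move=> e; split=> [/fE h|[n /fE h]]; first by exists (mu (f e)).
  by apply: muP; exists n.
by rewrite /f; rep.
Qed.

Lemma Rp_forall (M : rca) C (P : @dctx M C -> D M T0 -> Prop) : has_mu M ->
  @RpP M (T0 :: C) (fun e => P e.2 e.1) -> RpP (fun e => forall n, P e n).
Proof.
move=> hmu rP; apply: (@RpP_ext _ _ (fun e => ~ exists n, ~ P e n)).
  move=> e; split=> [h n|h [n]]; last exact.
  by apply: contrapT => nP; apply: h; exists n.
by apply/RpP_not/Rp_exists => //; apply: RpP_not.
Qed.

Ltac rep_quant := lazymatch goal with
  | |- Rp (fun e => chi (exists n : _, @?P e n)) => apply: (Rp_exists (P := P)); [assumption|unfold RpP]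
  | |- Rp (fun e => chi (forall n : _, @?P e n)) => apply: (Rp_forall (P := P)); [assumption|unfold RpP]
  end.

Ltac rep_ext ::= first [rep_logic | rep_arith | rep_codes | rep_grid | rep_quant].

Section RepReals.
Context {M : rca} {C : seq ty}.
Hypothesis hmu : has_mu M.

Lemma Rp_ratlt (F G H : @dctx M C -> D M T0) : Rp F -> Rp G -> Rp H ->
  RpP (fun e => ratlt (F e) (G e) (H e)).
Proof. by rewrite /ratlt /with_ratsD; rep. Qed.

Lemma Rp_ratle (F G H : @dctx M C -> D M T0) : Rp F -> Rp G -> Rp H ->
  RpP (fun e => ratle (F e) (G e) (H e)).
Proof. by rewrite /ratle /with_ratsD; rep. Qed.

End RepReals.

Ltac rep_rats := lazymatch goal with
  | |- Rp (fun e => chi (ratlt (@?F e) (@?G e) (@?H e))) =>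
      refine (@Rp_ratlt _ _ _ F G H _ _ _); [assumption|..]
  | |- Rp (fun e => chi (ratle (@?F e) (@?G e) (@?H e))) =>
      refine (@Rp_ratle _ _ _ F G H _ _ _); [assumption|..]
  end.

Ltac rep_ext ::= first [rep_logic | rep_arith | rep_codes | rep_grid | rep_rats | rep_quant].

Section RepRelations.
Context {M : rca} {C : seq ty}.
Hypothesis hmu : has_mu M.
Implicit Types F G : @dctx M C -> D M T1.

Lemma Rp_isreal F : Rp F -> RpP (fun e => isreal (F e)).
Proof. by rewrite /isreal; rep. Qed.

Lemma Rp_leR F G : Rp F -> Rp G -> RpP (fun e => leR (F e) (G e)).
Proof. by rewrite /leR; rep. Qed.

Lemma Rp_eqR F G : Rp F -> Rp G -> RpP (fun e => eqR (F e) (G e)).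
Proof. by rewrite /eqR; rep. Qed.

End RepRelations.

Ltac rep_rel := lazymatch goal with
  | |- Rp (fun e => chi (isreal (@?F e))) => refine (@Rp_isreal _ _ _ F _); [assumption|]
  | |- Rp (fun e => chi (leR (@?F e) (@?G e))) => refine (@Rp_leR _ _ _ F G _ _); [assumption|..]
  | |- Rp (fun e => chi (eqR (@?F e) (@?G e))) => refine (@Rp_eqR _ _ _ F G _ _); [assumption|..]
  end.

Ltac rep_unfold := progress unfold leN, ltR, inunit, memR, memR2.
Ltac rep_ext ::=
  first [rep_logic | rep_arith | rep_codes | rep_grid | rep_rats | rep_rel | rep_quant | rep_unfold].

(** * Dedekind cuts and canonical representations *)

Section WithMu.
Context {M : rca}.
Hypothesis hmu : has_mu M.
Implicit Types (p q r n m i k : D M T0) (x y z f g : D M T1).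

Definition mu : D M T2 := sval (cid hmu).

Definition pick (P : D M T0 -> Prop) : D M T0 := mu (dfun (fun n => chi (P n))).

Lemma pickP (P : D M T0 -> Prop) : @RpP M [:: T0] (fun e => P e.1) -> (exists n, P n) -> P (pick P).
Proof.
move=> rP [n Pn]; have fE m : dfun (fun n => chi (P n)) m = 0 <-> P m by rewrite dfunE ?chi0.
by apply/fE; rewrite /pick /mu; case: cid => /= mu' h; apply: h; exists n; apply/fE.
Qed.

(** The Dedekind cut of [x]; unlike [x] itself it depends only on the real number
    that [x] represents. *)
Definition cut x : D M T1 := dfun (fun q => chi (leR (cst q) x)).

Lemma cutE x q : cut x q = chi (leR (cst q) x).
Proof. by rewrite /cut dfunE //; rep. Qed.

Lemma leR_isq q x : leR (cst q) x -> isq q.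
Proof. by move=> /(_ 0)/ratleE[]; rewrite cstE. Qed.

Lemma leR_eqR_r x y z : isreal x -> isreal y -> isreal z -> eqR x y -> leR z x -> leR z y.
Proof. by move=> hx hy hz /eqR_leR[h _] h'; apply: (leR_trans hz hx). Qed.

Lemma leR_eqR_l x y z : isreal x -> isreal y -> isreal z -> eqR x y -> leR x z -> leR y z.
Proof. by move=> hx hy hz /eqR_leR[_ h] h'; apply: (leR_trans hy hx). Qed.

Lemma cut_ext x y : isreal x -> isreal y -> eqR x y -> cut x = cut y.
Proof.
move=> hx hy xy; apply: app_ext => q; rewrite !cutE; congr chi; apply/propext.
by split=> h; have /cst_real hq := leR_isq h; apply: leR_eqR_r h => //; apply: eqR_sym.
Qed.

Lemma cut_isbit x q : isbit (cut x q).
Proof. by rewrite cutE /chi; case: pselect => h; [left|right]. Qed.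

(** Entry [k] is a rational in the cut that has some rational outside the cut less than 2^(-k) above
    it. It is selected from [g] alone, so [uncut] picks one representation for each real. *)
Definition uncut g : D M T1 :=
  dfun (fun k => pick (fun q => g q = 0 /\ exists r, g r <> 0 /\ ratlt r q k)).

Lemma uncutE g k : (exists q r, g q = 0 /\ g r <> 0 /\ ratlt r q k) ->
  g (uncut g k) = 0 /\ exists r, g r <> 0 /\ ratlt r (uncut g k) k.
Proof.
move=> [q [r [gq h]]]; rewrite /uncut dfunE; last by rewrite /pick; rep.
apply: (pickP (P := fun q => g q = 0 /\ exists r, g r <> 0 /\ ratlt r q k)); first by rep.
by exists q; split=> //; exists r.
Qed.

Lemma uncut_cut x : isreal x -> isreal (uncut (cut x)) /\ eqR (uncut (cut x)) x.
Proof.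
move=> hx; have cut0 q : cut x q = 0 <-> leR (cst q) x by rewrite cutE chi0.
have h k : leR (cst (uncut (cut x) k)) x /\
    exists r, isq r /\ ~ leR (cst r) x /\ val r < val (uncut (cut x) k) + pw k.
  have [|/cut0 h1 [r [h2 /ratltE[h3 [_ h4]]]]] := @uncutE (cut x) k; last first.
    by split=> //; exists r; split=> //; split=> // /cut0.
  (* At precision k + 3, the rationals one unit below and two units above [x] straddle it, the upper
     one strictly; their distance 3 * 2^(-k-3) is below 2^(-k). *)
  have [q hq qv] := val_surj (val (x (k + 1 + 1 + 1)) - pw (k + 1 + 1 + 1)).
  have [r hr rv] := val_surj (val (x (k + 1 + 1 + 1)) + 2 * pw (k + 1 + 1 + 1)).
  have p := pw_gt0 (k + 1 + 1 + 1).
  exists q, r; split; first by apply/cut0; apply: cst_lowl; rewrite ?qv.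
  split; first by move=> /cut0/(leR_cstl hr hx)/(_ (k + 1 + 1 + 1)); lra.
  by apply/ratltE; do !split => //; rewrite qv rv !pw_S in p *; lra.
apply: approx_real => // k; have [h1 [r [hr [h2 h3]]]] := h k; first exact: leR_isq h1.
by split=> //; exists r; do !split => //; apply: ltR_leR => //; apply: cst_real.
Qed.

Definition fstN p : D M T0 := pick (fun a => exists b, p = pairN a b).
Definition sndN p : D M T0 := pick (fun b => exists a, p = pairN a b).

Lemma fstNE n m : fstN (pairN n m) = n.
Proof.
have [||b /pairN_inj[]] // := @pickP (fun a => exists b, pairN n m = pairN a b); first by rep.
by exists n, m.
Qed.

Lemma sndNE n m : sndN (pairN n m) = m.
Proof.
have [||b /pairN_inj[]] // := @pickP (fun b => exists a, pairN n m = pairN a b); first by rep.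
by exists m, n.
Qed.

End WithMu.

Ltac rep_unfold ::= progress unfold leN, ltR, inunit, memR, memR2, pick, cut, uncut, fstN, sndN.

(** * From [Delta_CA] to [cocode1] *)

Lemma cocode_of_DeltaCA (M : rca) : DeltaCA M -> cocode M.
Proof.
move=> DCA A [A_ext A_bit] A_unit [x0 [hx0 Ax0]] [Y [Y_ext [Y_inj Y_surj]]].
have hmu : has_mu M.
  (* The real 2 is outside the unit interval and so outside [A], while [x0] is inside. *)
  have two_isq : isq (ratN (1 + 1 : D M T0) 0 0) by exists (1 + 1), 0, 0.
  have one_isq : isq (ratN (1 : D M T0) 0 0) by exists 1, 0, 0.
  apply: (mu_of_nonconstant A_ext hx0 (cst_real two_isq)) => e.
  have [_ [_ /leR_cst]] : inunit (cst (ratN (1 + 1 : D M T0) 0 0)).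
    by apply: A_unit; split; [apply: cst_real|rewrite -e].
  by move=> /(_ two_isq one_isq); rewrite !val_rat !frE_emb !embE !add0r !subr0 !divr1; lra.
(* [f] represents the element with number [n], and [m] is a possible member of its cut. All such
   representations are equal reals with the same cut, so the existential closures of [rel] and
   [rel'] are complementary. *)
pose rel (n m : D M T0) f := memR f A /\ Y f = n /\ cut f m = 0.
pose rel' (n m : D M T0) f := memR f A /\ Y f = n /\ cut f m <> 0.
pose tl (h : D M T1) : D M T1 := dfun (fun k => h (k + 1)).
(* The argument is read as [push n f]: its head codes the pair of an element number and a rational,
   its tail is the representation. *)
pose Y0 : D M T2 := dfun (fun h => chi (rel (fstN hmu (h 0)) (sndN hmu (h 0)) (tl h))).
pose Y1 : D M T2 := dfun (fun h => chi (rel' (fstN hmu (h 0)) (sndN hmu (h 0)) (tl h))).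
have tlE n f : tl (pushD n f) = f.
  by apply: app_ext => k; rewrite /tl dfunE; [exact: pushD_S|rep].
have Y0E n f : Y0 (pushD n f) = 0 <-> rel (fstN hmu n) (sndN hmu n) f.
  rewrite /Y0 dfunE; last by rewrite /rel /tl; rep.
  by rewrite chi0 pushD_0 tlE.
have Y1E n f : Y1 (pushD n f) = 0 <-> rel' (fstN hmu n) (sndN hmu n) f.
  rewrite /Y1 dfunE; last by rewrite /rel' /tl; rep.
  by rewrite chi0 pushD_0 tlE.
have [n|X [_ XE]] := DCA Y0 Y1.
  split=> [[f /Y0E[fA [fY f0]]] [g /Y1E[gA [gY g0]]]|h].
    have e : cut f = cut g.
      by apply: (cut_ext hmu); [case: fA|case: gA|apply: Y_inj => //; rewrite fY].
    by apply: g0; rewrite -e.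
  have [x [xA xY]] := Y_surj (fstN hmu n); exists x; apply/Y0E; do 2!split => //.
  by apply: contrapT => x0'; apply: h; exists x; apply/Y1E.
have XpE n m : X (pairN n m) = 1 <-> exists f, rel n m f.
  by rewrite XE; split=> -[f h]; exists f; move: h; rewrite Y0E fstNE sndNE.
(* Passes from the value 1 for membership in [X] to the value 0 of [chi]; this makes [g (Y x)]
   identical with [cut x]. *)
pose g n : D M T1 := dfun (fun m => chi (X (pairN n m) = 1)).
have gE x : memR x A -> g (Y x) = cut x.
  move=> xA; apply: app_ext => m; rewrite /g dfunE; last by rep.
  rewrite (cutE hmu); congr chi; apply/propext; rewrite XpE; split=> [[f [fA [fY fm]]]|h].
    have e : cut f = cut x by apply: (cut_ext hmu); [case: fA|case: xA|exact: Y_inj].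
    by move: fm; rewrite e (cutE hmu) chi0.
  by exists x; do 2!split => //; rewrite (cutE hmu) chi0.
pose xs : D M (Arr T0 T1) := dfun (fun n => uncut hmu (g n)).
have xsE x : memR x A -> isreal (xs (Y x)) /\ eqR (xs (Y x)) x.
  move=> xA; have -> : xs (Y x) = uncut hmu (g (Y x)) by rewrite /xs dfunE // /g; rep.
  by rewrite gE //; apply: uncut_cut; case: xA.
have xsA x : memR x A -> memR (xs (Y x)) A.
  move=> xA; have [h1 h2] := xsE x xA; split=> //; have [hx <-] := xA.
  exact: A_ext.
exists xs; split=> [n|x hx]; first by have [x [xA <-]] := Y_surj n; apply: xsA.
split=> [xA|[n nx]]; first by exists (Y x); case: (xsE x xA).
have [y [yA yY]] := Y_surj n; have [h1 h2] := xsA _ yA; rewrite yY in h1 h2.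
by split=> //; rewrite -h2; apply: A_ext => //; apply: eqR_sym.
Qed.

(** * Coding pairs of reals by elements of the unit interval *)

Section Coding.
Context {M : rca}.
Hypothesis hmu : has_mu M.
Implicit Types (p q r n m i k : D M T0) (x y z f g : D M T1).

Notation G := (grid (0 : D M T0) 0 1).

Lemma emb1_ge1 : 1 <= emb (1 : D M T0).
Proof. by rewrite emb1. Qed.

Lemma val_unit_grid n i : val (G n i) = emb i * pw n.
Proof. by rewrite val_grid ?emb1_ge1 // !embE subrr add0r divr1. Qed.

Lemma unit_gridE x : isreal x -> leR (cst (G 0 0)) x -> leR x (cst (G 0 1)) -> inunit x.
Proof.
have i0 : isq (ratN (0 : D M T0) 0 0) by exists 0, 0, 0.
have i1 : isq (ratN (1 : D M T0) 0 0) by exists 1, 0, 0.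
move=> hx h0 h1; split=> //; split.
  apply: (leR_trans (cst_real i0) (cst_real (grid_isq _ _ _ 0 0)) hx _ h0).
  apply/leR_cst => //; first exact: grid_isq.
  by rewrite val_unit_grid val_rat frE_emb !embE mul0r subrr mul0r.
apply: (leR_trans hx (cst_real (grid_isq _ _ _ 0 1)) (cst_real i1) h1).
apply/leR_cst => //; first exact: grid_isq.
by rewrite val_unit_grid val_rat frE_emb pw_0 !embE add0r subr0 divr1 mulr1.
Qed.

Lemma inunit_grid x : inunit x -> leR (cst (G 0 0)) x /\ leR x (cst (G 0 1)).
Proof.
have i0 : isq (ratN (0 : D M T0) 0 0) by exists 0, 0, 0.
have i1 : isq (ratN (1 : D M T0) 0 0) by exists 1, 0, 0.
move=> [hx [h0 h1]]; split.
  apply: (leR_trans (cst_real (grid_isq _ _ _ 0 0)) (cst_real i0) hx _ h0).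
  apply/leR_cst => //; first exact: grid_isq.
  by rewrite val_unit_grid val_rat frE_emb !embE mul0r subrr mul0r.
apply: (leR_trans hx (cst_real i1) (cst_real (grid_isq _ _ _ 0 1)) h1).
apply/leR_cst => //; first exact: grid_isq.
by rewrite val_unit_grid val_rat frE_emb pw_0 !embE add0r subr0 divr1 mulr1.
Qed.

(** The zeros of [g] are coded by the binary digits with even index, the other
    digits being 0, so that no two expansions denote the same number. *)
Definition digit g n : Prop := exists m, n = m + m /\ g m = 0.
Definition digits g : D M T1 :=
  dfun (fun n => rec (fun n i => ite (digit g n) (i + i + 1) (i + i)) 0 n).
Definition enc g : D M T1 := grid_lim 0 0 1 (digits g).
(** As digits of odd index are 0, [enc g] lies in the first or third quarter of a dyadic cell of
    length 4^(-m), according to the digit of index 2m. The test asks for a closed first quarter,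
    which never meets a closed third quarter; being a statement about the real, it does not depend
    on the representation. *)
Definition dec z : D M T1 := dfun (fun m => chi (~ exists i,
  leR (cst (G (m + m) i)) z /\ leR z (cst (G (m + m + 1 + 1) (i + i + (i + i) + 1))))).

Lemma digitsE g n : digits g n = rec (fun n i => ite (digit g n) (i + i + 1) (i + i)) 0 n.
Proof. by rewrite /digits dfunE // /digit; rep. Qed.

Lemma digits_0 g : digits g 0 = 0.
Proof. by rewrite digitsE rec0. Qed.

Lemma digits_S g n : digits g (n + 1) =
  ite (digit g n) (digits g n + digits g n + 1) (digits g n + digits g n).
Proof. by rewrite !digitsE [LHS]recS // /digit; rep. Qed.

Lemma digits_step g n : digits g (n + 1) = digits g n + digits g n \/
  digits g (n + 1) = digits g n + digits g n + 1.
Proof. by rewrite digits_S /ite; case: pselect; [right|left]. Qed.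

Lemma enc_real g : isreal (enc g).
Proof. by apply: grid_lim_real; [exact: emb1_ge1|exact: digits_step]. Qed.

Lemma enc_ge g n : leR (cst (G n (digits g n))) (enc g).
Proof. by apply: grid_lim_ge; [exact: emb1_ge1|exact: digits_step]. Qed.

Lemma enc_le g n : leR (enc g) (cst (G n (digits g n + 1))).
Proof. by apply: grid_lim_le; [exact: emb1_ge1|exact: digits_step]. Qed.

Lemma enc_unit g : inunit (enc g).
Proof.
apply: unit_gridE; first exact: enc_real.
  by have := enc_ge g 0; rewrite digits_0.
by have := enc_le g 0; rewrite digits_0 add0r.
Qed.

Lemma digit_even g m : digit g (m + m) <-> g m = 0.
Proof.
split=> [[m' [/(congr1 emb) e]]|h]; last by exists m.
suff -> : m = m' by [].
by apply: emb_inj; move: e; rewrite !embE; lra.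
Qed.

Lemma digit_odd g m : ~ digit g (m + m + 1).
Proof.
move=> [m' [/(congr1 emb)]]; rewrite !embE => e _.
have [/emb_lt1|/emb_lt1|] := ltgtP (emb m) (emb m'); lra.
Qed.

Lemma decE z m : dec z m = chi (~ exists i,
  leR (cst (G (m + m) i)) z /\ leR z (cst (G (m + m + 1 + 1) (i + i + (i + i) + 1)))).
Proof. by rewrite /dec dfunE //; rep. Qed.

Lemma dec_ext z z' : isreal z -> isreal z' -> eqR z z' -> dec z = dec z'.
Proof.
move=> hz hz' zz'; have z'z := eqR_sym zz'; apply: app_ext => m; rewrite !decE; congr chi.
apply/propext; split=> h [i [h1 h2]]; apply: h; exists i.
  split; first exact: (leR_eqR_r hz' hz (cst_real (grid_isq _ _ _ _ _)) z'z).
  exact: (leR_eqR_l hz' hz (cst_real (grid_isq _ _ _ _ _)) z'z).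
split; first exact: (leR_eqR_r hz hz' (cst_real (grid_isq _ _ _ _ _)) zz').
exact: (leR_eqR_l hz hz' (cst_real (grid_isq _ _ _ _ _)) zz').
Qed.

Lemma dec_enc g : (forall m, isbit (g m)) -> dec (enc g) = g.
Proof.
move=> gbit; apply: app_ext => m; rewrite decE; set j := digits g (m + m).
have j2 : digits g (m + m + 1 + 1) = digits g (m + m + 1) + digits g (m + m + 1).
  by rewrite digits_S iteF //; apply: digit_odd.
have [gm|gm] := gbit m; rewrite gm; last first.
  have j1 : digits g (m + m + 1) = j + j.
    by rewrite digits_S iteF // => /digit_even; rewrite gm; apply: oneD_neq0.
  apply: chiF => h; apply: h; exists j; split; first exact: enc_ge.
  by have := enc_le g (m + m + 1 + 1); rewrite j2 j1.
have j1 : digits g (m + m + 1) = j + j + 1.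
  by rewrite digits_S iteT //; apply/digit_even.
apply: chiT => -[i [h1 h2]].
have := cst_between (grid_isq _ _ _ _ _) (grid_isq _ _ _ _ _) (enc_real g) (enc_ge g (m + m + 1 + 1)) h2.
have := cst_between (grid_isq _ _ _ _ _) (grid_isq _ _ _ _ _) (enc_real g) h1 (enc_le g (m + m + 1 + 1)).
rewrite j2 j1 !val_unit_grid !pw_S !embE => a1 a2.
have p := pw_gt0 (m + m).
(* The third quarter of cell [j] would meet the first quarter of cell [i], forcing j < i < j + 1. *)
have b1 : emb i < emb j + 1 by nra.
have b2 : emb j < emb i by nra.
by have := emb_lt1 b2; lra.
Qed.

Definition join f g : D M T1 :=
  dfun (fun n => chi (exists m, (n = m + m /\ f m = 0) \/ (n = m + m + 1 /\ g m = 0))).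
Definition lpart g : D M T1 := dfun (fun m => chi (g (m + m) = 0)).
Definition rpart g : D M T1 := dfun (fun m => chi (g (m + m + 1) = 0)).

Lemma joinE f g n :
  join f g n = chi (exists m, (n = m + m /\ f m = 0) \/ (n = m + m + 1 /\ g m = 0)).
Proof. by rewrite /join dfunE //; rep. Qed.

Lemma chi_isbit P : isbit (chi P : D M T0).
Proof. by rewrite /chi; case: pselect => h; [left|right]. Qed.

Lemma join_isbit f g n : isbit (join f g n).
Proof. by rewrite joinE; apply: chi_isbit. Qed.

Lemma chi_isbitE (a : D M T0) : isbit a -> chi (a = 0) = a.
Proof.
by case=> ->; [apply: chiT|apply: chiF; apply: oneD_neq0].
Qed.

Lemma lpart_join f g : (forall m, isbit (f m)) -> lpart (join f g) = f.
Proof.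
move=> fbit; apply: app_ext => m; rewrite /lpart dfunE; last by rep.
rewrite -[RHS]chi_isbitE //; congr chi; apply/propext; rewrite joinE chi0.
split=> [[m' [[/(congr1 emb) e h]|[/(congr1 emb) e h]]]|h]; last by exists m; left.
  suff -> : m = m' by []; apply: emb_inj; move: e; rewrite !embE; lra.
exfalso; move: e; rewrite !embE => e.
by have [/emb_lt1|/emb_lt1|] := ltgtP (emb m) (emb m'); lra.
Qed.

Lemma rpart_join f g : (forall m, isbit (g m)) -> rpart (join f g) = g.
Proof.
move=> gbit; apply: app_ext => m; rewrite /rpart dfunE; last by rep.
rewrite -[RHS]chi_isbitE //; congr chi; apply/propext; rewrite joinE chi0.
split=> [[m' [[/(congr1 emb) e h]|[/(congr1 emb) e h]]]|h]; last by exists m; right.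
  exfalso; move: e; rewrite !embE => e.
  by have [/emb_lt1|/emb_lt1|] := ltgtP (emb m) (emb m'); lra.
suff -> : m = m' by []; apply: emb_inj; move: e; rewrite !embE; lra.
Qed.

(** Through the cuts, equal arguments give the identical code and not merely an equal real. *)
Definition pair_real x y : D M T1 := enc (join (cut x) (cut y)).
Definition fst_real z : D M T1 := uncut hmu (lpart (dec z)).
Definition snd_real z : D M T1 := uncut hmu (rpart (dec z)).

Lemma pair_real_ext x y x' y' : isreal x -> isreal y -> isreal x' -> isreal y' ->
  eqR x x' -> eqR y y' -> pair_real x y = pair_real x' y'.
Proof.
move=> hx hy hx' hy' xx' yy'; have e := cut_ext hmu hx hx' xx'; have e' := cut_ext hmu hy hy' yy'.
by rewrite /pair_real e e'.
Qed.

Lemma fst_real_ext z z' : isreal z -> isreal z' -> eqR z z' -> fst_real z = fst_real z'.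
Proof. by move=> hz hz' zz'; rewrite /fst_real (dec_ext hz hz' zz'). Qed.

Lemma snd_real_ext z z' : isreal z -> isreal z' -> eqR z z' -> snd_real z = snd_real z'.
Proof. by move=> hz hz' zz'; rewrite /snd_real (dec_ext hz hz' zz'). Qed.

Lemma fst_pair_real x y : isreal x -> isreal (fst_real (pair_real x y)) /\ eqR (fst_real (pair_real x y)) x.
Proof.
move=> hx; rewrite /fst_real /pair_real dec_enc; last exact: join_isbit.
by rewrite lpart_join; [apply: uncut_cut|exact: (cut_isbit hmu)].
Qed.

Lemma snd_pair_real x y : isreal y -> isreal (snd_real (pair_real x y)) /\ eqR (snd_real (pair_real x y)) y.
Proof.
move=> hy; rewrite /snd_real /pair_real dec_enc; last exact: join_isbit.
by rewrite rpart_join; [apply: uncut_cut|exact: (cut_isbit hmu)].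
Qed.

(** Elements of the model for the coding maps, which later proofs of representability can treat as
    constants. *)
Definition fst_map : D M (Arr T1 T1) := dfun fst_real.
Definition snd_map : D M (Arr T1 T1) := dfun snd_real.
Definition pair_map : D M (Arr T1 (Arr T1 T1)) := dfun (fun x => dfun (pair_real x)).

Lemma fst_mapE z : fst_map z = fst_real z.
Proof. by rewrite /fst_map dfunE // /fst_real /lpart /dec; rep. Qed.

Lemma snd_mapE z : snd_map z = snd_real z.
Proof. by rewrite /snd_map dfunE // /snd_real /rpart /dec; rep. Qed.

Lemma pair_mapE x y : pair_map x y = pair_real x y.
Proof.
rewrite /pair_map dfunE; last by rewrite /pair_real /enc /grid_lim /digits /digit /join; rep.
by rewrite dfunE // /pair_real /enc /grid_lim /digits /digit /join; rep.
Qed.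

End Coding.

(** Changing one coordinate at a time, the value changes along one of the two steps, and the other
    coordinate can be frozen there. *)
Lemma mu_of_nonconstant2 (M : rca) (F : D M (Arr T1 T2)) x y x' y' : funR2 F ->
  isreal x -> isreal y -> isreal x' -> isreal y' -> F x y <> F x' y' -> has_mu M.
Proof.
move=> F_ext hx hy hx' hy' ne; have [e|ne1] := pselect (F x y = F x' y).
  apply: (@mu_of_nonconstant M (F x') _ y y') => //; last by rewrite -e.
  by move=> u v hu hv uv; apply: F_ext => //; apply: eqR_refl.
apply: (@mu_of_nonconstant M (dfun (fun u => F u y)) _ x x') => //; last first.
  by rewrite !dfunE //; rep.
move=> u v hu hv uv; rewrite !dfunE; [|by rep..].
by apply: F_ext => //; apply: eqR_refl.
Qed.

Opaque ratlt ratle isreal leR eqR fst_real snd_real pair_real.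

(** * Finite subcovers *)

Section Subcover.
Context {M : rca}.
Hypothesis hmu : has_mu M.
Implicit Types (p q r n m i k l : D M T0) (x y z : D M T1).
Variables a b : D M (Arr T0 T1).
Hypotheses (a_real : forall m, isreal (a m)) (b_real : forall m, isreal (b m)).
Hypothesis ab_cover : forall x, inunit x -> exists m, ltR (a m) x /\ ltR x (b m).

Notation G := (grid (0 : D M T0) 0 1).

Definition covers l i m : Prop := ltR (a m) (cst (G l i)) /\ ltR (cst (G l (i + 1))) (b m).

(** Infinitely many dyadic subintervals of [i / 2^n, (i + 1) / 2^n] are not
    contained in a single interval of the cover. *)
Definition bad n i : Prop := forall l0, exists l k, ~ ltD l l0 /\
  ~ ltD (k * p2 n) (i * p2 l) /\ ~ ltD ((i + 1) * p2 l) ((k + 1) * p2 n) /\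
  ~ exists m, covers l k m.

(** Were both halves good from levels [l0] and [l1] on, an uncovered cell of a level beyond these
    and [n + 1] would still lie in one of the halves, because dyadic cells do not straddle the
    midpoint. *)
Lemma bad_split n i : bad n i -> bad (n + 1) (i + i) \/ bad (n + 1) (i + i + 1).
Proof.
move=> h; apply: contrapT => /not_orP[/existsNP[l0 h0] /existsNP[l1 h1]].
have [l [k [/ltD_nemb ll [/ltD_nemb k1 [/ltD_nemb k2 nc]]]]] := h (l0 + l1 + (n + 1)).
have ge0 := (emb_ge0 l0, emb_ge0 l1, emb_ge0 n).
have [e lE] : exists e, l = (n + 1) + e.
  by apply: emb_leP; move: ll; rewrite !embE; case: ge0 => [[]]; lra.
have pS : p2 (n + 1) = p2 n + p2 n by apply: p2_S.
have plE : emb (p2 l) = emb (p2 (n + 1)) * emb (p2 e) by rewrite lE p2_add embM.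
have P0 := p2_gt0 (n + 1).
have mulP u v : u <= v -> u * emb (p2 (n + 1)) <= v * emb (p2 (n + 1)).
  by move=> uv; apply: ler_wpM2r => //; apply: ltW.
move: k1 k2; rewrite !embE => k1 k2.
have [lt|le] := ltP (emb k) (emb ((i + i + 1) * p2 e)).
  apply: h0; exists l, k; split; first by apply/ltD_nemb; move: ll; rewrite !embE; case: ge0 => [[]]; lra.
  split; first by apply/ltD_nemb; rewrite pS !embE; move: k1; lra.
  split=> //; apply/ltD_nemb; have := mulP _ _ (emb_lt1 lt).
  by rewrite !embE plE; lra.
apply: h1; exists l, k; split; first by apply/ltD_nemb; move: ll; rewrite !embE; case: ge0 => [[]]; lra.
split; last by split=> //; apply/ltD_nemb; rewrite pS !embE; move: k2; lra.
apply/ltD_nemb; have := mulP _ _ le.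
by rewrite !embE plE; lra.
Qed.

(** Bisection along bad cells converges to a point [c]. An interval of the cover contains [c] with
    some margin, hence also every cell inside a small enough bad cell around [c]. *)
Lemma not_bad : ~ bad 0 0.
Proof.
move=> bad0.
have rbad : @RpP M [:: T0; T0] (fun e => bad e.2.1 e.1) by rewrite /bad /covers; rep.
(* [bad] is arithmetical, so [mu] decides it and the bisection can be defined by recursion. *)
pose bad_code : D M (Arr T0 T1) := dfun (fun n => dfun (fun i => chi (bad n i))).
have bad_codeE n i : bad n i <-> bad_code n i = 0.
  have [h hE] := rbad; rewrite /bad_code dfunE; last by rep.
  rewrite dfunE ?chi0 //; exists (h n : D M T1) => -[i' []] /=; exact: (hE (i', (n, tt))).
pose j : D M T1 := dfun (fun n =>
  rec (fun n i => ite (bad_code (n + 1) (i + i) = 0) (i + i) (i + i + 1)) 0 n).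
have jE n : j n = rec (fun n i => ite (bad_code (n + 1) (i + i) = 0) (i + i) (i + i + 1)) 0 n.
  by rewrite /j dfunE //; rep.
have j0 : j 0 = 0 by rewrite jE rec0.
have jS n : j (n + 1) = ite (bad_code (n + 1) (j n + j n) = 0) (j n + j n) (j n + j n + 1).
  by rewrite !jE [LHS]recS //; rep.
have jstep n : j (n + 1) = j n + j n \/ j (n + 1) = j n + j n + 1.
  by rewrite jS /ite; case: pselect; [left|right].
have jbad n : bad n (j n).
  apply/bad_codeE; apply: (indP (P := fun n => bad_code n (j n) = 0)) => [||m /bad_codeE IH].
  - by rep.
  - by apply/bad_codeE; rewrite j0.
  rewrite [addD m oneD]/(m + 1) jS; have [e|ne] := pselect (bad_code (m + 1) (j m + j m) = 0).
    by rewrite iteT.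
  by rewrite iteF //; apply/bad_codeE; have [/bad_codeE|] := bad_split IH.
have d1 := @emb1_ge1 M.
pose c := grid_lim 0 0 1 j; have c_real : isreal c by apply: grid_lim_real.
have c_ge n : leR (cst (G n (j n))) c by apply: grid_lim_ge.
have c_le n : leR c (cst (G n (j n + 1))) by apply: grid_lim_le.
have [|m [ac cb]] := ab_cover (x := c).
  apply: unit_gridE => //; first by have := c_ge 0; rewrite j0.
  by have := c_le 0; rewrite j0 add0r.
have [e e0 [N1 h1]] := (ltR_evP (a_real m) c_real).1 ac.
have [e' e'0 [N2 h2]] := (ltR_evP c_real (b_real m)).1 cb.
(* A quarter of the margin leaves room for three errors of at most [pw n]: the length of the cell
   and the approximations to [c] and to the endpoint of the interval. *)
have [n1 n1e] := @pw_lim M (e / 4) ltac:(by lra).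
have [n2 n2e] := @pw_lim M (e' / 4) ltac:(by lra).
have [n [/pw_le n1n /pw_le n2n]] := emb_max n1 n2.
have [N [N1N N2N]] := emb_max N1 N2; have [K [nK NK]] := emb_max n N.
have {N1N}h1 := h1 K (le_trans N1N NK); have {N2N}h2 := h2 K (le_trans N2N NK).
have pK := pw_le nK.
have [l [k [_ [/ltD_nemb k1 [/ltD_nemb k2 nc]]]]] := jbad n 0.
apply: nc; exists m.
have gc := (leR_cstl (grid_isq _ _ _ _ _) c_real).1 (c_ge n) K.
have cg := (leR_cstr (grid_isq _ _ _ _ _) c_real).1 (c_le n) K.
move: k1 k2 gc cg; rewrite !val_unit_grid !embE => k1 k2 gc cg.
have scale u v : u * emb (p2 l) <= v * emb (p2 n) -> u * pw n <= v * pw l.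
  have pp : 0 <= pw n * pw l by apply: mulr_ge0; apply/ltW/pw_gt0.
  move=> /(ler_wpM2r pp); have -> : u * emb (p2 l) * (pw n * pw l) = u * pw n * (emb (p2 l) * pw l) by ring.
  have -> : v * emb (p2 n) * (pw n * pw l) = v * pw l * (emb (p2 n) * pw n) by ring.
  by rewrite !p2_pw !mulr1.
have scale' u v : u * emb (p2 n) <= v * emb (p2 l) -> u * pw l <= v * pw n.
  have pp : 0 <= pw n * pw l by apply: mulr_ge0; apply/ltW/pw_gt0.
  move=> /(ler_wpM2r pp); have -> : u * emb (p2 n) * (pw n * pw l) = u * pw l * (emb (p2 n) * pw n) by ring.
  have -> : v * emb (p2 l) * (pw n * pw l) = v * pw n * (emb (p2 l) * pw l) by ring.
  by rewrite !p2_pw !mulr1.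
have {}k1 := scale _ _ k1; have {}k2 := scale' _ _ k2.
split.
  by apply: (@cst_gtr _ _ _ K) => //; [exact: grid_isq|rewrite val_unit_grid; lra].
by apply: (@cst_ltl _ _ _ K) => //; [exact: grid_isq|rewrite val_unit_grid !embE; lra].
Qed.

(** If no cell contained [x], induction would place [x] to the right of every left endpoint; but [x]
    is at most 1, so the last cell contains it. *)
Lemma unit_grid_interval l x : inunit x -> exists2 i, ltD i (p2 l) &
  leR (cst (G l i)) x /\ leR x (cst (G l (i + 1))).
Proof.
move=> ux; have [hx _] := ux; have [x0 x1] := inunit_grid ux.
have gE n i m k : emb i * pw n = emb k * pw m -> eqR (cst (G n i)) (cst (G m k)).
  by move=> e; apply: eqR_cst; rewrite ?val_unit_grid //; apply: grid_isq.
have gr n i : isreal (cst (G n i)) by apply: cst_real; apply: grid_isq.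
apply: contrapT => no.
have all_le i : ltD i (p2 l) -> leR (cst (G l i)) x.
  apply: (indP (P := fun i => ltD i (p2 l) -> leR (cst (G l i)) x)) => [||k IH]; first by rep.
    by move=> _; apply: (leR_eqR_l (gr 0 0) (gr l 0) hx) x0; apply: gE; rewrite emb0 !mul0r.
  move=> lt; have kl : ltD k (p2 l) by apply: ltD_trans (ltD_S k) lt.
  apply: contrapT => nle; apply: no; exists k => //; split; first exact: IH.
  exact: ltR_leR.
have pl := p2_gt0 l; apply: no; exists (predN (p2 l)).
  by apply/ltDE; have := emb_predN pl; lra.
split; first by apply: all_le; apply/ltDE; have := emb_predN pl; lra.
apply: (leR_eqR_r (gr 0 1) (gr l (predN (p2 l) + 1)) hx) x1; apply: gE.
by rewrite embD !emb1 emb_predN // p2_pw pw_0 mul1r.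
Qed.

(** As the whole interval is not bad, all its cells of some level [l] are covered. Choice assigns to
    each of the 2^l cells an interval of the cover containing it. *)
Lemma finite_subcover : exists l, exists f : D M T1, forall x, inunit x ->
  exists i, ltD i (p2 l) /\ ltR (a (f i)) x /\ ltR x (b (f i)).
Proof.
have /existsNP[l nb] := not_bad.
have cov k : ltD k (p2 l) -> exists m, covers l k m.
  move=> lt; apply: contrapT => nc; apply: nb; exists l, k; split; first exact: ltD_irr.
  split; first by rewrite p2_0 mulr1 mul0r; apply: ltD_ge0.
  split=> //; apply/ltD_nemb; rewrite p2_0 !embE.
  by have /ltDE/emb_lt1 := lt; lra.
have [||f fP] := @choice0 M (fun k m => ltD k (p2 l) -> covers l k m).
- by rewrite /covers; rep.
- move=> k; have [/cov[m hm]|nlt] := pselect (ltD k (p2 l)); first by exists m.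
  by exists 0.
exists l, f => x ux; have [i il [h1 h2]] := unit_grid_interval l ux; have [hx _] := ux.
have [c1 c2] := fP i il; have gr n k : isreal (cst (G n k)) by apply: cst_real; apply: grid_isq.
exists i; split=> //; split; first exact: ltR_leR_trans c1 h1.
exact: leR_ltR_trans h2 c2.
Qed.

End Subcover.

(** * From [cocode1] to [HBC1] *)

Lemma HBC_of_cocode (M : rca) : cocode M -> HBC M.
Proof.
move=> coc A [A_ext A_bit] [Y [Y_ext [Y_inj Y_surj]]] A_cover.
have [x0 [y0 [A0 _]]] := Y_surj 0.
have [hx0 [hy0 Axy0]] := A0.
have hmu : has_mu M.
  have i0 : isq (ratN (0 : D M T0) 0 0) by exists 0, 0, 0.
  have i1 : isq (ratN (1 : D M T0) 0 0) by exists 1, 0, 0.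
  have r0 := cst_real i0; have r1 := cst_real i1.
  set o := cst (ratN 0 0 0) in r0; set u := cst (ratN 1 0 0) in r1.
  (* If (0,0) or (1,0) is outside [A], the member (x0, y0) shows that [A] is not constant; otherwise
     [Y] separates the two points. *)
  have [e|ne] := pselect (A o o = 1); last first.
    by apply: (mu_of_nonconstant2 A_ext hx0 hy0 r0 r0); rewrite Axy0 => /esym.
  have [e'|ne] := pselect (A u o = 1); last first.
    by apply: (mu_of_nonconstant2 A_ext hx0 hy0 r1 r0); rewrite Axy0 => /esym.
  apply: (mu_of_nonconstant2 Y_ext r1 r0 r0 r0) => eY.
  have [//|//|/eqR_leR[/leR_cst - /(_ i1 i0)]] := Y_inj u o o o _ _ eY.
  by rewrite !val_rat !frE_emb !embE !add0r !subr0 !divr1; lra.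
(* The last conjunct admits only codes of pairs: several reals could decode to one pair, and [Y']
   has to be injective on the new set. *)
pose T z := inunit z /\ memR2 (fst_real hmu z) (snd_real hmu z) A /\
  eqR (pair_real (fst_real hmu z) (snd_real hmu z)) z.
pose A' : D M T2 := dfun (fun z => ite (T z) 1 0).
pose Y' : D M T2 := dfun (fun z => Y (fst_map hmu z) (snd_map hmu z)).
(* With the coding maps as elements of the model, [T] takes a form in which its representability is
   evident. *)
have TE : T = fun z => inunit z /\ memR2 (fst_map hmu z) (snd_map hmu z) A /\
    eqR (pair_map (fst_map hmu z) (snd_map hmu z)) z.
  by apply: funext => z; rewrite fst_mapE snd_mapE pair_mapE.
have A'E z : A' z = ite (T z) 1 0 by rewrite /A' dfunE // TE; rep.
have Y'E z : Y' z = Y (fst_real hmu z) (snd_real hmu z) by rewrite /Y' dfunE ?fst_mapE ?snd_mapE //; rep.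
have memE z : memR z A' <-> T z.
  rewrite /memR A'E; split=> [[_]|Tz]; last by split; [case: Tz => -[]|rewrite iteT].
  by rewrite /ite; case: pselect => // _ /esym/oneD_neq0.
have fst_ext := fst_real_ext hmu; have snd_ext := snd_real_ext hmu.
have T_ext z z' : isreal z -> isreal z' -> eqR z z' -> T z -> T z'.
  move=> hz hz' zz' [[_ [h0 h1]] [h2 h3]].
  have i0 : isreal (cst (ratN (0 : D M T0) 0 0)) by apply: cst_real; exists 0, 0, 0.
  have i1 : isreal (cst (ratN (1 : D M T0) 0 0)) by apply: cst_real; exists 1, 0, 0.
  split; first by split=> //; split; [exact: leR_eqR_r h0|exact: leR_eqR_l h1].
  rewrite /T -(fst_ext _ _ hz hz' zz') -(snd_ext _ _ hz hz' zz'); split; first exact: h2.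
  by apply: (eqR_trans _ hz hz' h3 zz'); apply: enc_real.
have pair_mem x y : memR2 x y A -> T (pair_real x y).
  move=> [hx [hy Axy]]; have [fr fe] := fst_pair_real hmu y hx; have [sr se] := snd_pair_real hmu x hy.
  split; first exact: enc_unit.
  split; first by do 2!split => //; rewrite -Axy; apply: A_ext.
  rewrite (pair_real_ext hmu fr sr hx hy fe se); apply: eqR_refl; exact: enc_real.
have A'_set : setR A'.
  split=> [z z' hz hz' zz'|z _]; last by rewrite A'E /ite; case: pselect; [right|left].
  rewrite !A'E; have -> // : T z = T z'.
  by apply/propext; split; apply: T_ext => //; apply: eqR_sym.
have A'_count : scount A'.
  exists Y'; split=> [z z' hz hz' zz'|]; first by rewrite !Y'E (fst_ext z z') // (snd_ext z z').
  split=> [z z' /memE[[hz _] [h1 h2]] /memE[[hz' _] [h1' h2']]|n].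
    rewrite !Y'E => /(Y_inj _ _ _ _ h1 h1')[e1 e2].
    have [fr [sr _]] := h1; have [fr' [sr' _]] := h1'.
    move: h2; rewrite (pair_real_ext hmu fr sr fr' sr' e1 e2) => h2.
    by apply: (eqR_trans hz _ hz' _ h2'); [apply: enc_real|apply: eqR_sym].
  have [x [y [xyA <-]]] := Y_surj n; exists (pair_real x y); split; first by apply/memE/pair_mem.
  have [hx [hy _]] := xyA; rewrite Y'E.
  have [fr fe] := fst_pair_real hmu y hx; have [sr se] := snd_pair_real hmu x hy.
  exact: Y_ext.
have A'_ne : exists z, memR z A' by exists (pair_real x0 y0); apply/memE/pair_mem.
have [zs [zsA zsE]] := coc A' A'_set (fun z h => ((memE z).1 h).1) A'_ne A'_count.
pose a : D M (Arr T0 T1) := dfun (fun n => fst_map hmu (zs n)).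
pose b : D M (Arr T0 T1) := dfun (fun n => snd_map hmu (zs n)).
have aE n : a n = fst_real hmu (zs n) by rewrite /a dfunE ?fst_mapE //; rep.
have bE n : b n = snd_real hmu (zs n) by rewrite /b dfunE ?snd_mapE //; rep.
have abA n : memR2 (a n) (b n) A by rewrite aE bE; have /memE[_ []] := zsA n.
have a_real n : isreal (a n) by case: (abA n).
have b_real n : isreal (b n) by case: (abA n) => _ [].
have cover x : inunit x -> exists m, ltR (a m) x /\ ltR x (b m).
  move=> ux; have [hx _] := ux; have [u [v [uvA [ux' xv]]]] := A_cover x ux.
  have [hu [hv _]] := uvA; have zr : isreal (pair_real u v) by apply: enc_real.
  have [m zm] := (zsE _ zr).1 ((memE _).2 (pair_mem _ _ uvA)).
  have [zmr _] := zsA m.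
  have [fr fe] := fst_pair_real hmu v hu; have [sr se] := snd_pair_real hmu u hv.
  have /eqR_leR[am _] : eqR (a m) u by rewrite aE (fst_ext _ _ zmr zr zm).
  have /eqR_leR[_ vm] : eqR (b m) v by rewrite bE (snd_ext _ _ zmr zr zm).
  exists m; split; first exact: leR_ltR_trans am ux'.
  exact: ltR_leR_trans xv vm.
have [l [f fP]] := finite_subcover hmu a_real b_real cover.
(* The list is given by its last index, and 2^l intervals have last index 2^l - 1. *)
exists (predN (p2 l)), (dfun (fun i => a (f i))), (dfun (fun i => b (f i))).
have pE : predN (p2 l) + 1 = p2 l.
  by apply: emb_inj; rewrite embD emb1 emb_predN // p2_gt0.
have dE (c : D M (Arr T0 T1)) i : dfun (fun i => c (f i)) i = c (f i) by rewrite dfunE //; rep.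
rewrite pE; split=> [i _|x ux]; first by rewrite !dE.
by have [i [il h]] := fP x ux; exists i; rewrite !dE.
Qed.

Lemma cocode1_of_Delta_CA : RCA0w_proves (Imp Delta_CA cocode1).
Proof.
apply: completeness => M hM rho; rewrite sat_Imp.
rewrite (sat_Delta_CA (M := Rca hM)) (sat_cocode1 (M := Rca hM)).
exact: cocode_of_DeltaCA.
Qed.

Lemma HBC1_of_cocode1 : RCA0w_proves (Imp (And cocode1 WKL) HBC1).
Proof.
apply: completeness => M hM rho; rewrite sat_Imp sat_And => -[].
rewrite (sat_cocode1 (M := Rca hM)) (sat_HBC1 (M := Rca hM)) => h _.
exact: HBC_of_cocode h.
Qed.

End Models.

Import Defs.
Local Open Scope lomega_scope.

Theorem corollary3p36 :
  RCA0w_proves (Delta_CA ==> cocode1) /\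
  RCA0w_proves (cocode1 &&& WKL ==> HBC1).
Proof. exact (conj Models.cocode1_of_Delta_CA Models.HBC1_of_cocode1). Qed.
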